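(* There is a model structure on $\mathrm{Ch}(H)$ where the cofibrations are the maps $g$ such that $Fg$ is a monomorphism and the weak equivalences are the maps $g$ such that $Fg$ is a quasi-isomorphism. The fibrations are the maps satisfying the right lifting property with respect to all trivial cofibrations.
   Context: Let $k$ be a field of characteristic $p>0$ and $G$ a topological group (possibly discrete) admitting an open pro-$p$ subgroup $I$. $\mathrm{Rep}_k^\infty(G)$ is the category of smooth $k$-linear $G$-representations (stabilizers of vectors are open). $\mathbb{X}=\mathrm{ind}_I^G(k)$ is the space of compactly supported $f:G\to k$ with $f(gi)=f(g)$ for $i\in I$, with action $(gf)(g')=f(g^{-1}g')$; $H=\mathrm{End}_G(\mathbb{X})^{\mathrm{op}}$, so $\mathbb{X}$ is a right $H$-module. $\mathrm{Ch}(H)$ and $\mathrm{Ch}(G)$ are the categories of unbounded chain complexes of left $H$-modules and of objects of $\mathrm{Rep}^\infty_k(G)$, and $F:\mathrm{Ch}(H)\to\mathrm{Ch}(G)$ is given termwise by $FM=\mathbb{X}\otimes_HM$. A trivial cofibration is a cofibration that is also a weak equivalence. Model structures are in the sense of Hovey's book (with functorial factorizations). *)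

(* Defs.v *)
From HB Require Import structures.
From mathcomp Require Import all_boot all_order all_algebra.
From mathcomp Require Import all_classical topology.

Set Implicit Arguments.
Unset Strict Implicit.
Unset Printing Implicit Defensive.

Import GRing.Theory.

Local Open Scope classical_set_scope.
Local Open Scope quotient_scope.
Local Open Scope card_scope.
Local Open Scope ring_scope.

Record category := Category {
  obj :> Type;
  mor : obj -> obj -> Type;
  idm : forall X, mor X X;
  mcomp : forall X Y Z, mor Y Z -> mor X Y -> mor X Z;
  compA : forall X Y Z T (h : mor Z T) (g : mor Y Z) (f : mor X Y),
    mcomp h (mcomp g f) = mcomp (mcomp h g) f;
  comp1m : forall X Y (f : mor X Y), mcomp (idm Y) f = f;
  compm1 : forall X Y (f : mor X Y), mcomp f (idm X) = f }.

Arguments mor {c} _ _.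
Arguments idm {c} X.
Arguments mcomp {c X Y Z} _ _.

Declare Scope category_scope.
Delimit Scope category_scope with cat.
Notation "g '\;o' f" := (mcomp g f) (at level 50, format "g  \;o  f") :
  category_scope.
Local Open Scope category_scope.

Definition monomorphism (C : category) (X Y : C) (f : mor X Y) : Prop :=
  forall (Z : C) (u v : mor Z X), f \;o u = f \;o v -> u = v.

Record functor (C D : category) := Functor {
  fobj :> C -> D;
  fmor : forall X Y, mor X Y -> mor (fobj X) (fobj Y);
  fmor_id : forall X, fmor (idm X) = idm (fobj X);
  fmor_comp : forall X Y Z (g : mor Y Z) (f : mor X Y),
    fmor (g \;o f) = fmor g \;o fmor f }.

Arguments fmor {C D} _ {X Y} _.

(* Zero morphisms are the only part of the additive structure needed to speak
   of complexes. *)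
Record zcategory := ZCategory {
  zcat :> category;
  zerom : forall X Y : zcat, mor X Y;
  comp0m : forall (X Y Z : zcat) (f : mor X Y), zerom Y Z \;o f = zerom X Z;
  compm0 : forall (X Y Z : zcat) (f : mor Y Z), f \;o zerom X Y = zerom X Z }.

Arguments zerom {z} X Y.

Record zfunctor (C D : zcategory) := ZFunctor {
  zfun :> functor C D;
  fmor0 : forall X Y : C, fmor zfun (zerom X Y) = zerom (zfun X) (zfun Y) }.

Section Complexes.
Variable C : zcategory.

Record complex := Complex {
  cobj :> int -> C;
  cdiff : forall n : int, mor (cobj n) (cobj (n - 1));
  cdiffK : forall n : int, cdiff (n - 1) \;o cdiff n = zerom _ _ }.

Record chain_map (X Y : complex) := ChainMap {
  cmap :> forall n : int, mor (X n) (Y n);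
  cmap_diff : forall n : int, cdiff Y n \;o cmap n = cmap (n - 1) \;o cdiff X n }.

Lemma chain_map_ext (X Y : complex) (f g : chain_map X Y) :
  (forall n, f n = g n) -> f = g.
Proof.
case: f g => [f fP] [g gP] /= fg.
have {}fg : f = g by exact: functional_extensionality_dep.
by subst g; congr ChainMap; exact: Prop_irrelevance.
Qed.

Program Definition chain_id (X : complex) : chain_map X X :=
  @ChainMap X X (fun n => idm (X n)) _.
Next Obligation. by move=> X n; rewrite compm1 comp1m. Qed.

Program Definition chain_comp (X Y Z : complex) (g : chain_map Y Z)
    (f : chain_map X Y) : chain_map X Z :=
  @ChainMap X Z (fun n => g n \;o f n) _.
Next Obligation.
by move=> X Y Z g f n; rewrite compA cmap_diff -compA cmap_diff compA.
Qed.

Program Definition Ch : category :=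
  @Category complex chain_map chain_id chain_comp _ _ _.
Next Obligation.
by move=> X Y Z T h g f; apply: chain_map_ext => n /=; rewrite compA.
Qed.
Next Obligation. by move=> X Y f; apply: chain_map_ext => n /=; rewrite comp1m. Qed.
Next Obligation. by move=> X Y f; apply: chain_map_ext => n /=; rewrite compm1. Qed.

End Complexes.

Section TermwiseFunctor.
Variables (C D : zcategory) (F : zfunctor C D).

Program Definition Ch_obj (X : complex C) : complex D :=
  @Complex D (fun n => F (X n)) (fun n => fmor F (cdiff X n)) _.
Next Obligation. by move=> X n; rewrite -fmor_comp cdiffK fmor0. Qed.

Program Definition Ch_map (X Y : complex C) (f : chain_map X Y) :
    chain_map (Ch_obj X) (Ch_obj Y) :=
  @ChainMap D (Ch_obj X) (Ch_obj Y) (fun n => fmor F (f n)) _.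
Next Obligation. by move=> X Y f n /=; rewrite -!fmor_comp cmap_diff. Qed.

Program Definition Ch_functor : functor (Ch C) (Ch D) :=
  @Functor (Ch C) (Ch D) Ch_obj Ch_map _ _.
Next Obligation. by move=> X; apply: chain_map_ext => n /=; rewrite fmor_id. Qed.
Next Obligation.
by move=> X Y Z g f; apply: chain_map_ext => n /=; rewrite fmor_comp.
Qed.

End TermwiseFunctor.

Section ModelStructures.
Variable C : category.

Definition morphism_class := forall X Y : C, mor X Y -> Prop.

Definition cap_class (P Q : morphism_class) : morphism_class :=
  fun X Y f => P X Y f /\ Q X Y f.

Definition subcategory (P : morphism_class) : Prop :=
  (forall X, P X X (idm X)) /\
  (forall X Y Z (g : mor Y Z) (f : mor X Y), P _ _ g -> P _ _ f ->
     P _ _ (g \;o f)).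

Definition lifts (A B X Y : C) (i : mor A B) (q : mor X Y) : Prop :=
  forall (u : mor A X) (v : mor B Y), q \;o u = v \;o i ->
    exists h : mor B X, h \;o i = u /\ q \;o h = v.

Definition rlp (P : morphism_class) : morphism_class :=
  fun X Y q => forall (A B : C) (i : mor A B), P A B i -> lifts i q.

Definition retract (A B X Y : C) (f : mor A B) (g : mor X Y) : Prop :=
  exists (i : mor A X) (r : mor X A) (j : mor B Y) (s : mor Y B),
    [/\ r \;o i = idm A, s \;o j = idm B,
        g \;o i = j \;o f & f \;o r = s \;o g].

Definition retract_closed (P : morphism_class) : Prop :=
  forall (A B X Y : C) (f : mor A B) (g : mor X Y),
    retract f g -> P _ _ g -> P _ _ f.

Definition two_of_three (P : morphism_class) : Prop :=
  forall (X Y Z : C) (f : mor X Y) (g : mor Y Z),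
    [/\ P _ _ f -> P _ _ g -> P _ _ (g \;o f),
        P _ _ f -> P _ _ (g \;o f) -> P _ _ g
      & P _ _ g -> P _ _ (g \;o f) -> P _ _ f].

(* The two functors C^2 -> C^2 of a functorial factorization take the value
   fact_left f : X -> E f and fact_right f : E f -> Y at f : X -> Y, and the
   values (u, fact_mid sq) and (fact_mid sq, v) at a square sq = (u, v). *)
Record functorial_factorization := FunctorialFactorization {
  fact_obj : forall X Y : C, mor X Y -> C;
  fact_left : forall (X Y : C) (f : mor X Y), mor X (fact_obj f);
  fact_right : forall (X Y : C) (f : mor X Y), mor (fact_obj f) Y;
  fact_mid : forall (X Y X' Y' : C) (f : mor X Y) (f' : mor X' Y')
    (u : mor X X') (v : mor Y Y'), f' \;o u = v \;o f ->
    mor (fact_obj f) (fact_obj f');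
  factE : forall (X Y : C) (f : mor X Y), fact_right f \;o fact_left f = f;
  fact_mid_left : forall (X Y X' Y' : C) (f : mor X Y) (f' : mor X' Y')
    (u : mor X X') (v : mor Y Y') (sq : f' \;o u = v \;o f),
    fact_mid sq \;o fact_left f = fact_left f' \;o u;
  fact_mid_right : forall (X Y X' Y' : C) (f : mor X Y) (f' : mor X' Y')
    (u : mor X X') (v : mor Y Y') (sq : f' \;o u = v \;o f),
    fact_right f' \;o fact_mid sq = v \;o fact_right f;
  fact_mid_id : forall (X Y : C) (f : mor X Y)
    (sq : f \;o idm X = idm Y \;o f), fact_mid sq = idm (fact_obj f);
  fact_mid_comp : forall (X Y X' Y' X'' Y'' : C)
    (f : mor X Y) (f' : mor X' Y') (f'' : mor X'' Y'')
    (u : mor X X') (v : mor Y Y') (u' : mor X' X'') (v' : mor Y' Y'')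
    (sq : f' \;o u = v \;o f) (sq' : f'' \;o u' = v' \;o f')
    (sq'' : f'' \;o (u' \;o u) = (v' \;o v) \;o f),
    fact_mid sq'' = fact_mid sq' \;o fact_mid sq }.

(* A model structure in the sense of Hovey, Model Categories, 1.1.3: cof_tfib
   and tcof_fib are his functorial factorizations (alpha, beta) and
   (gamma, delta). *)
Record model_structure := ModelStructure {
  weq : morphism_class;
  cof : morphism_class;
  fib : morphism_class;
  cof_tfib : functorial_factorization;
  tcof_fib : functorial_factorization;
  weq_subcategory : subcategory weq;
  cof_subcategory : subcategory cof;
  fib_subcategory : subcategory fib;
  weq_two_of_three : two_of_three weq;
  weq_retract : retract_closed weq;
  cof_retract : retract_closed cof;
  fib_retract : retract_closed fib;
  tcof_lift : forall (A B X Y : C) (i : mor A B) (q : mor X Y),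
    cap_class cof weq i -> fib q -> lifts i q;
  cof_lift : forall (A B X Y : C) (i : mor A B) (q : mor X Y),
    cof i -> cap_class fib weq q -> lifts i q;
  cof_tfibP : forall (X Y : C) (f : mor X Y),
    cof (fact_left cof_tfib f) /\ cap_class fib weq (fact_right cof_tfib f);
  tcof_fibP : forall (X Y : C) (f : mor X Y),
    cap_class cof weq (fact_left tcof_fib f) /\ fib (fact_right tcof_fib f) }.

End ModelStructures.

Arguments cap_class {C} P Q {X Y} f.
Arguments rlp {C} P {X Y} q.
Arguments weq {C} m {X Y} _.
Arguments cof {C} m {X Y} _.
Arguments fib {C} m {X Y} _.

Definition trivial_cofibration (C : category) (S : model_structure C) :
    morphism_class C :=
  fun X Y f => cof S f /\ weq S f.

Arguments trivial_cofibration {C} S X Y f.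

Section LeftModules.
Variable R : pzRingType.

Lemma linear_ext (M N : lmodType R) (f g : {linear M -> N}) : f =1 g -> f = g.
Proof.
case: f g => [f cf] [g cg] /= /funext fg; subst g; congr GRing.Linear.Pack.
case: cf cg => [[a] [b]] [[c] [d]].
by rewrite (Prop_irrelevance a c) (Prop_irrelevance b d).
Qed.

Program Definition LMod_cat : category :=
  @Category (lmodType R) (fun M N => {linear M -> N})
    (fun M => idfun) (fun M N P g f => g \o f) _ _ _.
Next Obligation. by move=> *; exact: linear_ext. Qed.
Next Obligation. by move=> *; exact: linear_ext. Qed.
Next Obligation. by move=> *; exact: linear_ext. Qed.

Program Definition LMod : zcategory :=
  @ZCategory LMod_cat (fun M N => \0) _ _.
Next Obligation. by move=> *; exact: linear_ext. Qed.
Next Obligation. by move=> M N P f; apply: linear_ext => x /=; exact: linear0. Qed.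

End LeftModules.

HB.mixin Record isTopologicalGroup G & Topological G & Group G := {
  mulg_continuous : continuous (fun x : G * G => (x.1 * x.2)%g);
  invg_continuous : continuous (fun x : G => (x^-1)%g) }.

#[short(type="topGroupType")]
HB.structure Definition TopologicalGroup :=
  {G of isTopologicalGroup G & Topological G & Group G}.

Section Subgroups.
Variable G : topGroupType.

Definition is_subgroup (A : set G) : Prop :=
  A 1%g /\ forall x y, A x -> A y -> A (x * y^-1)%g.

Record open_subgroup := OpenSubgroup {
  os_set :> set G;
  os_subgroup : is_subgroup os_set;
  os_open : open os_set }.

Definition left_cosets (A N : set G) : set (set G) :=
  [set [set (x * y)%g | y in N] | x in A].

Definition normal_in (A N : set G) : Prop :=
  forall x y, A x -> N y -> N (x * y * x^-1)%g.

(* A pro-p group is a profinite (compact, Hausdorff, totally disconnected)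
   group all of whose open normal subgroups have p-power index; A carries the
   subspace topology of set_type. *)
Definition pro_p (p : nat) (A : set G) : Prop :=
  [/\ is_subgroup A,
      compact [set: set_type A],
      hausdorff_space (set_type A),
      totally_disconnected [set: set_type A]
    & forall N : set G, is_subgroup N -> N `<=` A -> normal_in A N ->
        open ((set_val : set_type A -> G) @^-1` N) ->
        exists n : nat, left_cosets A N #= `I_(p ^ n)].

End Subgroups.

Section SmoothRepresentations.
Variables (k : fieldType) (G : topGroupType).

Record smooth_rep := SmoothRep {
  rep_mod :> lmodType k;
  rep_act : G -> rep_mod -> rep_mod;
  rep_linear : forall g, linear (rep_act g);
  rep_act1 : forall v, rep_act 1%g v = v;
  rep_actM : forall g h v, rep_act (g * h)%g v = rep_act g (rep_act h v);
  rep_smooth : forall v, open [set g | rep_act g v = v] }.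

Record rep_hom (V W : smooth_rep) := RepHom {
  rep_hom_fun :> {linear V -> W};
  rep_hom_act : forall g v,
    rep_hom_fun (rep_act g v) = rep_act g (rep_hom_fun v) }.

Lemma rep_hom_ext (V W : smooth_rep) (f g : rep_hom V W) : f =1 g -> f = g.
Proof.
case: f g => [f fP] [g gP] /= /linear_ext fg; subst g; congr RepHom.
exact: Prop_irrelevance.
Qed.

Lemma rep_act0 (V : smooth_rep) (g : G) : rep_act g (0 : V) = 0.
Proof.
have := rep_linear g (-1) (0 : V) 0.
by rewrite scaleN1r oppr0 addr0 scaleN1r addNr. Qed.

Lemma rep_actD (V : smooth_rep) (g : G) : {morph @rep_act V g : v w / v + w}.
Proof. by move=> v w; have := rep_linear g 1 v w; rewrite !scale1r. Qed.

Lemma rep_actZ (V : smooth_rep) (g : G) c :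
  {morph @rep_act V g : v / c *: v}.
Proof. by move=> v; have := rep_linear g c v 0; rewrite rep_act0 !addr0. Qed.

Program Definition rep_id (V : smooth_rep) : rep_hom V V := @RepHom V V idfun _.
Next Obligation. by []. Qed.

Program Definition rep_comp (V W U : smooth_rep) (g : rep_hom W U)
  (f : rep_hom V W) : rep_hom V U := @RepHom V U (g \o f) _.
Next Obligation. by move=> V W U g f x v /=; rewrite !rep_hom_act. Qed.

Program Definition rep_zero (V W : smooth_rep) : rep_hom V W := @RepHom V W \0 _.
Next Obligation. by move=> V W g v /=; rewrite rep_act0. Qed.

Program Definition Rep_cat : category :=
  @Category smooth_rep rep_hom rep_id rep_comp _ _ _.
Next Obligation. by move=> *; exact: rep_hom_ext. Qed.
Next Obligation. by move=> *; exact: rep_hom_ext. Qed.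
Next Obligation. by move=> *; exact: rep_hom_ext. Qed.

Program Definition Rep : zcategory := @ZCategory Rep_cat rep_zero _ _.
Next Obligation. by move=> *; exact: rep_hom_ext. Qed.
Next Obligation.
by move=> V W U f; apply: rep_hom_ext => x /=; exact: linear0.
Qed.

End SmoothRepresentations.

Section EndomorphismRing.
Variables (k : fieldType) (G : topGroupType) (V : smooth_rep k G).

Definition rep_end : Type := rep_hom V V.

HB.instance Definition _ := gen_eqMixin rep_end.
HB.instance Definition _ := gen_choiceMixin rep_end.

Program Definition rep_end_add (f g : rep_end) : rep_end :=
  @RepHom k G V V (f \+ g) _.
Next Obligation. by move=> f g x v /=; rewrite !rep_hom_act rep_actD. Qed.

Program Definition rep_end_opp (f : rep_end) : rep_end :=
  @RepHom k G V V (-1 \*: (f : {linear V -> V})) _.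
Next Obligation. by move=> f x v /=; rewrite rep_hom_act rep_actZ. Qed.

Program Definition rep_end_zmod :=
  @GRing.isZmodule.Build rep_end (rep_zero V V) rep_end_opp rep_end_add _ _ _ _.
Next Obligation. by move=> f g h; apply: rep_hom_ext => x /=; rewrite addrA. Qed.
Next Obligation. by move=> f g; apply: rep_hom_ext => x /=; rewrite addrC. Qed.
Next Obligation. by move=> f; apply: rep_hom_ext => x /=; rewrite add0r. Qed.
Next Obligation.
by move=> f; apply: rep_hom_ext => x /=; rewrite scaleN1r addNr.
Qed.
HB.instance Definition _ := rep_end_zmod.

Program Definition rep_end_ring :=
  @GRing.Zmodule_isPzRing.Build rep_end (rep_id V) (@rep_comp k G V V V) _ _ _ _ _.
Next Obligation. by move=> *; exact: rep_hom_ext. Qed.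
Next Obligation. by move=> *; exact: rep_hom_ext. Qed.
Next Obligation. by move=> *; exact: rep_hom_ext. Qed.
Next Obligation. by move=> *; exact: rep_hom_ext. Qed.
Next Obligation.
by move=> f g h; apply: rep_hom_ext => x /=; rewrite linearD.
Qed.
HB.instance Definition _ := rep_end_ring.

Definition rep_end_op : pzRingType := rep_end^c.

End EndomorphismRing.

Section Translations.
Variable G : topGroupType.

Lemma lmul_continuous (a : G) : continuous (fun g : G => (a * g)%g).
Proof.
move=> g; apply: (@cvg_comp _ _ _ (fun h => (a, h)) (fun x : G * G => (x.1 * x.2)%g)).
  by apply: (@cvg_pair _ _ _ (nbhs g) (nbhs a) (nbhs g));
    [exact: (@cvg_cst _ _ _ (nbhs g))|exact: cvg_id].
exact: (@mulg_continuous G (a, g)).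
Qed.

Lemma rmul_continuous (a : G) : continuous (fun g : G => (g * a)%g).
Proof.
move=> g; apply: (@cvg_comp _ _ _ (fun h => (h, a)) (fun x : G * G => (x.1 * x.2)%g)).
  by apply: (@cvg_pair _ _ _ (nbhs g) (nbhs g) (nbhs a));
    [exact: cvg_id|exact: (@cvg_cst _ _ _ (nbhs g))].
exact: (@mulg_continuous G (g, a)).
Qed.

Lemma open_stabilizer (T : Type) (act : G -> T -> T) (v : T) :
    (forall g h, act (g * h)%g v = act g (act h v)) ->
    nbhs (1%g : G) [set g | act g v = v] ->
  open [set g | act g v = v].
Proof.
move=> actM nv; rewrite openE => s /= sv; rewrite /interior.
have nv' : nbhs (s^-1 * s)%g [set g | act g v = v] by rewrite mulVg.
have nv'' : nbhs s [set g | act (s^-1 * g)%g v = v].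
  exact: (@lmul_continuous s^-1%g s _ nv').
apply: filterS nv'' => g /= gv.
by rewrite -{1}(mulVKg s g) actM gv.
Qed.

End Translations.

Section CompactInduction.
Variables (k : fieldType) (G : topGroupType) (J : open_subgroup G).
Local Notation I := (os_set J).

(* The set where f does not vanish is closed, by right I-invariance: it is the
   support of f. *)
Definition ind_pred : {pred G -> k^o} := fun f =>
  `[< compact [set g | f g != 0] /\ forall g i, I i -> f (g * i)%g = f g >].

Lemma os1 : I 1%g. Proof. by case: (os_subgroup J). Qed.

Lemma osV x : I x -> I x^-1%g.
Proof. by move=> Ix; have := (os_subgroup J).2 _ _ os1 Ix; rewrite mul1g. Qed.

Lemma coset_open (x : G) : open [set g | I (x^-1 * g)%g].
Proof.
by move: (os_open J); apply: open_comp => g _; exact: lmul_continuous.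
Qed.

Lemma invariant_closed (f : G -> k^o) :
  (forall g i, I i -> f (g * i)%g = f g) -> closed [set g | f g != 0].
Proof.
move=> fI; rewrite -openC openE => g /= /negP; rewrite negbK => /eqP fg.
apply: (@filterS _ _ _ [set h | I (g^-1 * h)%g]) => [h /= Ih|].
  by rewrite -(mulVKg g h) fI // fg eqxx.
by apply: open_nbhs_nbhs; split; [exact: coset_open|rewrite /= mulVg; exact: os1].
Qed.

Lemma ind_pred_submod : submod_closed ind_pred.
Proof.
split.
  apply/asboolP; split=> //.
  rewrite (_ : [set _ | _] = set0); first exact: compact0.
  by apply/seteqP; split=> // g /=; rewrite eqxx.
move=> c f g /asboolP[cf fI] /asboolP[cg gI]; apply/asboolP.
have hI : forall x i, I i -> (c *: f + g) (x * i)%g = (c *: f + g) x.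
  by move=> x i Ii; rewrite !fctE /= fI // gI.
split=> //; apply: (subclosed_compact _ (compactU cf cg)).
  exact: invariant_closed.
move=> x /=; rewrite !fctE /=; have [f0|] := eqVneq (f x) 0; last by left.
by rewrite f0 scaler0 add0r; right.
Qed.

HB.instance Definition _ := GRing.isSubmodClosed.Build k (G -> k^o) ind_pred
  ind_pred_submod.

Record ind_type := Ind { ind_fun :> G -> k^o; ind_funP : ind_fun \in ind_pred }.

HB.instance Definition _ := [isSub for ind_fun].
HB.instance Definition _ := [Choice of ind_type by <:].
HB.instance Definition _ := [SubChoice_isSubLmodule of ind_type by <:].

Lemma ind_ext (f g : ind_type) : (forall x, f x = g x) -> f = g.
Proof. by move=> fg; apply/val_inj/funext. Qed.

Lemma ind_act_subproof (g : G) (f : ind_type) :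
  (fun x => f (g^-1 * x)%g) \in ind_pred.
Proof.
case: f => f fP /=; have /asboolP[cf fI] := fP; apply/asboolP; split=> [|x i Ii].
  rewrite (_ : [set _ | _] = (fun x => (g * x)%g) @` [set x | f x != 0]).
    by apply: continuous_compact cf; apply: continuous_subspaceT;
      exact: lmul_continuous.
  apply/seteqP; split=> [x /= fx|_ [x /= fx <-]]; last by rewrite mulKg.
  by exists (g^-1 * x)%g => //; rewrite mulVKg.
by rewrite mulgA fI.
Qed.

Definition ind_act (g : G) (f : ind_type) : ind_type :=
  Ind (ind_act_subproof g f).

Lemma ind_act_linear g : linear (ind_act g).
Proof. by move=> c u v; exact: ind_ext. Qed.

Lemma ind_act1 f : ind_act 1%g f = f.
Proof. by apply: ind_ext => x /=; rewrite invg1 mul1g. Qed.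

Lemma ind_actM g h f : ind_act (g * h)%g f = ind_act g (ind_act h f).
Proof. by apply: ind_ext => x /=; rewrite invgM mulgA. Qed.

Lemma ind_smooth f : open [set g | ind_act g f = f].
Proof.
apply: open_stabilizer => [g h|]; first exact: ind_actM.
case: f => f fP; have /asboolP[cf fI] := fP.
have nI x : nbhs (1%g : G) [set g | I (x^-1 * g * x)%g].
  have Ix : nbhs (x^-1 * 1 * x)%g I.
    by rewrite mulg1 mulVg; apply: open_nbhs_nbhs; split; [exact: os_open|exact: os1].
  have := @rmul_continuous G x (x^-1 * 1)%g _ Ix.
  exact: (@lmul_continuous G x^-1%g 1%g).
have fconj x a h : I (x^-1 * a * x)%g -> I (x^-1 * h)%g -> f (a * h)%g = f h.
  move=> Ia Ih; rewrite -(mulVKg x h).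
  rewrite (_ : (a * (x * (x^-1 * h)))%g = (x * (x^-1 * a * x) * (x^-1 * h))%g).
    by rewrite !fI.
  by rewrite !mulgA mulgV mul1g.
move/compact_near_coveringP: cf => /(_ G (nbhs (1%g : G))
  (fun g h => f (g * h)%g = f h /\ f (g^-1 * h)%g = f h)) ncov.
apply: filterS (ncov _ _) => [g gP|]; last move=> x fx.
  apply: ind_ext => h /=.
  have [h0|/gP[]//] := eqVneq (f h) 0.
  apply/eqP; rewrite h0; apply/negPn/negP => gh0.
  by have [] := gP _ gh0; rewrite mulVKg h0 => /esym/eqP; rewrite (negPf gh0).
exists ([set h | I (x^-1 * h)%g], [set g | I (x^-1 * g * x)%g]) => [|[h g] [/= Ih Ig]].
  split=> /=; last exact: nI.
  apply: open_nbhs_nbhs; split; first exact: coset_open.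
  by rewrite /= mulVg; exact: os1.
split; apply: (fconj x) => //.
by have /= := osV Ig; rewrite !invgM invgK mulgA.
Qed.

Definition ind : smooth_rep k G :=
  SmoothRep ind_act_linear ind_act1 ind_actM ind_smooth.

Definition hecke : pzRingType := rep_end_op ind.

End CompactInduction.

Section TensorProduct.
Variables (H : pzRingType) (X : zmodType) (ract : X -> H -> X).

Section Quotient.
Variable M : lmodType H.

(* A list [:: (x1, m1); ...; (xn, mn)] stands for the formal sum of the
   xi (x) mi.  The tensor product is the quotient of the free commutative
   monoid of such sums by the bilinearity and balancing relations; opposites
   exist because x (x) m + x (x) (- m) = x (x) 0 = 0. *)
Inductive tensor_eq : seq (X * M) -> seq (X * M) -> Prop :=
| tensor_refl s : tensor_eq s s
| tensor_sym s t : tensor_eq s t -> tensor_eq t s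
| tensor_trans t s u : tensor_eq s t -> tensor_eq t u -> tensor_eq s u
| tensor_cat s s' t t' : tensor_eq s s' -> tensor_eq t t' ->
    tensor_eq (s ++ t) (s' ++ t')
| tensor_catC s t : tensor_eq (s ++ t) (t ++ s)
| tensor_addl x x' m : tensor_eq [:: (x + x', m)] [:: (x, m); (x', m)]
| tensor_addr x m m' : tensor_eq [:: (x, m + m')] [:: (x, m); (x, m')]
| tensor_zeror x : tensor_eq [:: (x, 0)] [::]
| tensor_balance x h m : tensor_eq [:: (ract x h, m)] [:: (x, h *: m)].

Definition tensor_rel : rel (seq (X * M)) := fun s t => `[< tensor_eq s t >].

Lemma tensor_rel_refl : reflexive tensor_rel.
Proof. by move=> s; apply/asboolP; exact: tensor_refl. Qed.

Lemma tensor_rel_sym : symmetric tensor_rel.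
Proof. by move=> s t; apply/asbool_equiv_eq; split; exact: tensor_sym. Qed.

Lemma tensor_rel_trans : transitive tensor_rel.
Proof.
by move=> t s u /asboolP st /asboolP tu; apply/asboolP; exact: tensor_trans tu.
Qed.

Canonical tensor_equiv :=
  EquivRel tensor_rel tensor_rel_refl tensor_rel_sym tensor_rel_trans.

Definition tensor : Type := {eq_quot tensor_equiv}.

HB.instance Definition _ := Choice.on tensor.
HB.instance Definition _ := EqQuotient.on tensor.

Definition tensor_sum (s : seq (X * M)) : tensor := \pi_tensor s.

Lemma tensor_sumP s t : tensor_sum s = tensor_sum t <-> tensor_eq s t.
Proof.
split=> [/eqquotP/asboolP//|st].
by apply/eqquotP/asboolP.
Qed.

Lemma tensor_reprP s : tensor_eq (repr (tensor_sum s)) s.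
Proof. by apply/tensor_sumP; rewrite /tensor_sum reprK. Qed.

Lemma tensorW (P : tensor -> Prop) : (forall s, P (tensor_sum s)) ->
  forall t, P t.
Proof. by move=> Ps t; rewrite -[t]reprK; exact: Ps. Qed.

End Quotient.

Definition tensor_map_seq (M N : lmodType H) (phi : X -> X) (psi : M -> N)
  (s : seq (X * M)) : seq (X * N) := [seq (phi u.1, psi u.2) | u <- s].

(* The map x (x) m |-> phi x (x) psi m, meaningful for the phi and psi of
   tensor_mapE. *)
Definition tensor_map (M N : lmodType H) (phi : X -> X) (psi : M -> N)
    (t : tensor M) : tensor N :=
  tensor_sum (tensor_map_seq phi psi (repr t)).

Definition ract_morph (phi : X -> X) : Prop :=
  {morph phi : x y / x + y} /\ forall x h, phi (ract x h) = ract (phi x) h.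

Lemma tensor_eq_map (M N : lmodType H) (phi : X -> X) (psi : {linear M -> N}) s t :
  ract_morph phi -> tensor_eq s t ->
  tensor_eq (tensor_map_seq phi psi s) (tensor_map_seq phi psi t).
Proof.
move=> [phiD phih]; elim=> {s t}.
- by move=> s; exact: tensor_refl.
- by move=> s t _ st; exact: tensor_sym.
- by move=> t s u _ st _ tu; exact: tensor_trans tu.
- by move=> s s' t t' _ ss' _ tt'; rewrite /tensor_map_seq !map_cat; exact: tensor_cat.
- by move=> s t; rewrite /tensor_map_seq !map_cat; exact: tensor_catC.
- by move=> x x' m /=; rewrite phiD; exact: tensor_addl.
- by move=> x m m' /=; rewrite linearD; exact: tensor_addr.
- by move=> x /=; rewrite linear0; exact: tensor_zeror.
- by move=> x h m /=; rewrite phih linearZ; exact: tensor_balance.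
Qed.

Lemma tensor_mapE (M N : lmodType H) (phi : X -> X) (psi : {linear M -> N}) s :
  ract_morph phi ->
  tensor_map phi psi (tensor_sum s) = tensor_sum (tensor_map_seq phi psi s).
Proof.
by move=> phiP; apply/tensor_sumP/tensor_eq_map => //; exact: tensor_reprP.
Qed.

Lemma ract_morph_id : ract_morph idfun. Proof. by []. Qed.

Section Zmodule.
Variable M : lmodType H.

Definition tensor_add (t u : tensor M) : tensor M :=
  tensor_sum (repr t ++ repr u).

Definition tensor_opp : tensor M -> tensor M := tensor_map idfun (\- idfun).

Lemma tensor_addE s t :
  tensor_add (tensor_sum s) (tensor_sum t) = tensor_sum (s ++ t).
Proof. by apply/tensor_sumP/tensor_cat; exact: tensor_reprP. Qed.

Lemma tensor_addA : associative tensor_add.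
Proof.
elim/tensorW=> s; elim/tensorW=> t; elim/tensorW=> u.
by rewrite !tensor_addE catA.
Qed.

Lemma tensor_addC : commutative tensor_add.
Proof.
elim/tensorW=> s; elim/tensorW=> t; rewrite !tensor_addE.
by apply/tensor_sumP; exact: tensor_catC.
Qed.

Lemma tensor_add0 : left_id (tensor_sum [::]) tensor_add.
Proof. by elim/tensorW=> s; rewrite tensor_addE. Qed.

Lemma tensor_addN : left_inverse (tensor_sum [::]) tensor_opp tensor_add.
Proof.
have add_cons u s : tensor_sum (u :: s) = tensor_add (tensor_sum [:: u]) (tensor_sum s).
  by rewrite tensor_addE.
have oppE s : tensor_opp (tensor_sum s) =
    tensor_sum (tensor_map_seq idfun (\- idfun : {linear M -> M}) s).
  exact: (tensor_mapE _ _ ract_morph_id).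
elim/tensorW; elim=> [|[x m] s IHs]; first by rewrite oppE tensor_add0.
rewrite oppE /= (add_cons (x, - m)) -oppE (add_cons (x, m) s).
set a := tensor_sum [:: (x, - m)]; set b := tensor_sum [:: (x, m)].
rewrite -tensor_addA (tensor_addC _ (tensor_add b _)) -tensor_addA.
rewrite (tensor_addC (tensor_sum s)) IHs (tensor_addC b) tensor_add0.
rewrite /a /b tensor_addE; apply/tensor_sumP.
apply: (@tensor_trans _ [:: (x, 0)]); last exact: tensor_zeror.
by rewrite -(addNr m); apply: tensor_sym; exact: tensor_addr.
Qed.

HB.instance Definition _ := GRing.isZmodule.Build (tensor M)
  tensor_addA tensor_addC tensor_add0 tensor_addN.

Lemma tensor_sum_cat s t :
  tensor_sum (s ++ t) = tensor_sum s + tensor_sum t :> tensor M.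
Proof. by rewrite -tensor_addE. Qed.

Lemma tensor_sum_cons u s :
  tensor_sum (u :: s) = tensor_sum [:: u] + tensor_sum s :> tensor M.
Proof. by rewrite -tensor_sum_cat. Qed.

End Zmodule.

Lemma tensor_mapD (M N : lmodType H) (phi : X -> X) (psi : {linear M -> N}) :
  ract_morph phi -> {morph tensor_map phi psi : t u / t + u}.
Proof.
move=> phiP; elim/tensorW=> s; elim/tensorW=> t.
by rewrite -tensor_sum_cat !tensor_mapE // /tensor_map_seq map_cat tensor_sum_cat.
Qed.

Lemma tensor_map_comp (M N P : lmodType H) (phi phi' : X -> X)
    (psi : {linear M -> N}) (psi' : {linear N -> P}) t :
    ract_morph phi -> ract_morph phi' ->
  tensor_map phi' psi' (tensor_map phi psi t) =
  tensor_map (phi' \o phi) (psi' \o psi) t.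
Proof.
move=> phiP phiP'; elim/tensorW: t => s.
have phiP'' : ract_morph (phi' \o phi).
  split=> [x y|x h] /=; first by rewrite phiP.1 phiP'.1.
  by rewrite phiP.2 phiP'.2.
by rewrite !tensor_mapE // /tensor_map_seq -map_comp.
Qed.

Lemma tensor_map_id (M : lmodType H) (t : tensor M) :
  tensor_map idfun idfun t = t.
Proof.
elim/tensorW: t => s.
apply: etrans (tensor_mapE (idfun : {linear M -> M}) s ract_morph_id) _.
by congr tensor_sum; rewrite /tensor_map_seq -[RHS]map_id; apply: eq_map => -[].
Qed.

End TensorProduct.

Section TensorRepresentation.
Variables (k : fieldType) (G : topGroupType) (V : smooth_rep k G).
Local Notation H := (rep_end_op V).

(* The right action of End_G(V)^op on V; it is a right action because the
   product of (rep_end V)^c is reversed composition. *)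
Definition rep_ract (x : V) (h : H) : V := (h : rep_end V) x.

Lemma scale_ract_morph (c : k) : ract_morph rep_ract ( *:%R c).
Proof.
split=> [x y|x h]; first exact: scalerDr.
by rewrite /rep_ract linearZ.
Qed.

Lemma act_ract_morph (g : G) : ract_morph rep_ract (@rep_act k G V g).
Proof.
split=> [x y|x h]; first exact: rep_actD.
by rewrite /rep_ract rep_hom_act.
Qed.

Definition rep_tensor (M : lmodType H) : Type := tensor rep_ract M.

Section Module.
Variable M : lmodType H.

HB.instance Definition _ := GRing.Zmodule.on (rep_tensor M).

Definition rep_tensor_scale (c : k) : rep_tensor M -> rep_tensor M :=
  tensor_map ( *:%R c) idfun.

Definition rep_tensor_act (g : G) : rep_tensor M -> rep_tensor M :=
  tensor_map (@rep_act k G V g) idfun.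

Lemma rep_tensor_scaleA c d t :
  rep_tensor_scale c (rep_tensor_scale d t) = rep_tensor_scale (c * d) t.
Proof.
rewrite /rep_tensor_scale (tensor_map_comp idfun idfun t
  (scale_ract_morph d) (scale_ract_morph c)).
by congr (tensor_map _ _ t); apply/funext => x /=; rewrite scalerA.
Qed.

Lemma rep_tensor_scale1 : left_id 1 rep_tensor_scale.
Proof.
move=> t; rewrite -[RHS]tensor_map_id.
by congr (tensor_map _ _ t); apply/funext => x /=; rewrite scale1r.
Qed.

Lemma rep_tensor_scaleDr : right_distributive rep_tensor_scale +%R.
Proof. by move=> c; exact: (tensor_mapD idfun (scale_ract_morph c)). Qed.

Lemma rep_tensor_scaleDl t : {morph rep_tensor_scale^~ t : c d / c + d}.
Proof.
move=> c d; elim/tensorW: t => s.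
rewrite /rep_tensor_scale !(tensor_mapE idfun _ (scale_ract_morph _)).
elim: s => [|[x m] s IHs]; first by rewrite addr0.
rewrite /= tensor_sum_cons IHs (tensor_sum_cons _ (c *: x, m)).
rewrite (tensor_sum_cons _ (d *: x, m)) addrACA.
congr (_ + _); rewrite -tensor_sum_cat; apply/tensor_sumP; rewrite scalerDl /=.
exact: tensor_addl.
Qed.

HB.instance Definition _ := GRing.Zmodule_isLmodule.Build k (rep_tensor M)
  rep_tensor_scaleA rep_tensor_scale1 rep_tensor_scaleDr rep_tensor_scaleDl.

Lemma rep_tensor_act_linear g : linear (rep_tensor_act g).
Proof.
move=> c t u; rewrite /rep_tensor_act (tensor_mapD idfun (act_ract_morph g)).
congr (_ + _); rewrite /GRing.scale /= /rep_tensor_scale.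
rewrite (tensor_map_comp idfun idfun t (scale_ract_morph c) (act_ract_morph g)).
rewrite (tensor_map_comp idfun idfun t (act_ract_morph g) (scale_ract_morph c)).
by congr (tensor_map _ _ t); apply/funext => x /=; rewrite rep_actZ.
Qed.

Lemma rep_tensor_act1 t : rep_tensor_act 1%g t = t.
Proof.
rewrite -[RHS]tensor_map_id.
by congr (tensor_map _ _ t); apply/funext => x /=; rewrite rep_act1.
Qed.

Lemma rep_tensor_actM g h t :
  rep_tensor_act (g * h)%g t = rep_tensor_act g (rep_tensor_act h t).
Proof.
rewrite /rep_tensor_act (tensor_map_comp idfun idfun t
  (act_ract_morph h) (act_ract_morph g)).
by congr (tensor_map _ _ t); apply/funext => x /=; rewrite rep_actM.
Qed.

Lemma rep_tensor_smooth t : open [set g | rep_tensor_act g t = t].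
Proof.
apply: open_stabilizer => [g h|]; first exact: rep_tensor_actM.
elim/tensorW: t; elim=> [|[x m] s IHs].
  apply: nearW => g; rewrite /rep_tensor_act.
  exact: (tensor_mapE idfun [::] (act_ract_morph g)).
have nx : nbhs (1%g : G) [set g | rep_act g x = x].
  by apply: open_nbhs_nbhs; split; [exact: rep_smooth|exact: rep_act1].
apply: filterS (filterI nx IHs) => g /= [gx].
rewrite /rep_tensor_act !(tensor_mapE idfun _ (act_ract_morph g)) => gs.
by rewrite /= tensor_sum_cons gs gx -tensor_sum_cons.
Qed.

Definition rep_tensor_rep : smooth_rep k G :=
  SmoothRep rep_tensor_act_linear rep_tensor_act1 rep_tensor_actM
    rep_tensor_smooth.

End Module.

Section Map.
Variables (M N : lmodType H) (psi : {linear M -> N}).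

Definition rep_tensor_map : rep_tensor M -> rep_tensor N := tensor_map idfun psi.

Let rid : ract_morph rep_ract idfun := @ract_morph_id _ _ _.

Lemma rep_tensor_map_linear : linear rep_tensor_map.
Proof.
move=> c t u; rewrite /rep_tensor_map (tensor_mapD psi rid).
congr (_ + _); rewrite /GRing.scale /= /rep_tensor_scale.
rewrite (tensor_map_comp idfun psi t (scale_ract_morph c) rid).
by rewrite (tensor_map_comp psi idfun t rid (scale_ract_morph c)).
Qed.

HB.instance Definition _ := GRing.isLinear.Build k (rep_tensor M) (rep_tensor N)
  *:%R rep_tensor_map rep_tensor_map_linear.

Lemma rep_tensor_map_act g (t : rep_tensor_rep M) :
  rep_tensor_map (rep_act g t) =
  rep_act g (rep_tensor_map t : rep_tensor_rep N).
Proof.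
rewrite /= /rep_tensor_act /rep_tensor_map.
rewrite (tensor_map_comp idfun psi t (act_ract_morph g) rid).
by rewrite (tensor_map_comp psi idfun t rid (act_ract_morph g)).
Qed.

Definition rep_tensor_hom : rep_hom (rep_tensor_rep M) (rep_tensor_rep N) :=
  @RepHom k G (rep_tensor_rep M) (rep_tensor_rep N) rep_tensor_map
    rep_tensor_map_act.

End Map.

Program Definition tensor_functor : functor (LMod H) (Rep k G) :=
  @Functor (LMod H) (Rep k G) rep_tensor_rep rep_tensor_hom _ _.
Next Obligation. by move=> M; apply: rep_hom_ext => t; exact: tensor_map_id. Qed.
Next Obligation.
move=> M N P g f; apply: rep_hom_ext => t /=; rewrite /rep_tensor_map.
by rewrite (tensor_map_comp f g t (@ract_morph_id _ _ _) (@ract_morph_id _ _ _)).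
Qed.

Program Definition tensor_zfunctor : zfunctor (LMod H) (Rep k G) :=
  @ZFunctor (LMod H) (Rep k G) tensor_functor _.
Next Obligation.
move=> M N; apply: rep_hom_ext; elim/tensorW => s /=.
rewrite /rep_tensor_map (tensor_mapE (\0 : {linear M -> N}) s (@ract_morph_id _ _ _)).
elim: s => [//|[x m] s IHs]; rewrite /= tensor_sum_cons IHs addr0.
by apply/tensor_sumP; exact: tensor_zeror.
Qed.

End TensorRepresentation.

Section Homology.
Variables (k : fieldType) (G : topGroupType).

Section Object.
Variables (X : complex (Rep k G)) (n : int).

(* The homology of X in degree n - 1, so that every degree is reached without
   transport along n + 1 - 1 = n. *)
Definition cycles : Type :=
  {z : (X (n - 1) : smooth_rep k G) | (cdiff X (n - 1) : rep_hom _ _) z == 0}.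

HB.instance Definition _ := Choice.on cycles.

Definition homologous : rel cycles := fun z z' =>
  `[< exists y, (cdiff X n : rep_hom _ _) y = val z - val z' >].

Lemma homologous_refl : reflexive homologous.
Proof. by move=> z; apply/asboolP; exists 0; rewrite linear0 subrr. Qed.

Lemma homologous_sym : symmetric homologous.
Proof.
move=> z z'; apply/asbool_equiv_eq.
by split=> -[y yz]; exists (- y); rewrite linearN yz opprB.
Qed.

Lemma homologous_trans : transitive homologous.
Proof.
move=> z' z z'' /asboolP[y yz] /asboolP[y' yz']; apply/asboolP.
by exists (y + y'); rewrite linearD yz yz' addrA subrK.
Qed.

Canonical homologous_equiv :=
  EquivRel homologous homologous_refl homologous_sym homologous_trans.

Definition homology : Type := {eq_quot homologous_equiv}.

HB.instance Definition _ := Choice.on homology.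
HB.instance Definition _ := EqQuotient.on homology.

End Object.

Section Map.
Variables (X Y : complex (Rep k G)) (f : chain_map X Y) (n : int).

Lemma cycle_map_subproof (z : cycles X n) :
  (cdiff Y (n - 1) : rep_hom _ _) ((f (n - 1) : rep_hom _ _) (val z)) == 0.
Proof.
case: z => z /= /eqP dz.
have /(congr1 (fun h : rep_hom _ _ => h z)) /= -> := cmap_diff f (n - 1).
by rewrite dz linear0.
Qed.

Definition cycle_map (z : cycles X n) : cycles Y n :=
  exist (fun w => (cdiff Y (n - 1) : rep_hom _ _) w == 0) _
    (cycle_map_subproof z).

Definition homology_map (c : homology X n) : homology Y n :=
  \pi_(homology Y n) (cycle_map (repr c)).

Lemma homology_mapE (z : cycles X n) :
  homology_map (\pi_(homology X n) z) = \pi_(homology Y n) (cycle_map z).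
Proof.
apply/eqquotP/asboolP.
have /eqquotP/asboolP[y yz] : repr (\pi_(homology X n) z) = z %[mod homology X n].
  by rewrite reprK.
exists ((f n : rep_hom _ _) y).
have /(congr1 (fun h : rep_hom _ _ => h y)) /= -> := cmap_diff f n.
by rewrite yz linearB.
Qed.

End Map.

Definition quasi_iso (X Y : Ch (Rep k G)) (f : mor X Y) : Prop :=
  forall n : int, bijective (@homology_map X Y f n).

End Homology.

Definition tensor_Ch (k : fieldType) (G : topGroupType) (I : open_subgroup G) :
    functor (Ch (LMod (hecke k I))) (Ch (Rep k G)) :=
  Ch_functor (tensor_zfunctor (ind k I)).

(* Main.v *)
(* Write T M for the complex X (x)_H M of k-vector spaces.  A map g is a
   cofibration when T g is termwise injective and a weak equivalence when T g is
   a quasi-isomorphism.  Termwise, T has the right adjoint W |-> Hom_k(X, W), and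
   vector spaces are injective, so maps into Hom_k(X, W) extend along
   cofibrations.  Hence, for the contractible complex D with
   D_n = Hom_k(X, T M_n) x Hom_k(X, T M_(n-1)) and d (a, b) = (b, 0), the
   factorization M -> N x D -> N is a cofibration followed by a map that lifts
   against all cofibrations.

   For the other factorization, a Loewenheim-Skolem argument exhausts every
   trivial cofibration by small ones; by Zorn's lemma a map lifting against a set
   of small trivial cofibrations then lifts against all of them.  The
   factorization M -> E -> N takes for E the initial complex over N and under M
   with chosen lifts against that set, built from infinitary terms modulo
   equality in all such complexes, so that no transfinite induction is needed.
   Initiality makes M -> E lift against all fibrations, and test fibrations of
   the form Hom_k(X, -) show that it is a trivial cofibration. *)

From HB Require Import structures.
Require Import Defs.
From mathcomp Require Import all_boot all_order all_algebra.
From mathcomp Require Import all_classical topology.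

Set Implicit Arguments.
Unset Strict Implicit.
Unset Printing Implicit Defensive.

Import GRing.Theory.

Local Open Scope classical_set_scope.
Local Open Scope quotient_scope.
Local Open Scope ring_scope.
Local Open Scope category_scope.

(** The tensor functor is only right exact, and this shapes the argument. A cofibration may itself
    have a kernel; an inclusion of submodules need not stay injective after T; a cycle over a
    subcomplex may bound only over the larger complex. The Loewenheim-Skolem step therefore closes
    under tensor relations and bounding chains as well as under module operations. Each of these is
    finite data, since a tensor is a finite sum and a relation between tensors has a finite
    derivation. Nor does Zorn's lemma run over all partial lifts: the domain must stay a trivial
    cofibration into B, so that the next small piece can be found relative to it.

    Test fibrations suffice because linear functionals over a field detect boundaries. Once T i is
    injective for i : A -> B, it is a quasi-isomorphism iff every cochain on T A whose coboundary is
    the restriction of a cocycle on T B extends to a cochain on T B with that cocycle as coboundary.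
    This is a lifting property of i against one map between complexes built from Hom_k(X, k). *)

Definition mklin (R : pzRingType) (M N : lmodType R) (f : M -> N)
    (fl : linear f) : {linear M -> N} :=
  HB.pack_for {linear M -> N} f (GRing.isLinear.Build R M N *:%R f fl).

(** * Extension of linear maps and separation by functionals over a field *)

Section LinearExtension.
Variables (k : fieldType) (U V W : lmodType k).
Variables (f : {linear U -> W}) (g : {linear U -> V}).
Hypothesis ker_fg : forall u, f u = 0 -> g u = 0.

Let partial (G : set (W * V)) : Prop :=
  [/\ G (0, 0), (forall c p q, G p -> G q -> G (c *: p + q)),
      (forall v, G (0, v) -> v = 0) & forall u, G (f u, g u)].

Lemma maximal_partial : exists G, partial G /\ forall G', G `<` G' -> ~ partial G'.
Proof.
pose G0 : set (W * V) := [set p | exists u, p = (f u, g u)].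
(* The empty chain must have an admissible union too, so [G0] is joined to every set: the empty
   union then stands for [G0] itself. *)
have [|A [PA maxA]] := @Zorn_bigcup _ (fun A => partial (G0 `|` A)).
  move=> F FP totF.
  have [[A0 FA0]|F0] := pselect (exists A, F A); last first.
    rewrite (_ : \bigcup_(X in F) X = set0); last first.
      by apply/seteqP; split=> // x [X FX]; case: F0; exists X.
    rewrite setU0; split.
    - by exists 0; rewrite !linear0.
    - by move=> c p q [u ->] [v ->]; exists (c *: u + v); rewrite !linearP.
    - by move=> v [u [/esym/ker_fg -> ->]].
    - by move=> u; exists u.
  have union2 p q : (G0 `|` \bigcup_(X in F) X) p -> (G0 `|` \bigcup_(X in F) X) q ->
      exists A, [/\ F A, (G0 `|` A) p & (G0 `|` A) q].
    move=> [Gp|[X FX Xp]] [Gq|[Y FY Yq]].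
    - by exists A0; split=> //; left.
    - by exists Y; split=> //; [left|right].
    - by exists X; split=> //; [right|left].
    - have [XY|YX] := totF _ _ FX FY; [exists Y|exists X]; split=> //; right => //.
      + exact: XY.
      + exact: YX.
  have sub A p : F A -> (G0 `|` A) p -> (G0 `|` \bigcup_(X in F) X) p.
    by move=> FA [Gp|Ap]; [left|right; exists A].
  split.
  - by left; exists 0; rewrite !linear0.
  - move=> c p q Gp Gq; have [A [FA Ap Aq]] := union2 _ _ Gp Gq.
    by apply: (sub A) => //; have [_ GP _ _] := FP _ FA; exact: GP.
  - move=> v Gv; have [A [FA Av _]] := union2 _ _ Gv Gv.
    by have [_ _ Gf _] := FP _ FA; exact: Gf.
  - by move=> u; left; exists u.
exists (G0 `|` A); split=> // G' [GG' nG'G] PG'.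
have G'E : G0 `|` G' = G'.
  by apply/seteqP; split=> [p [Gp|//]|p G'p]; [apply: GG'; left|right].
apply: (maxA G'); last by rewrite G'E.
split=> [p Ap|sub]; first by apply: GG'; right.
by apply: nG'G => p /sub Ap; right.
Qed.

Lemma linear_extension : exists e : {linear W -> V}, forall u, e (f u) = g u.
Proof.
have [G [[G0 GP Gf Gfg] Gmax]] := maximal_partial.
have total w : exists v, G (w, v).
  apply: contrapT => /forallNP nw.
  (* If [w] has no value, the graph grows by giving it the value 0. It stays single-valued: a pair
     (0, v) obtained with a nonzero coefficient of [w] would yield a value at [w] already in [G]. *)
  pose G' : set (W * V) := [set p | exists c q, G q /\ p = (c *: w, 0) + q].
  have GG' p : G p -> G' p.
    by move=> Gp; exists 0, p; split=> //; rewrite scale0r -[(0, 0)]/(0 : W * V) add0r.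
  apply: (Gmax G').
    split=> // sub; apply: (nw 0); apply: sub; exists 1, 0; split=> //.
    by rewrite scale1r addr0.
  split; first exact: GG'.
  - move=> c _ _ [a [p [Gp ->]]] [b [q [Gq ->]]].
    exists (c * a + b), (c *: p + q); split; first exact: GP.
    rewrite scalerDr addrACA; congr (_ + _).
    by congr (_, _); rewrite /= ?scalerA -?scalerDl // scaler0 addr0.
  - move=> v [c [[a b] [Gp [e ->]]]].
    rewrite /= add0r; have [c0|c0] := eqVneq c 0.
      by apply: Gf; move: Gp e; rewrite c0 scale0r add0r => Gp ->.
    case: (nw (- c^-1 *: b)).
    have := GP (- c^-1) _ _ Gp G0; rewrite -[(0, 0)]/(0 : W * V) addr0.
    congr (G _); congr (_, _) => /=.
    have -> : a = - (c *: w) by apply/eqP; rewrite -addr_eq0 addrC -e.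
    by rewrite scalerN scaleNr opprK scalerA mulVf // scale1r.
  - by move=> u; apply: GG'.
have [e eP] := choice total.
have Guniq w v v' : G (w, v) -> G (w, v') -> v = v'.
  move=> Gv Gv'; apply/eqP; rewrite -subr_eq0; apply/eqP/Gf.
  have := GP (-1) _ _ Gv' Gv; congr (G _).
  by congr (_, _); rewrite /= scaleN1r addrC // subrr.
have el : linear e.
  by move=> c x y; apply: (Guniq (c *: x + y)) => //; exact: (GP c (x, e x) (y, e y)).
by exists (mklin el) => u; exact: (Guniq (f u)).
Qed.

End LinearExtension.

(** Extend the projection (u, c) |-> c along (u, c) |-> f u + c w; the condition on kernels says
    precisely that [w] is outside the image of [f]. *)
Lemma linear_separation (k : fieldType) (U W : lmodType k)
    (f : {linear U -> W}) (w : W) : ~ (exists u, w = f u) ->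
  exists e : {linear W -> k^o}, (forall u, e (f u) = 0) /\ e w = 1.
Proof.
move=> nw.
have fl : linear (fun p : U * k^o => f p.1 + p.2 *: w).
  move=> c p q /=; rewrite linearP scalerDl scalerDr -!addrA; congr (_ + _).
  by rewrite addrCA scalerA.
have [[u c] /= uc|e eP] :=
    @linear_extension _ _ _ _ (mklin fl) (snd : {linear (U * k^o)%type -> k^o}).
  apply: contrapT => /eqP c0; apply: nw; exists (- c^-1 *: u).
  rewrite linearZ /=; have -> : f u = - (c *: w) by apply/eqP; rewrite -addr_eq0 uc.
  by rewrite scalerN scaleNr opprK scalerA mulVf // scale1r.
exists e; split=> [u|].
  by have /= := eP (u, 0); rewrite scale0r addr0.
by have /= := eP (0, 1); rewrite scale1r linear0 add0r.
Qed.

Lemma dependent_choice (I : Type) (T : I -> Type) (P : forall i, T i -> Prop) :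
  (forall i, exists x, P i x) -> exists f : forall i, T i, forall i, P i (f i).
Proof. by move=> ex; exists (fun i => sval (cid (ex i))) => i; case: cid. Qed.

(** * Complexes of modules *)

Record submodule (R : pzRingType) (V : lmodType R) := Submodule {
  sm_set :> V -> Prop;
  sm_set0 : sm_set 0;
  sm_setP : forall c u v, sm_set u -> sm_set v -> sm_set (c *: u + v) }.

Section SubmoduleType.
Variables (R : pzRingType) (V : lmodType R) (S : submodule V).

Definition sm_pred : {pred V} := fun x => `[< S x >].

Lemma sm_pred_closed : submod_closed sm_pred.
Proof.
split; first by apply/asboolP; exact: sm_set0.
by move=> c u v /asboolP Su /asboolP Sv; apply/asboolP; exact: sm_setP.
Qed.

HB.instance Definition _ := GRing.isSubmodClosed.Build R V sm_pred sm_pred_closed.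

Record sm_type := SmType { sm_val : V; sm_valP : sm_val \in sm_pred }.

HB.instance Definition _ := [isSub for sm_val].
HB.instance Definition _ := [Choice of sm_type by <:].
HB.instance Definition _ := [SubChoice_isSubLmodule of sm_type by <:].

Definition sm_mk (x : V) (Sx : S x) : sm_type := SmType (asboolT Sx).

Lemma sm_valS (x : sm_type) : S (sm_val x).
Proof. exact/asboolP/sm_valP. Qed.

Lemma sm_val_inj : injective sm_val.
Proof. exact: val_inj. Qed.

Lemma sm_val_linear : linear sm_val.
Proof. by []. Qed.

Definition sm_incl : {linear sm_type -> V} := mklin sm_val_linear.

End SubmoduleType.

Section ModuleComplexes.
Variable R : pzRingType.
Local Notation cx := (complex (LMod R)).

(** [el], [dl] and [ml] retype the abstract objects and morphisms of the category as modules and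
    linear maps, so that the lemmas on linear maps apply to them. *)
Definition el (X : cx) (n : int) : lmodType R := X n.
Definition dl (X : cx) (n : int) : {linear el X n -> el X (n - 1)} := cdiff X n.
Definition ml (X Y : cx) (f : chain_map X Y) (n : int) :
  {linear el X n -> el Y n} := f n.

Lemma dlK (X : cx) n (x : el X n) : dl X (n - 1) (dl X n x) = 0.
Proof. by have /(congr1 (fun h : {linear _ -> _} => h x)) := cdiffK X n. Qed.

Lemma ml_diff (X Y : cx) (f : chain_map X Y) n x :
  dl Y n (ml f n x) = ml f (n - 1) (dl X n x).
Proof. by have /(congr1 (fun h : {linear _ -> _} => h x)) := cmap_diff f n. Qed.

Lemma ml_ext (X Y : cx) (f g : chain_map X Y) :
  (forall n x, ml f n x = ml g n x) -> f = g.
Proof. by move=> fg; apply: chain_map_ext => n; apply: linear_ext => x; exact: fg. Qed.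

Definition mkcx (C : int -> lmodType R) (d : forall n, {linear C n -> C (n - 1)})
    (dd : forall n x, d (n - 1) (d n x) = 0) : cx.
Proof.
by apply: (@Complex (LMod R) C d) => n; apply: linear_ext => x; exact: dd.
Defined.

Definition mkmap (X Y : cx) (f : forall n, {linear el X n -> el Y n})
    (fd : forall n x, dl Y n (f n x) = f (n - 1) (dl X n x)) : chain_map X Y.
Proof.
by apply: (@ChainMap (LMod R) X Y f) => n; apply: linear_ext => x; exact: fd.
Defined.

Definition mkmap_fun (X Y : cx) (f : forall n, el X n -> el Y n)
    (fl : forall n, linear (f n))
    (fd : forall n x, dl Y n (f n x) = f (n - 1) (dl X n x)) : chain_map X Y :=
  @mkmap X Y (fun n => mklin (fl n)) fd.

Section Subcomplex.
Variables (X : cx) (S : forall n, submodule (el X n)).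
Hypothesis Sd : forall n x, S n x -> S (n - 1) (dl X n x).

Definition sub_diff n (x : sm_type (S n)) : sm_type (S (n - 1)) :=
  sm_mk (Sd (sm_valS x)).

Lemma sub_diff_linear n : linear (@sub_diff n).
Proof. by move=> c x y; apply: sm_val_inj; rewrite /= linearP. Qed.

Lemma sub_diffK n x :
  mklin (@sub_diff_linear (n - 1)) (mklin (@sub_diff_linear n) x) = 0.
Proof. by apply: sm_val_inj; exact: dlK. Qed.

Definition subcx : cx :=
  @mkcx (fun n => sm_type (S n)) (fun n => mklin (@sub_diff_linear n)) sub_diffK.

Definition subcx_incl : chain_map subcx X.
Proof.
by apply: (@mkmap subcx X (fun n => sm_incl (S n))).
Defined.

Lemma subcx_incl_inj n : injective (ml subcx_incl n).
Proof. exact: sm_val_inj. Qed.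

Lemma subcx_inclS n x : S n (ml subcx_incl n x).
Proof. exact: (sm_valS x). Qed.

Lemma subcx_inclP n x : S n x -> exists y, ml subcx_incl n y = x.
Proof. by move=> Sx; exists (sm_mk Sx). Qed.

Lemma subcx_lift (Z : cx) (f : chain_map Z X) :
  (forall n z, S n (ml f n z)) ->
  exists g : chain_map Z subcx, chain_comp subcx_incl g = f.
Proof.
move=> fS.
have gl n : linear (fun z => sm_mk (fS n z)).
  by move=> c z t; apply: sm_val_inj; exact: linearP.
unshelve eexists.
  apply: (@mkmap_fun Z subcx _ gl) => n z.
  by apply: sm_val_inj; exact: ml_diff.
exact: ml_ext.
Qed.

End Subcomplex.

Section Product.
Variables X Y : cx.

Definition prod_diff n (p : el X n * el Y n) : el X (n - 1) * el Y (n - 1) :=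
  (dl X n p.1, dl Y n p.2).

Lemma prod_diff_linear n : linear (@prod_diff n).
Proof. by move=> c p q; congr (_, _); exact: linearP. Qed.

Lemma prod_diffK n x :
  mklin (@prod_diff_linear (n - 1)) (mklin (@prod_diff_linear n) x) = 0.
Proof. by congr (_, _); exact: dlK. Qed.

Definition prodcx : cx :=
  @mkcx (fun n => (el X n * el Y n)%type) (fun n => mklin (@prod_diff_linear n))
    prod_diffK.

Definition prod_fst : chain_map prodcx X.
Proof. by apply: (@mkmap prodcx X (fun n => fst)). Defined.

Definition prod_snd : chain_map prodcx Y.
Proof. by apply: (@mkmap prodcx Y (fun n => snd)). Defined.

Lemma pair_linear (Z : cx) (f : chain_map Z X) (g : chain_map Z Y) n :
  linear (fun z => (ml f n z, ml g n z)).
Proof. by move=> c z t; congr (_, _); exact: linearP. Qed.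

Definition prod_pair (Z : cx) (f : chain_map Z X) (g : chain_map Z Y) :
  chain_map Z prodcx.
Proof.
apply: (@mkmap_fun Z prodcx _ (pair_linear f g)) => n z.
by congr (_, _); exact: ml_diff.
Defined.

End Product.
End ModuleComplexes.

(** * Initial complexes with chosen lifts *)

Section InitialAlgebra.
Variables (R : pzRingType) (J : Type).
Local Notation cx := (complex (LMod R)).
Variables (A B : J -> cx) (i : forall j, chain_map (A j) (B j)).

Section Construction.
Variables (M N : cx) (f : chain_map M N).

(** [Tfill] takes bare families of functions: that [u] is a chain map only makes sense once terms
    are interpreted in a complex, so it is left to [wf]. *)
Inductive term : int -> Type :=
| Tin n of el M n : term n
| Tadd n of term n & term n : term n
| Tscale n of R & term n : term n
| Tdiff n of term n : term (n - 1)
| Tfill n (j : J) (u : forall m, el (A j) m -> term m)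
    (w : forall m, el (B j) m -> el N m) (b : el (B j) n) : term n.

(* The base is allowed to vary along N -> al_base, so that a map between two
   factorization problems makes the second initial complex an algebra for the
   first: this gives functoriality. *)
Record algebra := Algebra {
  al_obj :> cx;
  al_base : cx;
  al_in : chain_map M al_obj;
  al_out : chain_map al_obj al_base;
  al_map : chain_map N al_base;
  al_sq : chain_comp al_out al_in = chain_comp al_map f;
  al_lift : forall j (u : forall m, el (A j) m -> el al_obj m)
    (w : forall m, el (B j) m -> el al_base m) n, el (B j) n -> el al_obj n;
  al_liftP : forall j (U : chain_map (A j) al_obj) (W : chain_map (B j) al_base),
    chain_comp al_out U = chain_comp W (i j) ->
    exists h : chain_map (B j) al_obj,
      [/\ forall n b, ml h n b = al_lift (ml U) (ml W) b,
          chain_comp h (i j) = U & chain_comp al_out h = W] }.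

Fixpoint itp (Q : algebra) n (t : term n) : el Q n :=
  match t in term n return el Q n with
  | Tin n x => ml (al_in Q) n x
  | Tadd n t t' => itp Q t + itp Q t'
  | Tscale n c t => c *: itp Q t
  | Tdiff n t => dl Q n (itp Q t)
  | Tfill n j u w b =>
      al_lift (fun m a => itp Q (u m a)) (fun m b => ml (al_map Q) m (w m b)) b
  end.

(* The filling is meaningful only for squares that commute in every algebra. *)
Fixpoint wf n (t : term n) : Prop :=
  match t with
  | Tin _ _ => True
  | Tadd _ t t' => wf t /\ wf t'
  | Tscale _ _ t => wf t
  | Tdiff _ t => wf t
  | Tfill _ j u w _ => (forall m a, wf (u m a)) /\
      exists W : chain_map (B j) N, (forall m b, w m b = ml W m b) /\
        forall Q : algebra, exists U : chain_map (A j) Q,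
          (forall m a, ml U m a = itp Q (u m a)) /\
          chain_comp (al_out Q) U = chain_comp (al_map Q) (chain_comp W (i j))
  end.

Lemma base_liftP j (U : chain_map (A j) N) (W : chain_map (B j) N) :
    chain_comp (chain_id N) U = chain_comp W (i j) ->
  exists h : chain_map (B j) N, [/\ forall n b, ml h n b = ml W n b,
    chain_comp h (i j) = U & chain_comp (chain_id N) h = W].
Proof.
move=> sq; exists W; split=> //; last exact: ml_ext.
by rewrite -sq; exact: ml_ext.
Qed.

(** Interpretation in this algebra computes the value of a term in [N]; it becomes the map from the
    initial complex to [N]. *)
Definition base_algebra : algebra :=
  @Algebra N N f (chain_id N) (chain_id N) erefl (fun j _ w => w) base_liftP.

Lemma al_lift_ext (Q : algebra) j (u u' : forall m, el (A j) m -> el Q m)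
    (w w' : forall m, el (B j) m -> el (al_base Q) m) n (b : el (B j) n) :
    (forall m a, u m a = u' m a) -> (forall m b, w m b = w' m b) ->
  al_lift u w b = al_lift u' w' b.
Proof.
move=> uu' ww'; have -> : u = u'.
  by apply/functional_extensionality_dep => m; apply/funext.
by have -> : w = w' by apply/functional_extensionality_dep => m; apply/funext.
Qed.

Lemma ml_eq (X Y : cx) (g h : chain_map X Y) n x : g = h -> ml g n x = ml h n x.
Proof. by move->. Qed.

Lemma itp_out (Q : algebra) n (t : term n) : wf t ->
  ml (al_out Q) n (itp Q t) = ml (al_map Q) n (itp base_algebra t).
Proof.
elim: t => {n} [n x|n t IHt t' IHt'|n c t IHt|n t IHt|n j u IHu w b] /=.
- by move=> _; exact: (ml_eq x (al_sq Q)).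
- by case=> /IHt tE /IHt' t'E; rewrite !linearD tE t'E.
- by move=> /IHt tE; rewrite !linearZ tE.
- by move=> /IHt tE; rewrite -!ml_diff tE.
- case=> wfu [W [wW]] /(_ Q) [U [uU sq]].
  have [|h [hE _ ho]] := @al_liftP Q j U (chain_comp (al_map Q) W).
    by rewrite sq; exact: ml_ext.
  rewrite (@al_lift_ext Q j _ (ml U) _ (ml (chain_comp (al_map Q) W))) //; last first.
    by move=> m a; rewrite wW.
  by rewrite -hE; apply: etrans (ml_eq b ho) _; rewrite wW.
Qed.

Record wterm n := Wterm { wt_val : term n; wt_wf : wf wt_val }.
HB.instance Definition _ n := gen_eqMixin (wterm n).
HB.instance Definition _ n := gen_choiceMixin (wterm n).

Definition sem n : rel (wterm n) := fun t t' =>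
  `[< forall Q, itp Q (wt_val t) = itp Q (wt_val t') >].

Lemma sem_refl n : reflexive (@sem n).
Proof. by move=> t; apply/asboolP. Qed.

Lemma sem_sym n : symmetric (@sem n).
Proof. by move=> t u; apply/asbool_equiv_eq; split=> tu Q. Qed.

Lemma sem_trans n : transitive (@sem n).
Proof.
by move=> t s u /asboolP st /asboolP tu; apply/asboolP => Q; rewrite st.
Qed.

Canonical sem_equiv n := EquivRel (@sem n) (@sem_refl n) (@sem_sym n) (@sem_trans n).

Definition free n : Type := {eq_quot (sem_equiv n)}.
HB.instance Definition _ n := Choice.on (free n).
HB.instance Definition _ n := EqQuotient.on (free n).

Definition wzero n : wterm n := @Wterm n (Tin 0) I.

(** Ill-formed terms get the class of 0. The lift operation of an algebra accepts arbitrary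
    functions, so [free_fill] must be defined even where the filling term is not well formed. *)
Definition cls n (t : term n) : free n :=
  if pselect (wf t) is left p then \pi_(free n) (Wterm p) else \pi_(free n) (wzero n).

Definition rep n (e : free n) : term n := wt_val (repr e).

Lemma rep_wf n (e : free n) : wf (rep e).
Proof. exact: wt_wf. Qed.

Lemma cls_rep n (e : free n) : cls (rep e) = e.
Proof.
rewrite /cls; case: pselect => [p|/(_ (rep_wf e))//].
rewrite -[RHS]reprK; congr (\pi_(free n) _).
by rewrite /rep in p *; case: (repr e) p => t q p; congr Wterm; exact: Prop_irrelevance.
Qed.

Definition eitp (Q : algebra) n (e : free n) : el Q n := itp Q (rep e).

Lemma eitp_cls (Q : algebra) n (t : term n) : wf t -> eitp Q (cls t) = itp Q t.
Proof.
move=> wft; rewrite /cls; case: pselect => // p.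
have /eqquotP/asboolP/(_ Q) // :
  repr (\pi_(free n) (Wterm p)) = Wterm p %[mod free n] by rewrite reprK.
Qed.

(** The interpretations are jointly injective by construction, so every law of the initial complex
    reduces to the same law in each algebra. *)
Lemma free_ext n (e e' : free n) : (forall Q, eitp Q e = eitp Q e') -> e = e'.
Proof.
by move=> ee'; rewrite -[e]reprK -[e']reprK; apply/eqquotP/asboolP => Q; exact: ee'.
Qed.

Definition free_zero n : free n := cls (Tin 0).
Definition free_add n (e e' : free n) : free n := cls (Tadd (rep e) (rep e')).
Definition free_scale n (c : R) (e : free n) : free n := cls (Tscale c (rep e)).

Lemma eitp0 Q n : eitp Q (free_zero n) = 0.
Proof. by rewrite eitp_cls //= linear0. Qed.

Lemma eitpD Q n (e e' : free n) : eitp Q (free_add e e') = eitp Q e + eitp Q e'.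
Proof. by rewrite eitp_cls //=; split; exact: rep_wf. Qed.

Lemma eitpZ Q n c (e : free n) : eitp Q (free_scale c e) = c *: eitp Q e.
Proof. by rewrite eitp_cls //=; exact: rep_wf. Qed.

Lemma free_addA n : associative (@free_add n).
Proof. by move=> a b c; apply: free_ext => Q; rewrite !eitpD addrA. Qed.

Lemma free_addC n : commutative (@free_add n).
Proof. by move=> a b; apply: free_ext => Q; rewrite !eitpD addrC. Qed.

Lemma free_add0 n : left_id (free_zero n) (@free_add n).
Proof. by move=> a; apply: free_ext => Q; rewrite eitpD eitp0 add0r. Qed.

Lemma free_addN n : left_inverse (free_zero n) (free_scale (-1)) (@free_add n).
Proof.
by move=> a; apply: free_ext => Q; rewrite eitpD eitp0 eitpZ scaleN1r addNr.
Qed.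

HB.instance Definition _ n := GRing.isZmodule.Build (free n)
  (@free_addA n) (@free_addC n) (@free_add0 n) (@free_addN n).

Lemma free_scaleA n c d (e : free n) :
  free_scale c (free_scale d e) = free_scale (c * d) e.
Proof. by apply: free_ext => Q; rewrite !eitpZ scalerA. Qed.

Lemma free_scale1 n : left_id 1 (@free_scale n).
Proof. by move=> e; apply: free_ext => Q; rewrite eitpZ scale1r. Qed.

Lemma free_scaleDr n : right_distributive (@free_scale n) +%R.
Proof. by move=> c e e'; apply: free_ext => Q; rewrite !(eitpZ, eitpD) scalerDr. Qed.

Lemma free_scaleDl n (e : free n) : {morph (@free_scale n)^~ e : c d / c + d}.
Proof. by move=> c d; apply: free_ext => Q; rewrite !(eitpZ, eitpD) scalerDl. Qed.

HB.instance Definition _ n := GRing.Zmodule_isLmodule.Build R (free n)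
  (@free_scaleA n) (@free_scale1 n) (@free_scaleDr n) (@free_scaleDl n).

Lemma eitp_linear (Q : algebra) n : linear (@eitp Q n : free n -> el Q n).
Proof. by move=> c e e'; rewrite eitpD eitpZ. Qed.

Definition free_diff n (e : free n) : free (n - 1) := cls (Tdiff (rep e)).

Lemma eitp_diff (Q : algebra) n (e : free n) : eitp Q (free_diff e) = dl Q n (eitp Q e).
Proof. by rewrite eitp_cls //=; exact: rep_wf. Qed.

Lemma free_diff_linear n : linear (@free_diff n).
Proof.
by move=> c e e'; apply: free_ext => Q; rewrite eitp_diff !eitp_linear !eitp_diff linearP.
Qed.

Lemma free_diffK n (e : free n) :
  mklin (@free_diff_linear (n - 1)) (mklin (@free_diff_linear n) e) = 0.
Proof. by apply: free_ext => Q; rewrite /= !eitp_diff dlK eitp0. Qed.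

Definition freecx : cx :=
  @mkcx R (fun n => free n : lmodType R) (fun n => mklin (@free_diff_linear n)) free_diffK.

Definition free_itp (Q : algebra) : chain_map freecx Q.
Proof.
apply: (@mkmap R freecx Q (fun n => mklin (@eitp_linear Q n))) => n x.
by rewrite /= -eitp_diff.
Defined.

Lemma free_itp_ext n (e e' : el freecx n) :
  (forall Q, ml (free_itp Q) n e = ml (free_itp Q) n e') -> e = e'.
Proof. exact: free_ext. Qed.

Lemma free_in_linear n : linear (fun x : el M n => cls (Tin x) : el freecx n).
Proof.
by move=> c x y; apply: free_ext => Q; rewrite eitp_linear !eitp_cls //= linearP.
Qed.

Definition free_in : chain_map M freecx.
Proof.
apply: (@mkmap_fun R M freecx _ free_in_linear) => n x.
by apply: free_ext => Q; rewrite eitp_diff !eitp_cls //=; exact: ml_diff.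
Defined.

Lemma free_itp_in (Q : algebra) : chain_comp (free_itp Q) free_in = al_in Q.
Proof. by apply: ml_ext => n x; exact: eitp_cls. Qed.

Definition free_out : chain_map freecx N := free_itp base_algebra.

Lemma free_itp_out (Q : algebra) :
  chain_comp (al_out Q) (free_itp Q) = chain_comp (al_map Q) free_out.
Proof. by apply: ml_ext => n e; apply: itp_out; exact: rep_wf. Qed.

Definition free_fill j (u : forall m, el (A j) m -> el freecx m)
    (w : forall m, el (B j) m -> el N m) n (b : el (B j) n) : el freecx n :=
  cls (Tfill (fun m a => rep (u m a)) w b).

Section Fill.
Variables (j : J) (U : chain_map (A j) freecx) (W : chain_map (B j) N).
Hypothesis sq : chain_comp free_out U = chain_comp W (i j).

Lemma itp_sq (Q : algebra) : chain_comp (al_out Q) (chain_comp (free_itp Q) U) =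
  chain_comp (chain_comp (al_map Q) W) (i j).
Proof.
apply: ml_ext => n a; rewrite -[LHS]/(ml (chain_comp (al_out Q) (free_itp Q)) n (ml U n a)).
rewrite free_itp_out -[LHS]/(ml (al_map Q) n (ml (chain_comp free_out U) n a)).
by rewrite sq.
Qed.

Lemma fill_wf n (b : el (B j) n) : wf (Tfill (fun m a => rep (ml U m a)) (ml W) b).
Proof.
split=> [m a|]; first exact: rep_wf.
exists W; split=> // Q; exists (chain_comp (free_itp Q) U); split=> //.
by rewrite itp_sq; exact: ml_ext.
Qed.

Lemma itp_fill (Q : algebra) n (b : el (B j) n) :
  ml (free_itp Q) n (free_fill (ml U) (ml W) b) =
  al_lift (ml (chain_comp (free_itp Q) U)) (ml (chain_comp (al_map Q) W)) b.
Proof. exact: (eitp_cls Q (fill_wf b)). Qed.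

(** After interpretation in any algebra the filling agrees with the chain map given by [al_liftP].
    Linearity, compatibility with the differential and the two triangles are thus checked there. *)
Lemma free_fillP : exists h : chain_map (B j) freecx,
  [/\ forall n b, ml h n b = free_fill (ml U) (ml W) b,
      chain_comp h (i j) = U & chain_comp free_out h = W].
Proof.
have lin n : linear (fun b => free_fill (ml U) (ml W) b : el freecx n).
  move=> c b b'; apply: free_itp_ext => Q.
  by have [h [hE _ _]] := al_liftP (itp_sq Q); rewrite linearP !itp_fill -!hE linearP.
have com n b : dl freecx n (free_fill (ml U) (ml W) b) =
    free_fill (ml U) (ml W) (dl (B j) n b).
  apply: free_itp_ext => Q.
  by have [h [hE _ _]] := al_liftP (itp_sq Q); rewrite -ml_diff !itp_fill -!hE ml_diff.
exists (@mkmap_fun R (B j) freecx _ lin com); split=> //.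
  apply: ml_ext => n a; apply: free_itp_ext => Q.
  have [h [hE hi _]] := al_liftP (itp_sq Q).
  apply: etrans (itp_fill Q _) _; rewrite -hE.
  exact: (ml_eq a hi).
apply: ml_ext => n b; apply: etrans (itp_fill base_algebra b) _.
by [].
Qed.

End Fill.

Lemma free_out_in : chain_comp free_out free_in = chain_comp (chain_id N) f.
Proof. by rewrite [LHS](free_itp_in base_algebra); exact: ml_ext. Qed.

Definition free_algebra : algebra :=
  @Algebra freecx N free_in free_out (chain_id N) free_out_in
    free_fill free_fillP.

(** Induction on terms. The map [g] needs to respect fillings of commuting squares only, because
    well-formed terms contain no others. *)
Lemma free_itp_unique (Q : algebra) (g : chain_map freecx Q) :
  chain_comp g free_in = al_in Q ->
  (forall j (U : chain_map (A j) freecx) (W : chain_map (B j) N),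
     chain_comp free_out U = chain_comp W (i j) -> forall n b,
     ml g n (free_fill (ml U) (ml W) b) =
     al_lift (ml (chain_comp g U)) (ml (chain_comp (al_map Q) W)) b) ->
  g = free_itp Q.
Proof.
move=> gin gfill.
suff gE n (t : term n) : wf t -> ml g n (cls t) = itp Q t.
  by apply: ml_ext => n e; rewrite -[e in LHS]cls_rep; apply: gE; exact: rep_wf.
elim: t => {n} [n x|n t IHt t' IHt'|n c t IHt|n t IHt|n j u IHu w b] /=.
- by move=> _; exact: (ml_eq x gin).
- move=> [wt wt']; have -> : cls (Tadd t t') = (cls t : el freecx n) + cls t'.
    by apply: free_ext => P; rewrite eitpD !eitp_cls.
  by rewrite linearD IHt // IHt'.
- move=> wt; have -> : cls (Tscale c t) = c *: (cls t : el freecx n).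
    by apply: free_ext => P; rewrite eitpZ !eitp_cls.
  by rewrite linearZ IHt.
- move=> wt; have -> : cls (Tdiff t) = dl freecx n (cls t).
    by apply: free_ext => P; rewrite eitp_diff !eitp_cls.
  by rewrite -ml_diff IHt.
- move=> wfu; case: (wfu) => wu [W [wW wQ]].
  (* Well-formedness gives a chain map in each algebra separately; joint injectivity of the
     interpretations assembles from them a chain map [U] into the initial complex. *)
  have ucE P m a : eitp P (cls (u m a)) = itp P (u m a) by rewrite eitp_cls.
  have lin m : linear (fun a => cls (u m a) : el freecx m).
    move=> c a a'; apply: free_ext => P; have [U [UE _]] := wQ P.
    by rewrite eitp_linear !ucE -!UE linearP.
  have com m a : dl freecx m (cls (u m a)) = cls (u (m - 1) (dl (A j) m a)).
    apply: free_ext => P; have [U [UE _]] := wQ P.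
    by rewrite eitp_diff !ucE -!UE ml_diff.
  pose U : chain_map (A j) freecx := @mkmap_fun R (A j) freecx _ lin com.
  have sq : chain_comp free_out U = chain_comp W (i j).
    have [U' [U'E sq']] := wQ base_algebra.
    apply: ml_ext => m a; rewrite -[LHS]/(eitp base_algebra (cls (u m a))) ucE -U'E.
    exact: (ml_eq a sq').
  have -> : cls (Tfill u w b) = free_fill (ml U) (ml W) b.
    apply: free_ext => P; rewrite eitp_cls // [RHS](itp_fill sq).
    by apply: al_lift_ext => m a; [exact: esym (ucE _ _ _)|rewrite wW].
  rewrite gfill //; apply: al_lift_ext => m a; first exact: IHu.
  by rewrite wW.
Qed.

End Construction.
End InitialAlgebra.

(** * Lifting properties and functoriality of the initial complex *)

Section FreeFactorization.
Variables (R : pzRingType) (J : Type).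
Local Notation cx := (complex (LMod R)).
Local Notation ChR := (Ch (LMod R)).
Variables (A B : J -> cx) (i : forall j, chain_map (A j) (B j)).

Definition J_injective (X Y : cx) (q : chain_map X Y) : Prop :=
  forall j, lifts (C := ChR) (i j) q.

Section FreeSection.
Variables (M N : cx) (f : chain_map M N).
Local Notation E := (freecx i f).
Variables (P : cx) (p : chain_map P E) (s : chain_map M P).
Hypotheses (pJ : J_injective p) (ps : chain_comp p s = free_in i f).

(** A lift over [N] alone would not make [p] respect the chosen lifts. The one chosen here must lie
    over the filling already fixed in [E]; the value 0 serves only when there is none. *)
Let pick j (u : forall m, el (A j) m -> el P m)
    (w : forall m, el (B j) m -> el N m) n (b : el (B j) n) : el P n :=
  if pselect (exists h : chain_map (B j) P,
    (forall m a, ml (chain_comp h (i j)) m a = u m a) /\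
    (forall m b', ml (chain_comp p h) m b' =
       free_fill (fun l a => ml p l (u l a) : el E l) w b'))
  is left e then ml (sval (cid e)) n b else 0.

Lemma pick_liftP j (U : chain_map (A j) P) (W : chain_map (B j) N) :
  chain_comp (chain_comp (free_out i f) p) U = chain_comp W (i j) ->
  exists h : chain_map (B j) P, [/\ forall n b, ml h n b = pick (ml U) (ml W) b,
    chain_comp h (i j) = U,
    forall n b, ml (chain_comp p h) n b =
      free_fill (ml (chain_comp p U)) (ml W) b &
    chain_comp (chain_comp (free_out i f) p) h = W].
Proof.
move=> sq; have sq' : chain_comp (free_out i f) (chain_comp p U) = chain_comp W (i j).
  by rewrite -sq; exact: ml_ext.
have [hE [hEE hEi hEo]] := free_fillP sq'.
rewrite /pick; case: pselect => [e|ne].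
  case: (cid e) => h [hi hp]; exists h; split=> //; first exact: ml_ext.
  apply: ml_ext => n b; rewrite -hEo -[LHS]/(ml (free_out i f) n (ml (chain_comp p h) n b)).
  by rewrite hp -hEE.
have [h [hi hp]] := pJ (esym hEi); case: ne; exists h.
split=> [m a|m b]; first exact: (ml_eq a hi).
by rewrite -[RHS]hEE; exact: (ml_eq b hp).
Qed.

Lemma pick_liftP' j (U : chain_map (A j) P) (W : chain_map (B j) N) :
  chain_comp (chain_comp (free_out i f) p) U = chain_comp W (i j) ->
  exists h : chain_map (B j) P, [/\ forall n b, ml h n b = pick (ml U) (ml W) b,
    chain_comp h (i j) = U & chain_comp (chain_comp (free_out i f) p) h = W].
Proof. by move=> /pick_liftP [h []]; exists h. Qed.

Lemma section_sq :
  chain_comp (chain_comp (free_out i f) p) s = chain_comp (chain_id N) f.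
Proof. by rewrite -(free_out_in i f) -ps; exact: ml_ext. Qed.

Let Q : algebra i f :=
  @Algebra _ _ _ _ i _ _ f P N s (chain_comp (free_out i f) p) (chain_id N) section_sq
    pick pick_liftP'.

(** With the lifts [pick], [P] is an algebra and [p] preserves the structure. The composite of the
    interpretation in [P] with [p] is then the identity of [E], by uniqueness of maps out of the
    initial algebra. *)
Lemma free_section : exists g : chain_map E P,
  chain_comp p g = chain_id E /\ chain_comp g (free_in i f) = s.
Proof.
exists (free_itp Q); split; last exact: (free_itp_in Q).
transitivity (free_itp (free_algebra i f)).
  apply: (@free_itp_unique _ _ _ _ _ _ _ _ (free_algebra i f)).
    apply: etrans ps; apply: ml_ext => n x.
    exact: (congr1 (ml p n) (ml_eq x (free_itp_in Q))).
  move=> j U W sq n b.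
  have sq' : chain_comp (chain_comp (free_out i f) p) (chain_comp (free_itp Q) U) =
      chain_comp W (i j).
    by apply: etrans (itp_sq sq Q) _; exact: ml_ext.
  have [h [hE hi hp _]] := pick_liftP sq'.
  rewrite -[LHS]/(ml p n (ml (free_itp Q) n (free_fill (ml U) (ml W) b))).
  rewrite (itp_fill sq Q) -[al_lift _ _ _](hE n b).
  by rewrite -[LHS]/(ml (chain_comp p h) n b) hp.
symmetry; apply: (@free_itp_unique _ _ _ _ _ _ _ _ (free_algebra i f)).
  exact: ml_ext.
by [].
Qed.

End FreeSection.

Section Lifting.
Variables (M N : cx) (f : chain_map M N) (X Y : cx) (q : chain_map X Y).
Variables (u : chain_map M X) (v : chain_map (freecx i f) Y).
Local Notation E := (freecx i f).

Lemma pullback_set0 n : ml v n (0 : el E n * el X n).1 = ml q n (0 : el E n * el X n).2.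
Proof. by rewrite !linear0. Qed.

Lemma pullback_setP n c (z t : el E n * el X n) :
  ml v n z.1 = ml q n z.2 -> ml v n t.1 = ml q n t.2 ->
  ml v n (c *: z + t).1 = ml q n (c *: z + t).2.
Proof. by move=> zE tE; rewrite !linearP zE tE. Qed.

Definition pullback_sub n : submodule (el (prodcx E X) n) :=
  Submodule (pullback_set0 n) (@pullback_setP n).

Lemma pullback_subd n (z : el (prodcx E X) n) : pullback_sub n z ->
  pullback_sub (n - 1) (dl (prodcx E X) n z).
Proof. by rewrite /= -!ml_diff => ->. Qed.

Local Notation P := (subcx pullback_subd).
Let p : chain_map P E := chain_comp (prod_fst E X) (subcx_incl pullback_subd).

Lemma pullback_J_injective : J_injective q -> J_injective p.
Proof.
move=> qJ j a b sq.
have [|h [hi qh]] := @qJ j (chain_comp (prod_snd E X) (chain_comp (subcx_incl pullback_subd) a))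
    (chain_comp v b).
  apply: ml_ext => n x.
  apply: etrans (congr1 (ml v n) (ml_eq x sq)).
  exact: esym (subcx_inclS (ml a n x)).
have [|g gE] := @subcx_lift _ _ _ pullback_subd _ (prod_pair b h).
  by move=> n z; rewrite /= -[LHS]/(ml (chain_comp v b) n z) -(ml_eq z qh).
exists g; split.
  apply: ml_ext => n x; apply: (@subcx_incl_inj _ _ _ pullback_subd).
  rewrite -[LHS]/(ml (chain_comp (subcx_incl pullback_subd) g) n (ml (i j) n x)) gE.
  rewrite [LHS](_ : _ = (ml b n (ml (i j) n x), ml h n (ml (i j) n x))) //.
  rewrite -[X in (X, _)]/(ml (chain_comp b (i j)) n x) -(ml_eq x sq).
  rewrite -[X in (_, X)]/(ml (chain_comp h (i j)) n x) (ml_eq x hi).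
  exact: esym (surjective_pairing _).
apply: ml_ext => n y.
rewrite -[LHS]/(ml (chain_comp (subcx_incl pullback_subd) g) n y).1.
by rewrite gE.
Qed.

(** The pullback of [q] along [v] is again [J_injective], so it has a section that restricts to
    (free_in, u) on [M]. The section followed by the projection to [X] is the lift. *)
Lemma free_in_llp : J_injective q ->
  chain_comp q u = chain_comp v (free_in i f) ->
  exists h : chain_map E X, chain_comp h (free_in i f) = u /\ chain_comp q h = v.
Proof.
move=> /pullback_J_injective pJ sq.
have [|s sE] := @subcx_lift _ _ _ pullback_subd _ (prod_pair (free_in i f) u).
  by move=> n z; exact: esym (ml_eq z sq).
have [|g [pg gi]] := free_section pJ (s := s).
  by apply: ml_ext => n x; rewrite -[LHS]/(ml (chain_comp (subcx_incl pullback_subd) s) n x).1 sE.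
exists (chain_comp (prod_snd E X) (chain_comp (subcx_incl pullback_subd) g)); split.
  apply: ml_ext => n x.
  rewrite -[LHS]/(ml (subcx_incl pullback_subd) n (ml (chain_comp g (free_in i f)) n x)).2.
  by rewrite gi -[LHS]/(ml (chain_comp (subcx_incl pullback_subd) s) n x).2 sE.
apply: ml_ext => n x.
apply: etrans (esym (subcx_inclS (ml g n x))) _.
exact: (congr1 (ml v n) (ml_eq x pg)).
Qed.

End Lifting.

Section Functoriality.
Variables (M N M' N' : cx) (f : chain_map M N) (f' : chain_map M' N').
Variables (u : chain_map M M') (v : chain_map N N').
Hypothesis sq : chain_comp f' u = chain_comp v f.
Local Notation E' := (freecx i f').

Lemma change_sq :
  chain_comp (free_out i f') (chain_comp (free_in i f') u) = chain_comp v f.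
Proof.
rewrite -sq; apply: ml_ext => n x; exact: (ml_eq (ml u n x) (free_out_in i f')).
Qed.

Definition change_algebra : algebra i f :=
  @Algebra _ _ _ _ i _ _ f E' N' (chain_comp (free_in i f') u) (free_out i f') v
    change_sq (@free_fill _ _ _ _ i _ _ f') (@free_fillP _ _ _ _ i _ _ f').

Definition free_mid : chain_map (freecx i f) E' := free_itp change_algebra.

Lemma free_mid_in : chain_comp free_mid (free_in i f) = chain_comp (free_in i f') u.
Proof. exact: (free_itp_in change_algebra). Qed.

Lemma free_mid_out : chain_comp (free_out i f') free_mid = chain_comp v (free_out i f).
Proof. exact: (free_itp_out change_algebra). Qed.

End Functoriality.

Lemma free_mid_id (M N : cx) (f : chain_map M N)
    (sq : chain_comp f (chain_id M) = chain_comp (chain_id N) f) :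
  free_mid sq = chain_id (freecx i f).
Proof.
symmetry; apply: (@free_itp_unique _ _ _ _ i _ _ _ (change_algebra sq)); first exact: ml_ext.
by [].
Qed.

Lemma free_mid_comp (M N M' N' M'' N'' : cx)
    (f : chain_map M N) (f' : chain_map M' N') (f'' : chain_map M'' N'')
    (u : chain_map M M') (v : chain_map N N') (u' : chain_map M' M'')
    (v' : chain_map N' N'') (sq : chain_comp f' u = chain_comp v f)
    (sq' : chain_comp f'' u' = chain_comp v' f')
    (sq'' : chain_comp f'' (chain_comp u' u) = chain_comp (chain_comp v' v) f) :
  free_mid sq'' = chain_comp (free_mid sq') (free_mid sq).
Proof.
symmetry; apply: (@free_itp_unique _ _ _ _ i _ _ _ (change_algebra sq'')).
  apply: ml_ext => n x.
  apply: etrans (congr1 (ml (free_mid sq') n) (ml_eq x (free_mid_in sq))) _.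
  exact: (ml_eq (ml u n x) (free_mid_in sq')).
move=> j U W sqUW n b.
rewrite -[LHS]/(ml (free_mid sq') n (ml (free_mid sq) n (free_fill (ml U) (ml W) b))).
have -> := itp_fill sqUW (change_algebra sq) b.
have sqUW' : chain_comp (free_out i f') (chain_comp (free_mid sq) U) =
    chain_comp (chain_comp v W) (i j).
  exact: (itp_sq sqUW (change_algebra sq)).
exact: (itp_fill sqUW' (change_algebra sq') b).
Qed.

Definition free_factorization : functorial_factorization ChR.
Proof.
apply: (@FunctorialFactorization ChR (fun X Y f => freecx i f)
  (fun X Y f => free_in i f) (fun X Y f => free_out i f)
  (fun X Y X' Y' f f' u v sq => free_mid sq)).
- by move=> X Y f; rewrite [LHS](free_out_in i f); exact: ml_ext.
- by move=> *; exact: free_mid_in.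
- by move=> *; exact: free_mid_out.
- by move=> *; exact: free_mid_id.
- by move=> *; exact: free_mid_comp.
Defined.

End FreeFactorization.

(** * The tensor functor and its right adjoint *)

(* A relation between tensors over M already holds over every submodule
   containing the finitely many elements of M that occur in its derivation. *)
Lemma tensor_eq_finite (H : pzRingType) (X : zmodType) (ract : X -> H -> X)
    (M : lmodType H) (s t : seq (X * M)) : tensor_eq ract s t ->
  exists l : seq M, forall (M' : lmodType H) (j : {linear M' -> M}),
    injective j -> (forall m, m \in l -> exists m', j m' = m) ->
    forall s' t', [seq (u.1, j u.2) | u <- s'] = s ->
      [seq (u.1, j u.2) | u <- t'] = t -> tensor_eq ract s' t'.
Proof.
have seqI (M' : lmodType H) (j : {linear M' -> M}) : injective j ->
    injective (map (fun u : X * M' => (u.1, j u.2))).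
  by move=> jI; apply: inj_map => -[x m] [y n] /= [-> /jI ->].
have seqS (M' : lmodType H) (j : {linear M' -> M}) (s0 : seq (X * M)) :
    (forall m, m \in map snd s0 -> exists m', j m' = m) ->
    exists s', [seq (u.1, j u.2) | u <- s'] = s0.
  elim: s0 => [_|[x m] s0 IHs jS]; first by exists [::].
  have [|s' s'E] := IHs; first by move=> m' m's; apply: jS; rewrite inE m's orbT.
  have [|m' m'E] := jS m; first by rewrite inE eqxx.
  by exists ((x, m') :: s'); rewrite /= s'E m'E.
elim=> {s t}.
- move=> s; exists [::] => M' j jI _ s' t' <- /(seqI _ _ jI) ->; exact: tensor_refl.
- move=> s t _ [l lP]; exists l => M' j jI jl s' t' s'E t'E.
  by apply: tensor_sym; exact: lP t'E s'E.
(* The intermediate sum [t] must lift along [j] as well, so its module entries join the list. *)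
- move=> t s u _ [l lP] _ [l' l'P]; exists (l ++ l' ++ map snd t) => M' j jI jl s' t' s'E t'E.
  have [|r' r'E] := seqS M' j t.
    by move=> m mt; apply: jl; rewrite !mem_cat mt !orbT.
  apply: (@tensor_trans _ _ _ _ r').
    by apply: lP r'E => // m ml; apply: jl; rewrite mem_cat ml.
  by apply: l'P t'E => // m ml; apply: jl; rewrite !mem_cat ml orbT.
- move=> s s' t t' _ [l lP] _ [l' l'P].
  exists (l ++ l') => M' j jI jl u u' uE u'E.
  have /(congr1 (take (size s))) := uE; rewrite -map_take take_size_cat // => tuE.
  have /(congr1 (drop (size s))) := uE; rewrite -map_drop drop_size_cat // => duE.
  have /(congr1 (take (size s'))) := u'E; rewrite -map_take take_size_cat // => tu'E.
  have /(congr1 (drop (size s'))) := u'E; rewrite -map_drop drop_size_cat // => du'E.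
  rewrite -(cat_take_drop (size s) u) -(cat_take_drop (size s') u').
  apply: tensor_cat; [apply: lP tuE tu'E|apply: l'P duE du'E] => // m ml;
    by apply: jl; rewrite mem_cat ml ?orbT.
- move=> s t; exists [::] => M' j jI _ u u' uE u'E.
  have -> : u = take (size s) u ++ drop (size s) u by rewrite cat_take_drop.
  have -> : u' = drop (size s) u ++ take (size s) u.
    apply: (seqI _ _ jI); rewrite u'E map_cat map_drop map_take uE.
    by rewrite take_size_cat // drop_size_cat.
  exact: tensor_catC.
- move=> x x' m; exists [::] => M' j jI _ [|[y n] [|]] //= [|[z p] [|[z' p'] [|]]] //=.
  move=> [-> <-] [-> /jI -> -> /jI ->]; exact: tensor_addl.
- move=> x m m'; exists [::] => M' j jI _ [|[y n] [|]] //= [|[z p] [|[z' p'] [|]]] //=.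
  move=> [-> nE] [-> pE -> p'E].
  have -> : n = p + p' by apply: jI; rewrite linearD pE p'E.
  exact: tensor_addr.
- move=> x; exists [::] => M' j jI _ [|[y n] [|]] //= [|] //=.
  move=> [-> nE] _; have -> : n = 0 by apply: jI; rewrite linear0.
  exact: tensor_zeror.
- move=> x h m; exists [::] => M' j jI _ [|[y n] [|]] //= [|[z p] [|]] //=.
  move=> [-> nE] [-> pE].
  have -> : p = h *: n by apply: jI; rewrite linearZ /= nE pE.
  exact: tensor_balance.
Qed.

Section TensorFunctor.
Variables (k : fieldType) (G : topGroupType) (V : smooth_rep k G).
Local Notation H := (rep_end_op V).

Definition tmod (M : lmodType H) : lmodType k := @rep_tensor k G V M.

Definition tsum (M : lmodType H) (s : seq (V * M)) : tmod M :=
  tensor_sum (@rep_ract k G V) s.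

Definition tmap (M N : lmodType H) (f : {linear M -> N}) :
  {linear tmod M -> tmod N} := rep_tensor_map f.

Section Sums.
Variable M : lmodType H.

Lemma tsumP (t : tmod M) : exists s, t = tsum s.
Proof. by elim/tensorW: t => s; exists s. Qed.

Lemma tsum0 : tsum [::] = 0 :> tmod M.
Proof. by []. Qed.

Lemma tsum_cat (s t : seq (V * M)) : tsum (s ++ t) = tsum s + tsum t.
Proof. exact: tensor_sum_cat. Qed.

Lemma tsum_cons u (s : seq (V * M)) : tsum (u :: s) = tsum [:: u] + tsum s.
Proof. exact: tensor_sum_cons. Qed.

Lemma tsumZ c (s : seq (V * M)) : c *: tsum s = tsum [seq (c *: u.1, u.2) | u <- s].
Proof.
rewrite {1}/GRing.scale /= /rep_tensor_scale.
exact: (tensor_mapE (idfun : {linear M -> M}) s (@scale_ract_morph k G V c)).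
Qed.

Lemma tsum_addl x y (m : M) : tsum [:: (x + y, m)] = tsum [:: (x, m)] + tsum [:: (y, m)].
Proof. by rewrite -tsum_cat; apply/tensor_sumP; exact: tensor_addl. Qed.

Lemma tsum_addr x (m n : M) : tsum [:: (x, m + n)] = tsum [:: (x, m)] + tsum [:: (x, n)].
Proof. by rewrite -tsum_cat; apply/tensor_sumP; exact: tensor_addr. Qed.

Lemma tsum_balance x (h : H) (m : M) : tsum [:: (rep_ract x h, m)] = tsum [:: (x, h *: m)].
Proof. by apply/tensor_sumP; exact: tensor_balance. Qed.

Lemma tsum_zero x : tsum [:: (x, 0 : M)] = 0.
Proof. by apply/tensor_sumP; exact: tensor_zeror. Qed.

Lemma tsum_ind (P : tmod M -> Prop) : P 0 ->
  (forall x m t, P t -> P (tsum [:: (x, m)] + t)) -> forall t, P t.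
Proof.
move=> P0 PS t; have [s ->] := tsumP t.
by elim: s => [//|[x m] s IHs]; rewrite tsum_cons; exact: PS.
Qed.

End Sums.

Lemma tmapE (M N : lmodType H) (f : {linear M -> N}) s :
  tmap f (tsum s) = tsum [seq (u.1, f u.2) | u <- s].
Proof. exact: (tensor_mapE f s (@ract_morph_id _ _ _)). Qed.

Lemma tmap_comp (M N P : lmodType H) (f : {linear M -> N}) (g : {linear N -> P})
    (h : {linear M -> P}) : (forall x, h x = g (f x)) ->
  forall t, tmap h t = tmap g (tmap f t).
Proof.
move=> hE; elim/tsum_ind => [|x m t IHt]; first by rewrite !linear0.
by rewrite !linearD IHt !tmapE /= hE.
Qed.

Lemma tmap_ext (M N : lmodType H) (f g : {linear M -> N}) : f =1 g -> tmap f =1 tmap g.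
Proof. by move=> /linear_ext ->. Qed.

Lemma tmap_id (M : lmodType H) (f : {linear M -> M}) : (forall x, f x = x) ->
  forall t, tmap f t = t.
Proof.
move=> fE; elim/tsum_ind => [|x m t IHt]; first by rewrite linear0.
by rewrite linearD IHt tmapE /= fE.
Qed.

Lemma tmapD (M N : lmodType H) (f g h : {linear M -> N}) :
  (forall x, h x = f x + g x) -> forall t, tmap h t = tmap f t + tmap g t.
Proof.
move=> hE; elim/tsum_ind => [|x m t IHt]; first by rewrite !linear0 addr0.
by rewrite !linearD IHt !tmapE /= hE tsum_addr addrACA.
Qed.

Lemma tmap0 (M N : lmodType H) (f : {linear M -> N}) :
  (forall x, f x = 0) -> forall t, tmap f t = 0.
Proof.
move=> fE; elim/tsum_ind => [|x m t IHt]; first by rewrite linear0.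
by rewrite linearD IHt tmapE /= fE tsum_zero addr0.
Qed.

Lemma tsum_finite (M : lmodType H) (s : seq (V * M)) : tsum s = 0 ->
  exists l : seq M, forall (M' : lmodType H) (j : {linear M' -> M}),
    injective j -> (forall m, m \in l -> exists m', j m' = m) ->
    forall s', [seq (u.1, j u.2) | u <- s'] = s -> tsum s' = 0.
Proof.
move=> /tensor_sumP/tensor_eq_finite[l lP]; exists l => M' j jI jl s' s'E.
rewrite -tsum0; apply/tensor_sumP; exact: (lP M' j jI jl s' [::] s'E).
Qed.

Section Coinduced.
Variable W : lmodType k.

Definition cohom : Type := {linear V -> W}.
HB.instance Definition _ := gen_eqMixin cohom.
HB.instance Definition _ := gen_choiceMixin cohom.

Definition coval (a : cohom) : {linear V -> W} := a.

Definition cohom_add (a b : cohom) : cohom := (coval a \+ coval b : {linear V -> W}).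
Definition cohom_opp (a : cohom) : cohom := (-1 \*: coval a : {linear V -> W}).
Definition cohom_zero : cohom := (\0 : {linear V -> W}).
(** Precomposition reverses products, and so does the multiplication of the opposite ring [H];
    together they give a left action. *)
Definition cohom_scale (h : H) (a : cohom) : cohom :=
  (coval a \o ((h : rep_end V) : {linear V -> V}) : {linear V -> W}).

Lemma cohom_ext (a b : cohom) : (forall x, coval a x = coval b x) -> a = b.
Proof. exact: linear_ext. Qed.

Lemma cohom_addA : associative cohom_add.
Proof. by move=> a b c; apply: cohom_ext => x /=; rewrite addrA. Qed.
Lemma cohom_addC : commutative cohom_add.
Proof. by move=> a b; apply: cohom_ext => x /=; rewrite addrC. Qed.
Lemma cohom_add0 : left_id cohom_zero cohom_add.
Proof. by move=> a; apply: cohom_ext => x /=; rewrite add0r. Qed.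
Lemma cohom_addN : left_inverse cohom_zero cohom_opp cohom_add.
Proof. by move=> a; apply: cohom_ext => x /=; rewrite scaleN1r addNr. Qed.

HB.instance Definition _ := GRing.isZmodule.Build cohom
  cohom_addA cohom_addC cohom_add0 cohom_addN.

Lemma cohom_scaleA g h a : cohom_scale g (cohom_scale h a) = cohom_scale (g * h) a.
Proof. exact: cohom_ext. Qed.
Lemma cohom_scale1 : left_id 1 cohom_scale.
Proof. by move=> a; exact: cohom_ext. Qed.
Lemma cohom_scaleDr : right_distributive cohom_scale +%R.
Proof. by move=> h a b; exact: cohom_ext. Qed.
Lemma cohom_scaleDl a : {morph cohom_scale^~ a : g h / g + h}.
Proof. by move=> g h; apply: cohom_ext => x /=; rewrite linearD. Qed.

HB.instance Definition _ := GRing.Zmodule_isLmodule.Build H cohom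
  cohom_scaleA cohom_scale1 cohom_scaleDr cohom_scaleDl.

Lemma covalD (a b : cohom) x : coval (a + b) x = coval a x + coval b x.
Proof. by []. Qed.

Lemma coval0 x : coval 0 x = 0.
Proof. by []. Qed.

Lemma covalZ h (a : cohom) x : coval (h *: a) x = coval a (rep_ract x h).
Proof. by []. Qed.

End Coinduced.

Section Adjunction.
Variables (M : lmodType H) (W : lmodType k).

Lemma tcurry_linear_in (f : {linear tmod M -> W}) (m : M) :
  linear (fun x => f (tsum [:: (x, m)])).
Proof.
move=> c x y; rewrite tsum_addl linearD; congr (_ + _).
by rewrite -linearZ tsumZ.
Qed.

Definition tcurry_fun (f : {linear tmod M -> W}) (m : M) : cohom W :=
  mklin (tcurry_linear_in f m).

Lemma tcurry_linear (f : {linear tmod M -> W}) : linear (tcurry_fun f).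
Proof.
move=> h m n; apply: cohom_ext => x; rewrite covalD covalZ /= -linearD.
by rewrite tsum_balance -tsum_addr.
Qed.

Definition tcurry (f : {linear tmod M -> W}) : {linear M -> cohom W} :=
  mklin (tcurry_linear f).

Lemma tcurryE f m x : coval (tcurry f m) x = f (tsum [:: (x, m)]).
Proof. by []. Qed.

Variable a : {linear M -> cohom W}.

Let fold (s : seq (V * M)) : W := \sum_(u <- s) coval (a u.2) u.1.

Lemma fold_tensor_eq s t : tensor_eq (@rep_ract k G V) s t -> fold s = fold t.
Proof.
rewrite /fold; elim=> {s t} //.
- by move=> t s u _ -> _ ->.
- by move=> s s' t t' _ ss' _ tt'; rewrite !big_cat /= ss' tt'.
- by move=> s t; rewrite !big_cat /= addrC.
- by move=> x x' m; rewrite !big_cons !big_nil /= !addr0 linearD.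
- by move=> x m m'; rewrite !big_cons !big_nil /= !addr0 linearD covalD.
- by move=> x; rewrite !big_cons !big_nil /= linear0 coval0 addr0.
- by move=> x h m; rewrite !big_cons !big_nil /= !addr0 linearZ covalZ.
Qed.

Definition tuncurry_fun (t : tmod M) : W := fold (repr (t : @rep_tensor k G V M)).

Lemma tuncurry_tsum s : tuncurry_fun (tsum s) = fold s.
Proof. exact/fold_tensor_eq/tensor_reprP. Qed.

Lemma tuncurry_linear : linear tuncurry_fun.
Proof.
move=> c t u; have [s ->] := tsumP t; have [r ->] := tsumP u.
rewrite tsumZ -tsum_cat !tuncurry_tsum /fold big_cat big_map /= scaler_sumr.
by congr (_ + _); apply: eq_bigr => v _; rewrite linearZ.
Qed.

Definition tuncurry : {linear tmod M -> W} := mklin tuncurry_linear.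

Lemma tuncurryE x m : tuncurry (tsum [:: (x, m)]) = coval (a m) x.
Proof. by rewrite /= tuncurry_tsum /fold big_seq1. Qed.

End Adjunction.

Lemma tuncurry_comp (M N : lmodType H) (W : lmodType k) (f : {linear M -> N})
    (a : {linear N -> cohom W}) (b : {linear M -> cohom W}) :
  (forall m, a (f m) = b m) -> forall t, tuncurry a (tmap f t) = tuncurry b t.
Proof.
move=> ab; elim/tsum_ind => [|x m t IHt]; first by rewrite !linear0.
by rewrite !linearD IHt tmapE !tuncurryE /= ab.
Qed.

Lemma tcurry_comp (M N : lmodType H) (W : lmodType k) (f : {linear M -> N})
    (a : {linear tmod N -> W}) (b : {linear tmod M -> W}) :
  (forall t, a (tmap f t) = b t) -> forall m, tcurry a (f m) = tcurry b m.
Proof. by move=> ab m; apply: cohom_ext => x; rewrite !tcurryE -ab tmapE. Qed.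

Lemma tuncurryK (M : lmodType H) (W : lmodType k) (a : {linear M -> cohom W}) m :
  tcurry (tuncurry a) m = a m.
Proof. by apply: cohom_ext => x; rewrite tcurryE tuncurryE. Qed.

Lemma cohom_extend (M N : lmodType H) (W : lmodType k) (f : {linear M -> N})
    (a : {linear M -> cohom W}) : injective (tmap f) ->
  exists b : {linear N -> cohom W}, forall m, b (f m) = a m.
Proof.
move=> fI; have [|e eE] := @linear_extension _ _ _ _ (tmap f) (tuncurry a).
  by move=> u; rewrite -(linear0 (tmap f)) => /fI ->; rewrite linear0.
by exists (tcurry e) => m; rewrite (tcurry_comp eE) tuncurryK.
Qed.

End TensorFunctor.

(** * Coinduced disks and the first factorization *)

Section TensorComplexes.
Variables (k : fieldType) (G : topGroupType) (V : smooth_rep k G).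
Local Notation H := (rep_end_op V).
Local Notation cx := (complex (LMod H)).
Local Notation ChH := (Ch (LMod H)).

Definition tel (X : cx) n : lmodType k := tmod (el X n).
Definition td (X : cx) n : {linear tel X n -> tel X (n - 1)} := tmap (dl X n).
Definition tm (X Y : cx) (f : chain_map X Y) n : {linear tel X n -> tel Y n} :=
  tmap (ml f n).

Lemma tdK (X : cx) n t : td X (n - 1) (td X n t) = 0.
Proof.
rewrite -(tmap_comp (h := \0)) ?tmap0 // => x.
by rewrite dlK.
Qed.

Lemma tm_diff (X Y : cx) (f : chain_map X Y) n t :
  td Y n (tm f n t) = tm f (n - 1) (td X n t).
Proof.
rewrite -(tmap_comp (h := dl Y n \o ml f n)) // -(tmap_comp (h := dl Y n \o ml f n)) //.
by move=> x; exact: ml_diff.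
Qed.

Lemma tm_comp (X Y Z : cx) (f : chain_map X Y) (g : chain_map Y Z) n t :
  tm (chain_comp g f) n t = tm g n (tm f n t).
Proof. exact: tmap_comp. Qed.

Lemma tm_id (X : cx) n t : tm (chain_id X) n t = t.
Proof. exact: tmap_id. Qed.

Definition tinj (X Y : cx) (f : chain_map X Y) : Prop := forall n, injective (tm f n).

(** Bijectivity on homology in degree n - 1 stated on elements, without quotients, as the two halves
    are used separately; [tqisoP] makes the link with [quasi_iso]. *)
Definition tqiso (X Y : cx) (f : chain_map X Y) : Prop := forall n,
  (forall z y, td X (n - 1) z = 0 -> tm f (n - 1) z = td Y n y ->
     exists x, z = td X n x) /\
  (forall z, td Y (n - 1) z = 0 -> exists x y,
     td X (n - 1) x = 0 /\ z = tm f (n - 1) x + td Y n y).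

Lemma tinj_eq0 (X Y : cx) (f : chain_map X Y) n (t : tel X n) :
  tinj f -> tm f n t = 0 -> t = 0.
Proof. by move=> fI t0; apply: fI; rewrite linear0. Qed.

Section CoinducedDisks.
Variable W : int -> lmodType k.

Definition disk_diff n (p : cohom V (W n) * cohom V (W (n - 1))) :
  cohom V (W (n - 1)) * cohom V (W (n - 1 - 1)) := (p.2, 0).

Lemma disk_diff_linear n : linear (@disk_diff n).
Proof. by move=> c p q; congr (_, _); rewrite /= scaler0 addr0. Qed.

Lemma disk_diffK n x :
  mklin (@disk_diff_linear (n - 1)) (mklin (@disk_diff_linear n) x) = 0.
Proof. by []. Qed.

Definition disk : cx :=
  @mkcx H (fun n => (cohom V (W n) * cohom V (W (n - 1)))%type)
    (fun n => mklin (@disk_diff_linear n)) disk_diffK.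

Definition disk_map_fun (A : cx) (a : forall n, {linear el A n -> cohom V (W n)})
  n (x : el A n) : el disk n := (a n x, a (n - 1) (dl A n x)).

Lemma disk_map_linear (A : cx) (a : forall n, {linear el A n -> cohom V (W n)}) n :
  linear (@disk_map_fun A a n).
Proof. by move=> c x y; congr (_, _); rewrite /= !linearP. Qed.

Definition disk_map (A : cx) (a : forall n, {linear el A n -> cohom V (W n)}) :
  chain_map A disk.
Proof.
apply: (@mkmap_fun H A disk _ (disk_map_linear a)) => n x.
by congr (_, _); rewrite /= dlK linear0.
Defined.

Definition disk_fst (A : cx) (u : chain_map A disk) n :
  {linear el A n -> cohom V (W n)} :=
  (fst : {linear (cohom V (W n) * cohom V (W (n - 1)))%type -> cohom V (W n)}) \o ml u n.

(** Compatibility with d (a, b) = (b, 0) forces the second component to be the first one after the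
    differential. Chain maps into [disk] therefore amount to arbitrary families of linear maps in
    each degree. *)
Lemma disk_mapP (A : cx) (u v : chain_map A disk) :
  (forall n x, disk_fst u n x = disk_fst v n x) -> u = v.
Proof.
move=> uv; apply: ml_ext => n x.
have sndE (w : chain_map A disk) : (ml w n x).2 = disk_fst w (n - 1) (dl A n x).
  by rewrite /disk_fst /= -[RHS]/((ml w (n - 1) (dl A n x)).1) -ml_diff.
rewrite (surjective_pairing (ml u n x)) (surjective_pairing (ml v n x)).
by rewrite !sndE uv; congr (_, _); exact: uv.
Qed.

Lemma disk_extend (A B : cx) (i : chain_map A B) (u : chain_map A disk) : tinj i ->
  exists v : chain_map B disk, chain_comp v i = u.
Proof.
move=> iI.
have ext n : exists b : {linear el B n -> cohom V (W n)},
    forall x, b (ml i n x) = disk_fst u n x.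
  exact: (cohom_extend (f := ml i n) (disk_fst u n) (@iI n)).
have [b bE] := dependent_choice ext.
exists (disk_map b); apply: disk_mapP => n x; exact: bE.
Qed.

(* h(y, (a, b)) = (0, (0, a)) contracts the kernel of the projection. *)
Lemma prod_disk_tqiso (N : cx) : tqiso (prod_fst N disk).
Proof.
pose E := prodcx N disk.
pose p := prod_fst N disk.
have sl n : linear (fun y : el N n => (y, 0) : el E n).
  by move=> c x y; congr (_, _); rewrite /= scaler0 addr0.
pose s : chain_map N E := @mkmap_fun H N E _ sl (fun n y => erefl).
have hl n : linear (fun z : el E (n - 1) => (0, (0, z.2.1)) : el E n).
  by move=> c x y; congr (_, (_, _)); rewrite /= scaler0 addr0.
(* The identity id = s p + (d h + h d) holds in [E], and the additive functor T preserves it. *)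
have hP n (z : tel E (n - 1)) : z = tm s (n - 1) (tm p (n - 1) z) +
    (td E n (tmap (mklin (hl n)) z) + tmap (mklin (hl (n - 1))) (td E (n - 1) z)).
  pose h1 := dl E n \o mklin (hl n).
  pose h2 := mklin (hl (n - 1)) \o dl E (n - 1).
  pose h0 := ml s (n - 1) \o ml p (n - 1).
  rewrite -(@tmap_comp _ _ _ _ _ _ _ _ h0) //.
  rewrite -(@tmap_comp _ _ _ _ _ _ _ _ h1) // -(@tmap_comp _ _ _ _ _ _ _ _ h2) //.
  rewrite -(@tmapD _ _ _ _ _ _ _ (h1 \+ h2)) //.
  rewrite -(@tmapD _ _ _ _ _ _ _ idfun) ?tmap_id // => -[x [a b]].
  congr (_, (_, _)).
  - by rewrite /= linear0 !addr0.
  - by rewrite /= add0r addr0.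
  - by rewrite /= !add0r.
have psE n (t : tel N n) : tm p n (tm s n t) = t.
  by rewrite -tm_comp -[RHS]tm_id; exact: tmap_ext.
move=> n; split=> [z y dz pz|z dz].
  exists (tm s n y + tmap (mklin (hl n)) z).
  by rewrite linearD tm_diff -pz {1}[z]hP dz linear0 addr0.
exists (tm s (n - 1) z), 0; rewrite tm_diff dz !linear0 addr0; split=> //.
by rewrite psE.
Qed.

End CoinducedDisks.

Lemma prod_disk_lift (W : int -> lmodType k) (A B N : cx) (i : chain_map A B)
    (u : chain_map A (prodcx N (disk W))) (v : chain_map B N) : tinj i ->
  chain_comp (prod_fst N (disk W)) u = chain_comp v i ->
  exists h : chain_map B (prodcx N (disk W)),
    chain_comp h i = u /\ chain_comp (prod_fst N (disk W)) h = v.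
Proof.
move=> iI sq; have [b bE] := disk_extend (chain_comp (prod_snd N (disk W)) u) iI.
exists (prod_pair v b); split; last exact: ml_ext.
apply: ml_ext => n x; rewrite -[LHS]/(ml v n (ml i n x), ml b n (ml i n x)).
rewrite -[X in (X, _)]/(ml (chain_comp v i) n x) -(ml_eq x sq).
rewrite -[X in (_, X)]/(ml (chain_comp b i) n x) (ml_eq x bE).
exact: esym (surjective_pairing _).
Qed.

Section DiskFactorization.
Variables (M N : cx) (f : chain_map M N).

Definition disk_unit n : {linear el M n -> cohom V (tel M n)} := tcurry idfun.

Definition disk_left : chain_map M (prodcx N (disk (tel M))) :=
  prod_pair f (disk_map disk_unit).

(** One component is the unit M_n -> Hom_k(X, T M_n) of the adjunction, and by a triangle identity
    the counit splits T of the unit. *)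
Lemma disk_left_tinj : tinj disk_left.
Proof.
move=> n; pose E := el (prodcx N (disk (tel M))) n.
pose a : {linear E -> cohom V (tel M n)} :=
  (fst : {linear (cohom V (tel M n) * cohom V (tel M (n - 1)))%type -> _}) \o
  (snd : {linear E -> (cohom V (tel M n) * cohom V (tel M (n - 1)))%type}).
have aE t : tuncurry a (tm disk_left n t) = t.
  rewrite (tuncurry_comp (b := disk_unit n)) //.
  elim/tsum_ind: t => [|x m t IHt]; first by rewrite linear0.
  by rewrite linearD IHt tuncurryE.
by move=> t t' tt'; rewrite -[t]aE tt' aE.
Qed.

End DiskFactorization.

Section DiskMid.
Variables (M N M' N' : cx) (u : chain_map M M') (v : chain_map N N').

Lemma cohom_map_linear n : linear (fun a : cohom V (tel M n) =>
  (tm u n \o coval a : {linear V -> tel M' n}) : cohom V (tel M' n)).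
Proof. by move=> h a b; apply: cohom_ext => x; rewrite /= linearD. Qed.

Definition cohom_map n : {linear cohom V (tel M n) -> cohom V (tel M' n)} :=
  mklin (@cohom_map_linear n).

Definition disk_mid_fun n (z : el (prodcx N (disk (tel M))) n) :
    el (prodcx N' (disk (tel M'))) n :=
  (ml v n z.1, (cohom_map n z.2.1, cohom_map (n - 1) z.2.2)).

Lemma disk_mid_linear n : linear (@disk_mid_fun n).
Proof. by move=> c x y; congr (_, (_, _)); exact: linearP. Qed.

Definition disk_mid : chain_map (prodcx N (disk (tel M))) (prodcx N' (disk (tel M'))).
Proof.
apply: (mkmap_fun disk_mid_linear) => n z.
by congr (_, (_, _)); [exact: ml_diff|exact: esym (linear0 _)].
Defined.

End DiskMid.

Definition disk_factorization : functorial_factorization ChH.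
Proof.
apply: (@FunctorialFactorization ChH (fun M N f => prodcx N (disk (tel M)))
  (fun M N f => disk_left f) (fun M N f => prod_fst N (disk (tel M)))
  (fun M N M' N' f f' u v sq => disk_mid u v)).
- by move=> M N f; exact: ml_ext.
- move=> M N M' N' f f' u v sq; apply: ml_ext => n x.
  congr (_, (_, _)); first exact: esym (ml_eq x sq).
    by apply: cohom_ext => y; rewrite /= tmapE.
  apply: cohom_ext => y; rewrite /= tmapE /=; congr (tsum [:: (_, _)]).
  exact: esym (ml_diff u x).
- by move=> M N M' N' f f' u v sq; exact: ml_ext.
- move=> M N f sq; apply: ml_ext => n [y [a b]]; congr (_, (_, _)).
    by apply: cohom_ext => x; exact: tm_id.
  by apply: cohom_ext => x; exact: tm_id.
- move=> M N M' N' M'' N'' f f' f'' u v u' v' sq sq' sq''.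
  apply: ml_ext => n [y [a b]]; congr (_, (_, _)).
    by apply: cohom_ext => x; exact: tm_comp.
  by apply: cohom_ext => x; exact: tm_comp.
Defined.

End TensorComplexes.

(** * Trivial cofibrations *)

Section Supported.
Variables (I : eqType) (T : I -> Type) (z : forall n, T n) (m : I) (x : T m).

Definition supported (n : I) : T n :=
  if m =P n is ReflectT e then ecast n (T n) e x else z n.

Lemma supported_eq : supported m = x.
Proof. by rewrite /supported; case: eqP => // e; rewrite (eq_irrelevance e erefl). Qed.

Lemma supported_neq n : m <> n -> supported n = z n.
Proof. by rewrite /supported; case: eqP. Qed.

End Supported.

Lemma pred_int_inj (m n : int) : m - 1 = n - 1 -> m = n.
Proof. exact: addIr. Qed.

Section TrivialCofibrations.
Variables (k : fieldType) (G : topGroupType) (V : smooth_rep k G).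
Local Notation H := (rep_end_op V).
Local Notation cx := (complex (LMod H)).
Local Notation ChH := (Ch (LMod H)).

Definition tcof (X Y : cx) (f : chain_map X Y) : Prop := tinj f /\ tqiso f.

Section Extension.
Variables (A B : cx) (i : chain_map A B) (W : lmodType k).
Variables (phi : forall n, {linear tel B n -> W}) (psi : forall n, {linear tel A n -> W}).
Hypotheses (phid : forall n y, phi (n - 1) (td B n y) = 0)
  (psid : forall n x, psi (n - 1) (td A n x) = phi n (tm i n x)).

(* psi' is defined on i (T A) + d (T B) by i a + d b |-> psi a + phi b. *)
Lemma functional_extend : tcof i ->
  exists psi' : forall n, {linear tel B n -> W},
    (forall n x, psi' n (tm i n x) = psi n x) /\
    (forall n y, psi' (n - 1) (td B n y) = phi n y).
Proof.
move=> [iI iQ].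
have cyc m z : td B m z = 0 -> exists x, td A m x = 0 /\ phi m z = phi m (tm i m x).
  move: z; suff : forall n z, td B (n - 1) z = 0 ->
      exists x, td A (n - 1) x = 0 /\ phi (n - 1) z = phi (n - 1) (tm i (n - 1) x).
    by move/(_ (m + 1)); rewrite addrK.
  move=> n z /(iQ n).2 [x [y [dx ->]]]; exists x; split=> //.
  by rewrite linearD phid addr0.
(* The degrees are extended independently of each other. The differential into degree [m] starts
   from any n with n - 1 = m, hence the transport. *)
have ext m : exists e : {linear tel B m -> W}, (forall x, e (tm i m x) = psi m x) /\
    forall n (E : n - 1 = m) y, e (ecast m (tel B m) E (td B n y)) = phi n y.
  suff ext1 n : exists e : {linear tel B (n - 1) -> W},
    (forall x, e (tm i (n - 1) x) = psi (n - 1) x) /\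
    forall n' (E : n' - 1 = n - 1) y, e (ecast m (tel B m) E (td B n' y)) = phi n' y.
    by have := ext1 (m + 1); rewrite addrK.
  have fl : linear (fun p : tel A (n - 1) * tel B n => tm i (n - 1) p.1 + td B n p.2).
    by move=> c p q; rewrite !linearP /= scalerDr addrACA.
  have gl : linear (fun p : tel A (n - 1) * tel B n => psi (n - 1) p.1 + phi n p.2).
    by move=> c p q; rewrite !linearP /= scalerDr addrACA.
  (* Well-definedness. If i a + d b = 0, then a is a cycle whose image bounds, so a = d a'. The
     cycle i a' + b has the same value under phi as i x for some cycle x, and phi (i x) = psi (d x)
     = 0. Since phi (i a') = psi a, the sum psi a + phi b vanishes. *)
  have [[a b] /= ab|e eE] := @linear_extension _ _ _ _ (mklin fl) (mklin gl).
    have ia : tm i (n - 1) a = td B n (- b).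
      by apply/eqP; rewrite linearN -addr_eq0 ab.
    have da : td A (n - 1) a = 0.
      by apply: (tinj_eq0 iI); rewrite -tm_diff ia tdK.
    have [a' aE] := (iQ n).1 _ _ da ia.
    have [|x [dx]] := cyc n (tm i n a' + b).
      by rewrite linearD tm_diff -aE.
    rewrite linearD -!psid dx linear0 -aE => e0.
    by rewrite e0.
  exists e; split=> [x|n' E y].
    by have /= := eE (x, 0); rewrite !linear0 !addr0.
  have nn := pred_int_inj E; subst n'; rewrite (eq_irrelevance E erefl) /=.
  by have /= := eE (0, y); rewrite !linear0 !add0r.
have [e eE] := dependent_choice ext.
exists e; split=> [n|n y]; first exact: (eE n).1.
exact: (eE (n - 1)).2 n erefl y.
Qed.

End Extension.

(** Each failure is caught by a functional e concentrated in one degree. For a cycle z that bounds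
    only in T B, take psi = e with e d = 0 and e z = 1, and phi = 0. For a cycle z outside i (T A) +
    d (T B), take phi = e vanishing on that sum with e z = 1, and psi = 0; then psi' (d z) would be
    both 0 and 1. *)
Lemma linear_functional_tqiso (A B : cx) (i : chain_map A B) : tinj i ->
  (forall (phi : forall n, {linear tel B n -> k^o})
     (psi : forall n, {linear tel A n -> k^o}),
     (forall n y, phi (n - 1) (td B n y) = 0) ->
     (forall n x, psi (n - 1) (td A n x) = phi n (tm i n x)) ->
   exists psi' : forall n, {linear tel B n -> k^o},
     (forall n x, psi' n (tm i n x) = psi n x) /\
     (forall n y, psi' (n - 1) (td B n y) = phi n y)) -> tqiso i.
Proof.
move=> iI ext n; split=> [z y dz iz|z dz].
  apply: contrapT => nz; have [e [ed ez]] := linear_separation nz.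
  pose psi : forall m, {linear tel A m -> k^o} :=
    supported (fun m => \0 : {linear tel A m -> k^o}) e.
  have [m y'|m x|psi' [psi'i psi'd]] := ext (fun m => \0) psi => //.
    rewrite /psi; have [E|nE] := pselect (n - 1 = m - 1).
      have nm := pred_int_inj E; subst m; rewrite supported_eq; exact: ed.
    by rewrite supported_neq.
  have := psi'i (n - 1) z; rewrite iz psi'd /psi supported_eq ez => /esym/eqP.
  by rewrite oner_eq0.
have fl : linear (fun p : tel A (n - 1) * tel B n => tm i (n - 1) p.1 + td B n p.2).
  by move=> c p q; rewrite !linearP /= scalerDr addrACA.
have [[[x y] /= zE]|nz] := pselect (exists p, z = mklin fl p).
  exists x, y; split=> //; apply: (tinj_eq0 iI).
  by move: dz; rewrite zE linearD tdK addr0 -tm_diff.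
have [e [ef ez]] := linear_separation nz.
pose phi : forall m, {linear tel B m -> k^o} :=
  supported (fun m => \0 : {linear tel B m -> k^o}) e.
have [m y|m x|psi' [_ psi'd]] := ext phi (fun m => \0).
- rewrite /phi; have [E|nE] := pselect (n - 1 = m - 1).
    have nm := pred_int_inj E; subst m; rewrite supported_eq.
    by have /= := ef (0, y); rewrite linear0 add0r.
  by rewrite supported_neq.
- rewrite /phi /=; have [E|nE] := pselect (n - 1 = m).
    subst m; rewrite supported_eq.
    by have /= := ef (x, 0); rewrite linear0 addr0.
  by rewrite supported_neq.
have := psi'd (n - 1) z; rewrite dz linear0 /phi supported_eq ez => /esym/eqP.
by rewrite oner_eq0.
Qed.

Section TestFibration.
Local Notation W := (fun _ : int => k^o : lmodType k).

Lemma null_linear : linear (fun _ : cohom V k^o => 0 : cohom V k^o).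
Proof. by move=> c x y; rewrite scaler0 addr0. Qed.

Definition const_cx : cx :=
  @mkcx H (fun _ => cohom V k^o) (fun _ => mklin null_linear) (fun _ _ => erefl).

(** By adjunction a map to [const_cx] is a cocycle phi, a map to the disk is a cochain psi, and a
    square says that phi restricts to the coboundary of psi. The lifts are the extensions psi' of
    [linear_functional_tqiso]. *)
Definition test_fib : chain_map (disk V W) const_cx.
Proof.
by apply: (@mkmap H (disk V W) const_cx
  (fun n => (snd : {linear (cohom V k^o * cohom V k^o)%type -> cohom V k^o}))).
Defined.

Lemma disk_snd (A : cx) (u : chain_map A (disk V W)) n x :
  (ml u n x).2 = disk_fst u (n - 1) (dl A n x).
Proof. by rewrite /disk_fst /= -[RHS]/((ml u (n - 1) (dl A n x)).1) -ml_diff. Qed.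

Lemma test_fib_lifts (A B : cx) (i : chain_map A B) : tcof i ->
  lifts (C := ChH) i test_fib.
Proof.
move=> iT u v sq.
pose phi n := tuncurry (ml v n : {linear el B n -> cohom V k^o}).
pose psi n := tuncurry (disk_fst u n).
have phid n y : phi (n - 1) (td B n y) = 0.
  rewrite /phi (tuncurry_comp (b := \0)) => [|m]; last exact: esym (ml_diff v m).
  by elim/tsum_ind: y => [|x m t IHt]; rewrite ?linear0 // linearD IHt tuncurryE addr0.
have psid n x : psi (n - 1) (td A n x) = phi n (tm i n x).
  rewrite /phi /psi (tuncurry_comp (b := ml v n \o ml i n)) => [|m].
    exact: esym (tuncurry_comp _ _).
  by rewrite -disk_snd; exact: (ml_eq m sq).
have [psi' [psi'i psi'd]] := functional_extend phid psid iT.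
exists (disk_map (fun n => tcurry (psi' n))); split.
  apply: disk_mapP => n x.
  by rewrite -[LHS]/(tcurry (psi' n) (ml i n x)) (tcurry_comp (psi'i n)) tuncurryK.
apply: ml_ext => n y.
rewrite -[LHS]/(tcurry (psi' (n - 1)) (dl B n y)) (tcurry_comp (psi'd n)).
exact: tuncurryK.
Qed.

(** A lift in the square formed by [disk_left i] and the identity of [B] factors [disk_left i]
    through [i], so T i is injective. Lifts against [test_fib] then extend functionals, which gives
    the quasi-isomorphism. *)
Lemma llp_tcof (A B : cx) (i : chain_map A B) :
  lifts (C := ChH) i (prod_fst B (disk V (tel A))) ->
  lifts (C := ChH) i test_fib -> tcof i.
Proof.
move=> il it.
have iI : tinj i.
  have [|h [hi _]] := il (disk_left i) (chain_id B); first exact: ml_ext.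
  move=> n t t' tt'; apply: (@disk_left_tinj _ _ _ _ _ i n).
  by rewrite -hi -[LHS]/(tm (chain_comp h i) n t) -[RHS]/(tm (chain_comp h i) n t')
    !tm_comp tt'.
split=> //; apply: linear_functional_tqiso => // phi psi phid psid.
have vd n y : dl const_cx n (tcurry (phi n) y) = tcurry (phi (n - 1)) (dl B n y).
  apply: cohom_ext => x; rewrite tcurryE; have := phid n (tsum [:: (x, y)]).
  by rewrite /td tmapE => ->.
pose v : chain_map B const_cx := @mkmap H B const_cx (fun n => tcurry (phi n)) vd.
have [|h [hi hv]] := it (disk_map (fun n => tcurry (psi n))) v.
  apply: ml_ext => n x; apply: cohom_ext => y.
  rewrite -[LHS](_ : psi (n - 1) (td A n (tsum [:: (y, x)])) = _); last first.
    by rewrite /td tmapE.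
  by rewrite psid /tm tmapE.
exists (fun n => tuncurry (disk_fst h n)); split=> [n t|n t].
  rewrite (tuncurry_comp (b := tcurry (psi n))).
    elim/tsum_ind: t => [|x m t IHt]; first by rewrite !linear0.
    by rewrite !linearD IHt tuncurryE.
  by move=> m; exact: (congr1 fst (ml_eq m hi)).
rewrite (tuncurry_comp (b := tcurry (phi n))).
  elim/tsum_ind: t => [|x m t IHt]; first by rewrite !linear0.
  by rewrite !linearD IHt tuncurryE.
by move=> m; rewrite -disk_snd; exact: (ml_eq m hv).
Qed.

End TestFibration.
End TrivialCofibrations.

(** * Small trivial cofibrations *)

(* Names for the elements of a substructure closed under Skolem functions with
   parameters in P, so that its size is bounded independently of the ambient
   structure; the number selects one of the values required by a demand. *)
Inductive name (P : Type) := Name of P & nat & seq (name P).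

Lemma skolem_closure (P U : Type) (u0 : U) (Req : P -> seq U -> seq U -> Prop) :
  (forall p us, exists vs, Req p us vs) ->
  exists ev : name P -> U, forall p ws, exists ws', Req p (map ev ws) (map ev ws').
Proof.
move=> ex; have [F FP] := choice (fun pu => ex pu.1 pu.2).
(* [Name p j ws] evaluates to the j-th value chosen for the demand [p] at the values of [ws]; [u0]
   is only the default beyond the end of that list. *)
pose ev := fix ev (w : name P) : U :=
  let: Name p j ws := w in nth u0 (F (p, map ev ws)) j.
exists ev => p ws; exists [seq Name p j ws | j <- iota 0 (size (F (p, map ev ws)))].
have -> : [seq ev w | w <- [seq Name p j ws | j <- iota 0 (size (F (p, map ev ws)))]] =
    F (p, map ev ws) by rewrite -map_comp; exact: mkseq_nth.
exact: (FP (p, map ev ws)).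
Qed.

Lemma mem_mapE (T : Type) (E : eqType) (f : T -> E) (s : seq T) (y : E) :
  y \in map f s -> exists x, y = f x.
Proof.
by elim: s => // x s IHs; rewrite inE => /orP [/eqP ->|/IHs //]; exists x.
Qed.

Section SmallSubcomplexes.
Variables (k : fieldType) (G : topGroupType) (V : smooth_rep k G).
Local Notation H := (rep_end_op V).
Local Notation cx := (complex (LMod H)).
Local Notation ChH := (Ch (LMod H)).

(* The closure conditions of a pair of subcomplexes A' of A and B' of B: beyond
   being subcomplexes preserved by A -> B, they ask that B' meet the image of A
   in that of A' (DPre), that T A' -> T A and T B' -> T B be injective (DEq), that
   T A' -> T B' be a quasi-isomorphism (DBd, DHom), and that T B' meet the image
   of T A in that of T A' (DInt). *)
Inductive demand :=
| DGen
| DLin of H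
| DDiff of bool & int
| DImg of int
| DPre of int
| DEq of bool & int & seq V
| DBd of bool & int & seq V
| DHom of int & seq V
| DInt of int & seq V.

Section Closure.
Variables (C : bool -> cx) (i : chain_map (C true) (C false)).

(* The pair A -> B is C true -> C false.  A name denotes an element of every
   component at once, which avoids transports between degrees. *)
Definition efamily := forall p : bool * int, el (C p.1) p.2.

Definition fval b n (u : efamily) : el (C b) n := u (b, n).

Definition expr b n (xs : seq V) (us : seq efamily) : tel (C b) n :=
  tsum (zip xs (map (fval b n) us)).

Lemma exprP b n (t : tel (C b) n) : exists xs us, t = expr b n xs us.
Proof.
have [s ->] := tsumP t.
exists (unzip1 s), [seq supported (fun p => 0 : el (C p.1) p.2) (m := (b, n)) x | x <- unzip2 s].
rewrite /expr -map_comp -[s in LHS]zip_unzip; congr (tsum (zip _ _)).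
rewrite -[LHS]map_id; apply: eq_map => x /=; exact: esym (supported_eq _ _).
Qed.

Variable u0 : efamily.

(** Every clause but [DGen] is conditional, so a demand with arguments of the wrong shape or a false
    premise is met trivially. In [DEq] the list [vs] carries the module elements of a derivation of
    the relation. [DHom] leaves the bounding chain t' in the ambient complex; [DBd] brings a
    bounding chain into the subcomplex afterwards. *)
Definition meets (D : demand) (us vs : seq efamily) : Prop :=
  match D with
  | DGen => vs = [:: u0]
  | DLin c => forall u u', us = [:: u; u'] -> exists v, vs = [:: v] /\
      forall b n, v (b, n) = c *: (u (b, n) : el (C b) n) + u' (b, n)
  | DDiff b n => forall u, us = [:: u] -> exists v, vs = [:: v] /\
      v (b, n - 1) = dl (C b) n (u (b, n))
  | DImg n => forall u, us = [:: u] -> exists v, vs = [:: v] /\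
      v (false, n) = ml i n (u (true, n))
  | DPre n => forall u, us = [:: u] -> forall a, ml i n a = u (false, n) ->
      exists v, vs = [:: v] /\ ml i n (v (true, n)) = u (false, n)
  | DEq b n xs => expr b n xs us = 0 -> forall (M : lmodType H)
      (j : {linear M -> el (C b) n}), injective j ->
      (forall m, m \in map (fval b n) vs -> exists m', j m' = m) ->
      forall s, [seq (u.1, j u.2) | u <- s] =
        zip xs (map (fval b n) us) -> tsum s = 0
  | DBd b n xs => (exists t, td (C b) n t = expr b (n - 1) xs us) ->
      exists ys, td (C b) n (expr b n ys vs) = expr b (n - 1) xs us
  | DHom n xs =>
      (exists t t', expr false (n - 1) xs us = tm i (n - 1) t + td (C false) n t') ->
      exists ys t', expr false (n - 1) xs us =
        tm i (n - 1) (expr true (n - 1) ys vs) + td (C false) n t'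
  | DInt n xs => (exists t, tm i n t = expr false n xs us) ->
      exists ys, tm i n (expr true n ys vs) = expr false n xs us
  end.

Lemma meetable D us : exists vs, meets D us vs.
Proof.
case: D => [|c|b n|n|n|b n xs|b n xs|n xs|n xs] /=.
- by exists [:: u0].
- case: us => [|u [|u' us]]; try by exists [::].
  by exists [:: fun p => c *: u p + u' p] => v v' [<- <-]; eexists.
- case: us => [|u us]; first by exists [::].
  exists [:: supported (fun p => 0 : el (C p.1) p.2) (m := (b, n - 1)) (dl (C b) n (u (b, n)))].
  by move=> v [<- _]; eexists; split=> //; rewrite supported_eq.
- case: us => [|u us]; first by exists [::].
  exists [:: supported (fun p => 0 : el (C p.1) p.2) (m := (false, n)) (ml i n (u (true, n)))].
  by move=> v [<- _]; eexists; split=> //; rewrite supported_eq.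
- case: us => [|u us]; first by exists [::].
  have [[a ia]|na] := pselect (exists a, ml i n a = u (false, n)).
    exists [:: supported (fun p => 0 : el (C p.1) p.2) (m := (true, n)) a].
    by move=> v [<- _] a' _; eexists; split=> //; rewrite supported_eq.
  by exists [::] => v [<- _] a ia; case: na; exists a.
- have [/tsum_finite[l lP]|nz] := pselect (expr b n xs us = 0); last by exists [::] => /nz.
  exists [seq supported (fun p => 0 : el (C p.1) p.2) (m := (b, n)) x | x <- l].
  move=> _ M j jI jl; apply: lP => // m ml; apply: jl.
  rewrite -map_comp -[m](supported_eq (fun p => 0 : el (C p.1) p.2) (m := (b, n))).
  exact: (map_f (fun x => supported _ x (b, n)) ml).
- have [[t tE]|nt] := pselect (exists t, td (C b) n t = expr b (n - 1) xs us).
    by have [ys [vs tys]] := exprP t; exists vs => _; exists ys; rewrite -tys.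
  by exists [::] => /nt.
- have [[t [t' tE]]|nt] := pselect (exists t t',
      expr false (n - 1) xs us = tm i (n - 1) t + td (C false) n t').
    by have [ys [vs tys]] := exprP t; exists vs => _; exists ys, t'; rewrite -tys.
  by exists [::] => /nt.
- have [[t tE]|nt] := pselect (exists t, tm i n t = expr false n xs us).
    by have [ys [vs tys]] := exprP t; exists vs => _; exists ys; rewrite -tys.
  by exists [::] => /nt.
Qed.

End Closure.

(** Smallness means that in each degree both complexes are images of the one fixed type of names. *)
Record named := Named {
  nm_cx :> bool -> cx;
  nm_map : chain_map (nm_cx true) (nm_cx false);
  nm_val : forall b n, name demand -> el (nm_cx b) n;
  nm_surj : forall b n x, exists w, nm_val b n w = x;
  nm_tcof : tcof nm_map }.

Lemma tinj_ker (X Y : cx) (f : chain_map X Y) :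
  (forall n t, tm f n t = 0 -> t = 0) -> tinj f.
Proof.
move=> f0 n t t' tt'; apply/eqP; rewrite -subr_eq0; apply/eqP/f0.
by rewrite linearB tt' subrr.
Qed.

Section SmallSub.
Variables (C : bool -> cx) (i : chain_map (C true) (C false)) (u0 : efamily C).
Hypothesis iT : tcof i.

(** The values of all names form the subpair. Its last two properties say that B' meets the image of
    A only in that of A', before and after T. They keep an enlarged partial lift single-valued and
    its domain well behaved under T. *)
Lemma small_sub : exists (N : named) (inc : forall b, chain_map (N b) (C b)),
  [/\ chain_comp i (inc true) = chain_comp (inc false) (nm_map N),
      (forall b, tinj (inc b)) /\ (forall b n, injective (ml (inc b) n)),
      forall b n, exists x, ml (inc b) n x = u0 (b, n),
      forall n y a, ml (inc false) n y = ml i n a -> exists x, y = ml (nm_map N) n x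
    & forall n y a, tm (inc false) n y = tm i n a -> exists x, y = tm (nm_map N) n x].
Proof.
have [ev evP] := skolem_closure u0 (meetable i u0).
have [w0 ev0] : exists w, ev w = u0.
  by have [[|w []] //= [e]] := evP DGen [::]; exists w.
have evlin c w w' : exists w'', forall b n,
    ev w'' (b, n) = c *: (ev w (b, n) : el (C b) n) + ev w' (b, n).
  have [ws' /= /(_ _ _ erefl) [v [vE vP]]] := evP (DLin c) [:: w; w'].
  case: ws' vE => [|w'' []] //= [e]; exists w'' => b n; rewrite e; exact: vP.
pose S0 b n (x : el (C b) n) := exists w, ev w (b, n) = x.
have S00 b n : S0 b n 0.
  by have [w wE] := evlin (-1) w0 w0; exists w; rewrite wE scaleN1r addNr.
have S0P b n c x y : S0 b n x -> S0 b n y -> S0 b n (c *: x + y).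
  by move=> [w <-] [w' <-]; have [w'' w''E] := evlin c w w'; exists w''.
pose S b n : submodule (el (C b) n) := Submodule (@S00 b n) (@S0P b n).
have Sd b n x : S b n x -> S b (n - 1) (dl (C b) n x).
  move=> [w <-]; have [ws' /= /(_ _ erefl) [v [vE vP]]] := evP (DDiff b n) [:: w].
  by case: ws' vE => [|w' []] //= [e]; exists w'; rewrite e.
pose C' b := subcx (Sd b).
pose inc b : chain_map (C' b) (C b) := subcx_incl (Sd b).
have iS n z : S false n (ml (chain_comp i (inc true)) n z).
  have [w wE] := subcx_inclS z; rewrite -[ml _ _ _]/(ml i n (ml (inc true) n z)) -wE.
  have [ws' /= /(_ _ erefl) [v [vE vP]]] := evP (DImg n) [:: w].
  by case: ws' vE => [|w' []] //= [e]; exists w'; rewrite e.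
have [i' i'E] := @subcx_lift _ _ _ (Sd false) _ _ iS.
pose val b n w : el (C' b) n := sm_mk (ex_intro _ w erefl : S b n (ev w (b, n))).
have incval b n w : ml (inc b) n (val b n w) = ev w (b, n) by [].
have incI b n : injective (ml (inc b) n) by exact: subcx_incl_inj.
have valS b n x : exists w, val b n w = x.
  by have [w wE] := subcx_inclS x; exists w; apply: incI.
have seqS b n (ys : seq (el (C' b) n)) : exists ws, ys = map (val b n) ws.
  elim: ys => [|y ys [ws ->]]; first by exists [::].
  by have [w <-] := valS _ _ y; exists (w :: ws).
pose nexpr b n xs ws : tel (C' b) n := tsum (zip xs (map (val b n) ws)).
have nexprP b n t : exists xs ws, t = nexpr b n xs ws.
  have [s ->] := tsumP t; have [ws wsE] := seqS _ _ (unzip2 s).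
  by exists (unzip1 s), ws; rewrite /nexpr -wsE zip_unzip.
have map_zip b n xs ws : [seq (u.1, ml (inc b) n u.2) | u <- zip xs (map (val b n) ws)] =
    zip xs (map (@fval C b n) (map ev ws)).
  by elim: xs ws => [|x xs IHx] [|w ws] //=; rewrite IHx.
have incE b n xs ws : tm (inc b) n (nexpr b n xs ws) = expr b n xs (map ev ws).
  by rewrite /tm tmapE map_zip.
have incT b : tinj (inc b).
  apply: tinj_ker => n t; have [xs [ws ->]] := nexprP _ _ t; rewrite incE => e0.
  have [ws' /= /(_ e0 _ (ml (inc b) n) (@incI b n))] := evP (DEq b n xs) ws.
  apply; last exact: map_zip.
  by move=> m; rewrite -map_comp => /mem_mapE [w ->]; exists (val b n w).
have sqT n t : tm (inc false) n (tm i' n t) = tm i n (tm (inc true) n t).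
  by rewrite -!tm_comp i'E.
have [iI iQ] := iT.
have i'I : tinj i'.
  apply: tinj_ker => n t t0; apply: (tinj_eq0 (@incT true)); apply: (tinj_eq0 iI).
  by rewrite -sqT t0 linear0.
have bd b n z t : td (C b) n t = tm (inc b) (n - 1) z -> exists x, z = td (C' b) n x.
  have [xs [ws ->]] := nexprP _ _ z; rewrite incE => e.
  have [ws' /= [|ys e']] := evP (DBd b n xs) ws; first by exists t.
  by exists (nexpr b n ys ws'); apply: incT; rewrite -tm_diff !incE.
have i'T : tcof i'.
  split=> // n; split=> [z y dz iz|z dz].
    have [||t tE] := (iQ n).1 (tm (inc true) (n - 1) z) (tm (inc false) n y).
    - by rewrite tm_diff dz linear0.
    - by rewrite -sqT iz tm_diff.
    exact: (bd true n z t).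
  have [|t [t' [_ tt']]] := (iQ n).2 (tm (inc false) (n - 1) z).
    by rewrite tm_diff dz linear0.
  (* [DHom] makes the source part small while t2 stays in the ambient T B; the difference is then a
     small element that bounds there, so [bd] finds a small bounding chain. That x is a cycle
     follows from injectivity of T i'. *)
  have [x [t2 xE]] : exists x t2,
      tm (inc false) (n - 1) z = tm i (n - 1) (tm (inc true) (n - 1) x) + td (C false) n t2.
    move: tt'; have [xs [ws ->]] := nexprP _ _ z; rewrite incE => e.
    have [ws' /= [|ys [t2 e']]] := evP (DHom n xs) ws; first by exists t, t'.
    by exists (nexpr true (n - 1) ys ws'), t2; rewrite incE.
  have [|y yE] := bd false n (z - tm i' (n - 1) x) t2.
    by rewrite linearB sqT xE addrAC subrr add0r.
  have zE : z = tm i' (n - 1) x + td (C' false) n y by rewrite -yE [RHS]addrC subrK.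
  exists x, y; split=> //; apply: (tinj_eq0 i'I).
  by move: dz; rewrite {1}zE linearD tdK addr0 tm_diff.
exists (Named valS i'T), inc; split=> //.
- by move=> b n; exists (val b n w0); rewrite incval ev0.
- move=> n y a; have [w <-] := valS _ _ y; rewrite incval => wa.
  have [ws' /= /(_ _ erefl a (esym wa)) [v [vE vP]]] := evP (DPre n) [:: w].
  case: ws' vE => [|w' []] //= [e]; exists (val true n w'); apply: (@incI false n).
  rewrite -[RHS]/(ml (chain_comp (inc false) i') n _) i'E.
  by rewrite -[RHS]/(ml i n (ml (inc true) n _)) !incval e.
- move=> n y a; have [xs [ws ->]] := nexprP _ _ y; rewrite incE => e.
  have [ws' /= [|ys e']] := evP (DInt n xs) ws; first by exists a.
  by exists (nexpr true n ys ws'); apply: (@incT false); rewrite sqT !incE.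
Qed.

End SmallSub.
End SmallSubcomplexes.

Section Codes.
Variables (k : fieldType) (G : topGroupType) (V : smooth_rep k G).
Local Notation H := (rep_end_op V).
Local Notation cx := (complex (LMod H)).
Local Notation ChH := (Ch (LMod H)).
Local Notation W := (name (demand V)).
Local Notation named := (named V).

(* The relations induced on names determine a named pair up to isomorphism; unlike
   named pairs, codes form a type in the universe of the modules, as needed to
   index the terms of the initial complex. *)
Definition code : Type :=
  (bool -> int -> H -> W -> W -> W -> Prop) *
  (bool -> int -> W -> W -> Prop) * (int -> W -> W -> Prop).

Definition code_of (N : named) : code :=
  ((fun b n c w w' w'' => nm_val N b n w'' = c *: nm_val N b n w + nm_val N b n w'),
   (fun b n w w' => dl (N b) n (nm_val N b n w) = nm_val N b (n - 1) w'),
   (fun n w w' => ml (nm_map N) n (nm_val N true n w) = nm_val N false n w')).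

Lemma code_iso (N N' : named) : code_of N = code_of N' ->
  exists t : forall b, chain_map (N b) (N' b),
    (forall b n w, ml (t b) n (nm_val N b n w) = nm_val N' b n w) /\
    chain_comp (nm_map N') (t true) = chain_comp (t false) (nm_map N).
Proof.
case=> lin dif map.
have linE b n c w w' w'' : nm_val N b n w'' = c *: nm_val N b n w + nm_val N b n w' ->
    nm_val N' b n w'' = c *: nm_val N' b n w + nm_val N' b n w'.
  by have := congr1 (fun r => r b n c w w' w'') lin; move=> /= ->.
have difE b n w w' : dl (N b) n (nm_val N b n w) = nm_val N b (n - 1) w' ->
    dl (N' b) n (nm_val N' b n w) = nm_val N' b (n - 1) w'.
  by have := congr1 (fun r => r b n w w') dif; move=> /= ->.
have mapE n w w' : ml (nm_map N) n (nm_val N true n w) = nm_val N false n w' ->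
    ml (nm_map N') n (nm_val N' true n w) = nm_val N' false n w'.
  by have := congr1 (fun r => r n w w') map; move=> /= ->.
(* Codes record no equality of names: it is the linear relation w' = 0 w + w. *)
have eqE b n w w' : nm_val N b n w = nm_val N b n w' ->
    nm_val N' b n w = nm_val N' b n w'.
  by move=> e; rewrite (linE b n 0 w w w') ?scale0r ?add0r.
pose f b n (x : el (N b) n) := nm_val N' b n (sval (cid (nm_surj x))).
have fE b n w : f b n (nm_val N b n w) = nm_val N' b n w.
  by apply: eqE; case: cid.
have fl b n : linear (f b n).
  move=> c x y; have [w <-] := nm_surj x; have [w' <-] := nm_surj y.
  have [w'' e] := nm_surj (c *: nm_val N b n w + nm_val N b n w').
  by rewrite -e !fE; exact: linE.
have fd b n x : dl (N' b) n (f b n x) = f b (n - 1) (dl (N b) n x).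
  have [w <-] := nm_surj x; have [w' e] := nm_surj (dl (N b) n (nm_val N b n w)).
  by rewrite -e !fE; exact: difE.
exists (fun b => @mkmap_fun H (N b) (N' b) _ (fl b) (fd b)); split; first exact: fE.
apply: ml_ext => n x; have [w <-] := nm_surj x.
have [w' e] := nm_surj (ml (nm_map N) n (nm_val N true n w)).
rewrite -[LHS]/(ml (nm_map N') n (f true n (nm_val N true n w))).
rewrite -[RHS]/(f false n (ml (nm_map N) n (nm_val N true n w))).
by rewrite -e !fE; exact: mapE.
Qed.

Definition small_index : Type := {c : code | exists N : named, code_of N = c}.
Definition decode (j : small_index) : named := sval (cid (svalP j)).

Lemma decodeE (j : small_index) : code_of (decode j) = sval j.
Proof. by rewrite /decode; case: cid. Qed.

Definition small_src (j : small_index) : cx := decode j true.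
Definition small_tgt (j : small_index) : cx := decode j false.
Definition small_map (j : small_index) : chain_map (small_src j) (small_tgt j) :=
  nm_map (decode j).

(** Only one representative of each code is indexed; the lift is transported along the isomorphisms
    of [code_iso]. *)
Lemma named_lifts (X Y : cx) (q : chain_map X Y) (N : named) :
  J_injective small_map q -> lifts (C := ChH) (nm_map N) q.
Proof.
move=> qJ u v sq.
pose j : small_index := exist _ (code_of N) (ex_intro _ N erefl).
have [t [tE tsq]] := code_iso (decodeE j).
have [t' [t'E t'sq]] := code_iso (esym (decodeE j)).
have tt' b : chain_comp (t b) (t' b) = chain_id (N b).
  apply: ml_ext => n x; have [w <-] := nm_surj x.
  by rewrite -[LHS]/(ml (t b) n (ml (t' b) n (nm_val N b n w))) t'E tE.
have [|h [hi qh]] := qJ j (chain_comp u (t true)) (chain_comp v (t false)).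
  apply: ml_ext => n x; apply: etrans (ml_eq (ml (t true) n x) sq) _.
  exact: (congr1 (ml v n) (ml_eq x tsq)).
exists (chain_comp h (t' false)); split; apply: ml_ext => n x.
  apply: etrans (congr1 (ml h n) (esym (ml_eq x t'sq))) _.
  apply: etrans (ml_eq (ml (t' true) n x) hi) _.
  exact: (congr1 (ml u n) (ml_eq x (tt' true))).
apply: etrans (ml_eq (ml (t' false) n x) qh) _.
exact: (congr1 (ml v n) (ml_eq x (tt' false))).
Qed.

End Codes.

(** * Lifting against all trivial cofibrations *)

Section ZornLift.
Variables (k : fieldType) (G : topGroupType) (V : smooth_rep k G).
Local Notation H := (rep_end_op V).
Local Notation cx := (complex (LMod H)).
Local Notation ChH := (Ch (LMod H)).

Variables (X Y : cx) (q : chain_map X Y).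
Hypothesis qJ : J_injective (@small_map k G V) q.

Definition pair_cx (A B : cx) (b : bool) : cx := if b then A else B.

Section Square.
Variables (A B : cx) (i : chain_map A B) (u : chain_map A X) (v : chain_map B Y).
Hypotheses (iT : tcof i) (sq : chain_comp q u = chain_comp v i).

(** Only T i is known to be injective, so this must be proved before a lift can be defined even on
    the image of [i]. A small subpair through [a] has a lift by hypothesis, and that lift forces u a
    = 0. *)
Lemma lift_kills_kernel n a : ml i n a = 0 -> ml u n a = 0.
Proof.
move=> ia.
pose u0 : efamily (pair_cx A B) :=
  supported (fun p => 0 : el (pair_cx A B p.1) p.2) (m := (true, n)) a.
have [N [inc [incsq [incT incI] incu _ _]]] := @small_sub k G V (pair_cx A B) i u0 iT.
have [x xE] := incu true n; rewrite /u0 supported_eq in xE.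
have [|h [hi _]] :=
  @named_lifts k G V X Y q N qJ (chain_comp u (inc true)) (chain_comp v (inc false)).
  apply: ml_ext => m y; apply: etrans (ml_eq (ml (inc true) m y) sq) _.
  exact: (congr1 (ml v m) (ml_eq y incsq)).
have ix : ml (nm_map N) n x = 0.
  apply: (@incI false n); rewrite linear0 -ia -xE; exact: esym (ml_eq x incsq).
by rewrite -xE -[LHS](ml_eq x hi) -[LHS]/(ml h n (ml (nm_map N) n x)) ix linear0.
Qed.

(* A partial lift is represented by its graph, a subcomplex of B x X. *)
Record partial_lift := PartialLift {
  pl_sub : forall n, submodule (el (prodcx B X) n);
  pl_diff : forall n z, pl_sub n z -> pl_sub (n - 1) (dl (prodcx B X) n z) }.

Definition pl_cx (g : partial_lift) : cx := subcx (@pl_diff g).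
Definition pl_incl (g : partial_lift) : chain_map (pl_cx g) (prodcx B X) :=
  subcx_incl (@pl_diff g).
Definition pl_fst (g : partial_lift) : chain_map (pl_cx g) B :=
  chain_comp (prod_fst B X) (pl_incl g).
Definition pl_snd (g : partial_lift) : chain_map (pl_cx g) X :=
  chain_comp (prod_snd B X) (pl_incl g).

(** [pl_tinj] and [pl_pure] give injectivity after T and on homology for the inclusion of the domain
    in [B]. Surjectivity on homology is inherited from [i] through [pl_base]. The inclusion is thus
    a trivial cofibration, to which [small_sub] applies again. *)
Record pl_good (g : partial_lift) : Prop := PlGood {
  pl_fun : forall n x, pl_sub g n (0, x) -> x = 0;
  pl_compat : forall n z, pl_sub g n z -> ml q n z.2 = ml v n z.1;
  pl_base : forall n a, pl_sub g n (ml i n a, ml u n a);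
  pl_tinj : tinj (pl_fst g);
  pl_pure : forall n z y, tm (pl_fst g) (n - 1) z = td B n y ->
    exists x, z = td (pl_cx g) n x }.

Lemma pl_lift (g : partial_lift) (Z : cx) (f : chain_map Z (prodcx B X)) :
  (forall n z, pl_sub g n (ml f n z)) ->
  exists h : chain_map Z (pl_cx g), chain_comp (pl_incl g) h = f.
Proof. exact: subcx_lift. Qed.

Lemma pl_fst_lift (g : partial_lift) (Z : cx) (h : chain_map Z (pl_cx g)) f :
  chain_comp (pl_incl g) h = f -> chain_comp (pl_fst g) h = chain_comp (prod_fst B X) f.
Proof. by move=> <-; exact: ml_ext. Qed.

Lemma pl_mono (g g' : partial_lift) :
  (forall n z, pl_sub g n z -> pl_sub g' n z) ->
  exists h : chain_map (pl_cx g) (pl_cx g'), chain_comp (pl_incl g') h = pl_incl g.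
Proof. by move=> gg'; apply: pl_lift => n z; apply: gg'; exact: subcx_inclS. Qed.

Lemma pl_fst_tcof (g : partial_lift) : pl_good g -> tcof (pl_fst g).
Proof.
move=> [_ _ base gI pure]; split=> // n; split=> [z y _ /pure //|z dz].
have [|j jE] := @pl_lift g _ (prod_pair i u); first exact: base.
have [x [y [dx ->]]] := (iT.2 n).2 _ dz.
exists (tm j (n - 1) x), y; rewrite tm_diff dx linear0; split=> //; congr (_ + _).
by rewrite -tm_comp; rewrite (pl_fst_lift jE); congr (tm _ _ _); exact: ml_ext.
Qed.

Definition pl_set (g : partial_lift) : set {n : int & el (prodcx B X) n} :=
  [set p | pl_sub g (projT1 p) (projT2 p)].

Definition good_set S := exists g, pl_good g /\ S = pl_set g.

(** The map j from [A] to the graph is surjective, hence so is T j. As T i is injective and factors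
    through T j, the graph inherits injectivity and purity from [i]. *)
Lemma good_base : good_set [set p | exists a,
  projT2 p = (ml i (projT1 p) a, ml u (projT1 p) a)].
Proof.
pose S0 n (z : el (prodcx B X) n) := exists a, z = (ml i n a, ml u n a).
have S00 n : S0 n 0 by exists 0; rewrite !linear0.
have S0P n c x y : S0 n x -> S0 n y -> S0 n (c *: x + y).
  by move=> [a ->] [b ->]; exists (c *: a + b); rewrite !linearP.
pose S n : submodule (el (prodcx B X) n) := Submodule (@S00 n) (@S0P n).
have Sd n z : S n z -> S (n - 1) (dl (prodcx B X) n z).
  by move=> [a ->]; exists (dl A n a); rewrite -!ml_diff.
pose g := PartialLift Sd.
have gbase n a : pl_sub g n (ml i n a, ml u n a) by exists a.
have [|j jE] := @pl_lift g _ (prod_pair i u); first exact: gbase.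
have ij : chain_comp (pl_fst g) j = i.
  by rewrite (pl_fst_lift jE); exact: ml_ext.
have ijT n t : tm (pl_fst g) n (tm j n t) = tm i n t by rewrite -tm_comp ij.
have jS n t : exists s, t = tm j n s.
  elim/tsum_ind: t => [|x m t [s ->]]; first by exists 0; rewrite linear0.
  have [a aE] := subcx_inclS m.
  exists (tsum [:: (x, a)] + s); rewrite linearD; congr (_ + _).
  rewrite /tm tmapE /=; congr (tsum [:: (_, _)]).
  apply: (@subcx_incl_inj _ _ _ Sd); rewrite [LHS]aE.
  exact: esym (ml_eq a jE).
exists g; split=> //; split=> //.
- by move=> n x [a [/esym/lift_kills_kernel -> ->]].
- by move=> n _ [a ->]; exact: (ml_eq a sq).
- apply: tinj_ker => n t; have [s ->] := jS _ t; rewrite ijT => /(tinj_eq0 iT.1) ->.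
  exact: linear0.
- move=> n z y; have [s ->] := jS _ z; rewrite ijT => sy.
  have [|x ->] := (iT.2 n).1 s y _ sy.
    by apply: (tinj_eq0 iT.1); rewrite -tm_diff sy tdK.
  by exists (tm j n x); rewrite tm_diff.
Qed.

(** A tensor over the union is a finite sum, so it comes from one member of the chain ([fin]).
    Injectivity after T and purity can then be tested in that member. *)
Lemma good_chain (F : set (set {n : int & el (prodcx B X) n})) :
  F `<=` good_set -> F !=set0 -> total_on F subset -> good_set (\bigcup_(S in F) S).
Proof.
move=> Fgood [S1 FS1] totF.
pose U n (z : el (prodcx B X) n) := exists2 S, F S & S (existT _ n z).
have U2 n z m t : U n z -> U m t -> exists S, [/\ F S, S (existT _ n z) & S (existT _ m t)].
  move=> [S FS Sz] [S' FS' S't]; have [SS'|SS'] := totF _ _ FS FS'.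
    by exists S'; split=> //; exact: SS'.
  by exists S; split=> //; exact: SS'.
have U0 n : U n 0.
  by have [g [gg SE]] := Fgood _ FS1; exists S1 => //; rewrite SE; exact: sm_set0.
have UP n c x y : U n x -> U n y -> U n (c *: x + y).
  move=> Ux Uy; have [S [FS]] := U2 _ _ _ _ Ux Uy; have [g [_ SE]] := Fgood _ FS.
  by rewrite SE => Sx Sy; exists S => //; rewrite SE; exact: sm_setP.
pose Us n : submodule (el (prodcx B X) n) := Submodule (@U0 n) (@UP n).
have Ud n z : Us n z -> Us (n - 1) (dl (prodcx B X) n z).
  move=> [S FS]; have [g [_ SE]] := Fgood _ FS; rewrite SE => Sz.
  by exists S => //; rewrite SE; exact: (pl_diff Sz).
pose gU := PartialLift Ud.
have sub g : F (pl_set g) -> forall n z, pl_sub g n z -> pl_sub gU n z.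
  by move=> Fg n z gz; exists (pl_set g).
have fin n (t : tel (pl_cx gU) n) : exists g, [/\ F (pl_set g), pl_good g &
    forall h : chain_map (pl_cx g) (pl_cx gU), chain_comp (pl_incl gU) h = pl_incl g ->
    exists s, t = tm h n s].
  have [l ->] := tsumP t.
  suff [g [Fg gg lg]] : exists g, [/\ F (pl_set g), pl_good g &
      forall x, x \in unzip2 l -> pl_sub g n (ml (pl_incl gU) n x)].
    exists g; split=> // h hE.
    elim: l lg => [|[x m] l IHl] lg; first by exists 0; rewrite linear0.
    have [y my|s sE] := IHl; first by apply: lg; rewrite inE my orbT.
    have [|a aE] := @subcx_inclP _ _ _ (@pl_diff g) n (ml (pl_incl gU) n m).
      by apply: lg; rewrite inE eqxx.
    exists (tsum [:: (x, a)] + s); rewrite linearD -sE tsum_cons; congr (_ + _).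
    rewrite /tm tmapE /=; congr (tsum [:: (_, _)]).
    by apply: (@subcx_incl_inj _ _ _ Ud); rewrite -[RHS](ml_eq a (esym hE)).
  elim: l => [|[x m] l [g [Fg gg lg]]].
    by have [g [gg SE]] := Fgood _ FS1; exists g; rewrite -SE.
  have [S' FS' S'm] := subcx_inclS m; have [g' [gg' S'E]] := Fgood _ FS'.
  have [gS'|S'g] := totF _ _ Fg FS'.
    exists g'; rewrite -S'E; split=> // y; rewrite inE => /orP [/eqP ->|/lg gy].
      by move: S'm; rewrite S'E.
    by have := gS' (existT _ n _) gy; rewrite S'E.
  exists g; split=> // y; rewrite inE => /orP [/eqP ->|/lg //].
  exact: (S'g _ S'm).
have fstE g (h : chain_map (pl_cx g) (pl_cx gU)) : chain_comp (pl_incl gU) h = pl_incl g ->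
    chain_comp (pl_fst gU) h = pl_fst g.
  by move=> /pl_fst_lift.
exists gU; split; last first.
  apply/seteqP; split=> [[n z] [S FS Sz]|[n z] [S FS Sz]]; first by exists S.
  by exists S.
split.
- move=> n x [S FS]; have [g [gg ->]] := Fgood _ FS; exact: pl_fun.
- move=> n z [S FS]; have [g [gg ->]] := Fgood _ FS; exact: pl_compat.
- move=> n a; have [g [gg SE]] := Fgood _ FS1; exists S1 => //; rewrite SE.
  exact: pl_base.
- apply: tinj_ker => n t; have [g [Fg gg ts]] := fin _ t.
  have [h hE] := pl_mono (sub _ Fg); have [s ->] := ts _ hE.
  by rewrite -tm_comp (fstE _ _ hE) => /(tinj_eq0 (pl_tinj gg)) ->; rewrite linear0.
- move=> n z y; have [g [Fg gg ts]] := fin _ z.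
  have [h hE] := pl_mono (sub _ Fg); have [s ->] := ts _ hE.
  rewrite -tm_comp (fstE _ _ hE) => /(pl_pure gg) [x ->].
  by exists (tm h n x); rewrite tm_diff.
Qed.

Lemma maximal_lift : exists g, pl_good g /\
  forall g', pl_good g' -> (forall n z, pl_sub g n z -> pl_sub g' n z) ->
  forall n z, pl_sub g' n z -> pl_sub g n z.
Proof.
pose S0 : set {n : int & el (prodcx B X) n} :=
  [set p | exists a, projT2 p = (ml i (projT1 p) a, ml u (projT1 p) a)].
have [|S [[g [gg SE]] Smax]] := @Zorn_bigcup _ (fun S => good_set (S0 `|` S)).
  move=> F FP totF.
  (* Adding [S0] as a member makes the chain nonempty, as [good_chain] requires. *)
  rewrite (_ : S0 `|` _ = \bigcup_(S in [set S0 `|` S | S in F] `|` [set S0]) S); last first.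
    apply/seteqP; split=> [p [S0p|[S FS Sp]]|p [_ [[S FS <-]|->]]].
    - by exists S0 => //; right.
    - by exists (S0 `|` S); [left; exists S|right].
    - by move=> [S0p|Sp]; [left|right; exists S].
    - by left.
  apply: good_chain.
  - by move=> _ [[S FS <-]|->]; [exact: FP|exact: good_base].
  - by exists S0; right.
  - have S0S S : S0 `<=` S0 `|` S by move=> p; left.
    move=> _ _ [[S FS <-]|->] [[S' FS' <-]|->].
    + have [SS|SS] := totF _ _ FS FS'; first by left; exact: setUS.
      by right; exact: setUS.
    + by right.
    + by left.
    + by left.
exists g; split=> // g' gg' gsub n z g'z.
have S0g' : S0 `|` pl_set g' = pl_set g'.
  apply/seteqP; split=> [[m t] [[a /= tE]|//]|p pg]; last by right.
  by rewrite /pl_set /= tE; exact: pl_base.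
have Sg p : S p -> pl_set g p by rewrite -SE => Sp; right.
apply: contrapT => ngz.
apply: (Smax (pl_set g')); last by exists g'.
split=> [[m t] /Sg|g'S]; first exact: gsub.
by apply: ngz; have /Sg := g'S (existT _ n z) g'z.
Qed.

Section Extend.
Variable g : partial_lift.
Hypothesis gg : pl_good g.

(** A small subpair of the inclusion of the domain in [B], taken through [b], has a lift h; the
    graph of h is added to that of [g]. Overlaps between the two graphs are controlled by the
    intersection properties [pre] and [int]. *)
Lemma pl_extend n0 (b : el B n0) : exists g', [/\ pl_good g',
  (forall n z, pl_sub g n z -> pl_sub g' n z) & exists x, pl_sub g' n0 (b, x)].
Proof.
pose u0 : efamily (pair_cx (pl_cx g) B) :=
  supported (fun p => 0 : el (pair_cx (pl_cx g) B p.1) p.2) (m := (false, n0)) b.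
have [N [inc [incsq [incT incI] incu pre int]]] :=
  @small_sub k G V (pair_cx (pl_cx g) B) (pl_fst g) u0 (pl_fst_tcof gg).
have [b' b'E] := incu false n0; rewrite /u0 supported_eq in b'E.
have [|h [hi hq]] := @named_lifts k G V X Y q N qJ (chain_comp (pl_snd g) (inc true))
    (chain_comp v (inc false)).
  apply: ml_ext => m y.
  apply: etrans (pl_compat gg (subcx_inclS (ml (inc true) m y))) _.
  exact: (congr1 (ml v m) (ml_eq y incsq)).
pose f : chain_map (N false) (prodcx B X) := prod_pair (inc false) h.
pose S0 n (z : el (prodcx B X) n) := exists p y, pl_sub g n p /\ z = p + ml f n y.
have S00 n : S0 n 0 by exists 0, 0; rewrite linear0 addr0; split=> //; exact: sm_set0.
have S0P n c x y : S0 n x -> S0 n y -> S0 n (c *: x + y).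
  move=> [p [s [gp ->]]] [p' [s' [gp' ->]]]; exists (c *: p + p'), (c *: s + s').
  by split; [exact: sm_setP|rewrite linearP scalerDr addrACA].
pose S n : submodule (el (prodcx B X) n) := Submodule (@S00 n) (@S0P n).
have Sd n z : S n z -> S (n - 1) (dl (prodcx B X) n z).
  move=> [p [s [gp ->]]]; exists (dl (prodcx B X) n p), (dl (N false) n s).
  by split; [exact: pl_diff|rewrite linearD ml_diff].
pose g' := PartialLift Sd.
have gg' n z : pl_sub g n z -> pl_sub g' n z.
  by move=> gz; exists z, 0; rewrite linear0 addr0.
have g'f n y : pl_sub g' n (ml f n y).
  by exists 0, y; rewrite add0r; split=> //; exact: sm_set0.
have [jg jgE] := pl_mono gg'; have [jN jNE] := pl_lift g'f.
have jsq : chain_comp jN (nm_map N) = chain_comp jg (inc true).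
  apply: ml_ext => n x; apply: (@subcx_incl_inj _ _ _ Sd).
  rewrite -[LHS]/(ml (chain_comp (pl_incl g') jN) n (ml (nm_map N) n x)) jNE.
  rewrite -[RHS]/(ml (chain_comp (pl_incl g') jg) n (ml (inc true) n x)) jgE.
  rewrite [RHS]surjective_pairing; congr (_, _); last exact: (ml_eq x hi).
  exact: esym (ml_eq x incsq).
have fstg n t : tm (pl_fst g') n (tm jg n t) = tm (pl_fst g) n t.
  by rewrite -tm_comp (pl_fst_lift jgE).
have fstN n t : tm (pl_fst g') n (tm jN n t) = tm (inc false) n t.
  rewrite -tm_comp; congr (tm _ _ _); apply: ml_ext => m x.
  by rewrite -[LHS]/(ml (chain_comp (pl_incl g') jN) m x).1 jNE.
have jsqT n t : tm jN n (tm (nm_map N) n t) = tm jg n (tm (inc true) n t).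
  by rewrite -!tm_comp jsq.
have incsqT n t : tm (pl_fst g) n (tm (inc true) n t) = tm (inc false) n (tm (nm_map N) n t).
  by rewrite -!tm_comp incsq.
have dec n t : exists t1 t2, t = tm jg n t1 + tm jN n t2.
  elim/tsum_ind: t => [|x m t [t1 [t2 ->]]]; first by exists 0, 0; rewrite !linear0 addr0.
  have [p [y [gp mE]]] := subcx_inclS m; have [p' p'E] := subcx_inclP (@pl_diff g) gp.
  exists (tsum [:: (x, p')] + t1), (tsum [:: (x, y)] + t2).
  rewrite !linearD addrACA; congr (_ + _); rewrite /tm !tmapE /= -tsum_addr.
  congr (tsum [:: (_, _)]); apply: (@subcx_incl_inj _ _ _ Sd); rewrite [LHS]mE linearD.
  congr (_ + _); last exact: esym (ml_eq y jNE).
  by rewrite -p'E; exact: esym (ml_eq p' jgE).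
have gI := pl_tinj gg; have [nI nQ] := nm_tcof N.
have g'I : tinj (pl_fst g').
  apply: tinj_ker => n t; have [t1 [t2 ->]] := dec n t.
  rewrite linearD fstg fstN => e0.
  have [|r rE] := int n t2 (- t1).
    by apply/eqP; rewrite linearN -addr_eq0 addrC e0.
  have -> : t1 = - tm (inc true) n r.
    apply: gI; rewrite linearN incsqT -rE; apply/eqP.
    by rewrite -addr_eq0 e0.
  by rewrite rE jsqT linearN addNr.
exists g'; split=> //; last first.
  by exists (ml h n0 b'); rewrite -b'E; exact: g'f.
split=> //.
- move=> n x [p [y [gp e]]].
  have e1 : 0 = p.1 + ml (inc false) n y := congr1 fst e.
  have e2 : x = p.2 + ml h n y := congr1 snd e.
  have [p' p'E] := subcx_inclP (@pl_diff g) gp.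
  (* Since y lies in the image of the old domain, it comes from some r in the small source. Then p +
     inc r belongs to the old graph, has first component 0 and second component x. *)
  have [|r rE] := pre n y (- p').
    rewrite linearN -[X in _ = - X]/((ml (pl_incl g) n p').1) p'E.
    by apply/eqP; rewrite -addr_eq0 addrC -e1.
  apply: (pl_fun gg (n := n)).
  have := subcx_inclS (p' + ml (inc true) n r); congr (pl_sub g n _).
  rewrite [LHS]surjective_pairing; congr (_, _).
    rewrite linearD p'E e1; congr (_ + _).
    by rewrite rE; exact: (ml_eq r incsq).
  rewrite linearD p'E e2; congr (_ + _).
  by rewrite rE; exact: esym (ml_eq r hi).
- move=> n z [p [y [gp ->]]]; rewrite !linearD (pl_compat gg gp); congr (_ + _).
  exact: (ml_eq y hq).
- by move=> n a; apply: gg'; exact: pl_base.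
- move=> n z y zy.
  have dz : td (pl_cx g') (n - 1) z = 0.
    by apply: (tinj_eq0 g'I); rewrite -tm_diff zy tdK.
  (* The aim is to move t2 into the old domain up to a boundary. As z is a cycle, d t2 lies in the
     image of the old domain and so comes from some r; r = d r2 because the small map is a
     quasi-isomorphism. The remaining cycle t2 - r2 is homologous to the image of some a, and purity
     of [g] applies to t1 + r2 + a. *)
  have [t1 [t2 zE]] := dec _ z.
  have [|r rE] := int _ (td (N false) (n - 1) t2) (- td (pl_cx g) (n - 1) t1).
    apply/eqP; rewrite linearN -addr_eq0 -fstg -fstN -linearD -!tm_diff -linearD.
    by rewrite [tm jN _ _ + _]addrC -zE dz linear0.
  have dr : td (N true) (n - 1 - 1) r = 0.
    by apply: (tinj_eq0 nI); rewrite -tm_diff -rE tdK.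
  have [r2 r2E] := (nQ (n - 1)).1 _ _ dr (esym rE).
  have [|a [c [_ acE]]] := (nQ n).2 (t2 - tm (nm_map N) (n - 1) r2).
    by rewrite linearB tm_diff -r2E rE subrr.
  have t2E : t2 = tm (nm_map N) (n - 1) (r2 + a) + td (N false) n c.
    by rewrite linearD -addrA -acE addrC subrK.
  have zE' : z = tm jg (n - 1) (t1 + tm (inc true) (n - 1) (r2 + a)) +
      td (pl_cx g') n (tm jN n c).
    by rewrite zE t2E (linearD (tm jN (n - 1))) jsqT addrA -(linearD (tm jg (n - 1))) tm_diff.
  have [|w wE] := @pl_pure g gg n (t1 + tm (inc true) (n - 1) (r2 + a)) (y - tm (inc false) n c).
    rewrite (linearB (td B n)) -zy zE' (linearD (tm (pl_fst g') (n - 1))) fstg.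
    by rewrite -tm_diff fstN addrK.
  by exists (tm jg n w + tm jN n c); rewrite linearD tm_diff -wE.
Qed.

End Extend.

Lemma tcof_lifts : exists h : chain_map B X, chain_comp h i = u /\ chain_comp q h = v.
Proof.
have [g [gg gmax]] := maximal_lift.
have tot n b : exists x, pl_sub g n (b, x).
  have [g' [gg' sub [x g'x]]] := pl_extend gg b.
  by exists x; exact: gmax gg' sub _ _ g'x.
have uniq n b x x' : pl_sub g n (b, x) -> pl_sub g n (b, x') -> x = x'.
  move=> gx gx'; apply/eqP; rewrite -subr_eq0; apply/eqP; apply: (pl_fun gg (n := n)).
  have := sm_setP (-1) gx' gx; congr (pl_sub g n _).
  by congr (_, _); rewrite /= scaleN1r addrC // subrr.
pose f n b := sval (cid (tot n b)).
have fP n b : pl_sub g n (b, f n b) by rewrite /f; case: cid.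
have fl n : linear (f n).
  move=> c x y; apply: (uniq n (c *: x + y)) => //.
  exact: (sm_setP c (fP n x) (fP n y)).
have fd n x : dl X n (f n x) = f (n - 1) (dl B n x).
  apply: (uniq (n - 1) (dl B n x)) => //; exact: (pl_diff (fP n x)).
exists (@mkmap_fun H B X _ fl fd); split; apply: ml_ext => n x.
  exact: (uniq n (ml i n x) _ _ (fP _ _) (pl_base gg _)).
exact: (pl_compat gg (fP n x)).
Qed.

End Square.
End ZornLift.

(** * The model structure *)

Section Assembly.
Variables (C : category) (c w : morphism_class C).
Hypotheses (c_sub : subcategory c) (c_ret : retract_closed c).
Hypotheses (w_sub : subcategory w) (w_23 : two_of_three w) (w_ret : retract_closed w).
Variables fac1 fac2 : functorial_factorization C.
Hypothesis cof_tfib_factP : forall (X Y : C) (f : mor X Y),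
  [/\ c (fact_left fac1 f), rlp c (fact_right fac1 f) & w (fact_right fac1 f)].
Hypothesis tcof_fib_factP : forall (X Y : C) (f : mor X Y),
  (c (fact_left fac2 f) /\ w (fact_left fac2 f)) /\
  rlp (@cap_class C c w) (fact_right fac2 f).

Lemma rlp_subcategory (P : morphism_class C) : subcategory (@rlp C P).
Proof.
split=> [X A B i _ u v sq|X Y Z g f gP fP A B i iP u v sq].
  by exists v; rewrite !comp1m in sq *.
have [|h [hi gh]] := gP _ _ i iP (f \;o u) v; first by rewrite Defs.compA.
have [|l [li fl]] := fP _ _ i iP u h; first by rewrite hi.
by exists l; rewrite -Defs.compA fl.
Qed.

Lemma rlp_retract (P : morphism_class C) : retract_closed (@rlp C P).
Proof.
move=> X Y X' Y' f g [i [r [j [s [ri sj gi fr]]]]] gP A B a aP u v sq.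
have [|h [ha gh]] := gP _ _ a aP (i \;o u) (j \;o v).
  by rewrite Defs.compA gi -!Defs.compA sq.
exists (r \;o h); split; first by rewrite -Defs.compA ha Defs.compA ri comp1m.
by rewrite Defs.compA fr -Defs.compA gh Defs.compA sj comp1m.
Qed.

(** Retract argument: by two out of three the left factor of [q] is a trivial cofibration, so [q]
    lifts against it and is a retract of its right factor. *)
Lemma rlp_cof_tfib (A B X Y : C) (i : mor A B) (q : mor X Y) : c i ->
  cap_class (@rlp C (@cap_class C c w)) w q -> lifts i q.
Proof.
move=> ci [qf qw].
have [cl rr wr] := cof_tfib_factP q.
have wl : w (fact_left fac1 q).
  have [_ _ h] := w_23 (fact_left fac1 q) (fact_right fac1 q).
  by apply: h => //; rewrite Defs.factE.
have [|h [hl qh]] := qf _ _ _ (conj cl wl) (idm X) (fact_right fac1 q).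
  by rewrite compm1 Defs.factE.
apply: (@rlp_retract c _ _ _ _ q (fact_right fac1 q) _ rr _ _ i ci).
exists (fact_left fac1 q), h, (idm Y), (idm Y).
by rewrite Defs.factE !comp1m.
Qed.

Definition assemble : model_structure C.
Proof.
apply: (@ModelStructure C w c (@rlp C (@cap_class C c w)) fac1 fac2) => //.
- exact: rlp_subcategory.
- exact: rlp_retract.
- by move=> A B X Y i q ci; apply.
- exact: rlp_cof_tfib.
- move=> X Y f; have [cl rr wr] := cof_tfib_factP f; split=> //; split=> // A B i [ci _].
  exact: rr.
Defined.

End Assembly.

(** * Quasi-isomorphisms and monomorphisms of complexes of representations *)

Section Homology.
Variables (k : fieldType) (G : topGroupType).
Local Notation cx := (complex (Rep k G)).
Local Notation ChG := (Ch (Rep k G)).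

Lemma homology_pi (X : cx) n (a : homology X n) : exists z, a = \pi_(homology X n) z.
Proof. by exists (repr a); rewrite reprK. Qed.

Lemma homology_map_comp (X Y Z : cx) (f : chain_map X Y) (g : chain_map Y Z) n :
  homology_map (chain_comp g f) (n := n) =1 homology_map g (n := n) \o homology_map f (n := n).
Proof.
move=> a; have [z ->] := homology_pi a; rewrite /= !homology_mapE.
by congr (\pi_(homology Z n) _); exact: val_inj.
Qed.

Lemma homology_map_id (X : cx) n : homology_map (chain_id X) (n := n) =1 id.
Proof.
move=> a; have [z ->] := homology_pi a; rewrite homology_mapE.
by congr (\pi_(homology X n) _); exact: val_inj.
Qed.

Lemma inj_surj_bijective (S T : Type) (f : S -> T) :
  injective f -> (forall y, exists x, f x = y) -> bijective f.
Proof.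
move=> fI /choice [g fg]; exists g => [x|y]; last exact: fg.
by apply: fI; rewrite fg.
Qed.

Lemma bijective_surj (S T : Type) (f : S -> T) : bijective f ->
  forall y, exists x, f x = y.
Proof. by case=> g _ fg y; exists (g y). Qed.

Lemma quasi_iso_subcategory : subcategory (fun X Y => @quasi_iso k G X Y).
Proof.
split=> [X n|X Y Z g f gq fq n].
  apply: (@eq_bij _ _ id); first by exists id.
  by move=> x; exact: esym (homology_map_id x).
exact: (eq_bij (bij_comp (gq n) (fq n)) (fun x => esym (@homology_map_comp X Y Z f g n x))).
Qed.

Lemma quasi_iso_two_of_three : two_of_three (fun X Y => @quasi_iso k G X Y).
Proof.
move=> X Y Z f g; split.
- by move=> fq gq; exact: quasi_iso_subcategory.2 gq fq.
- move=> fq gfq n; have [f' ff' f'f] := fq n.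
  have gE y : homology_map (g \;o f : chain_map X Z) (f' y) = homology_map (n := n) g y.
    by rewrite homology_map_comp /= f'f.
  exact: (eq_bij (bij_comp (gfq n) (Bijective f'f ff')) gE).
- move=> gq gfq n; have [g' gg' g'g] := gq n.
  have fE x : g' (homology_map (g \;o f : chain_map X Z) x) = homology_map (n := n) f x.
    by rewrite homology_map_comp /= gg'.
  exact: (eq_bij (bij_comp (Bijective g'g gg') (gfq n)) fE).
Qed.

Lemma quasi_iso_retract : retract_closed (fun X Y => @quasi_iso k G X Y).
Proof.
move=> A B X Y f g [i [r [j [s [ri sj gi fr]]]]] gq n.
have HC (P Q R : cx) (u : chain_map P Q) (v : chain_map Q R) (a : homology P n) :
    homology_map v (homology_map u a) = homology_map (chain_comp v u) a.
  by rewrite homology_map_comp.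
have Hri (a : homology A n) : homology_map r (homology_map i a) = a.
  by rewrite HC [chain_comp _ _]ri homology_map_id.
have Hsj (b : homology B n) : homology_map s (homology_map j b) = b.
  by rewrite HC [chain_comp _ _]sj homology_map_id.
have Hgi (a : homology A n) : homology_map g (homology_map i a) = homology_map j (homology_map f a).
  by rewrite !HC [chain_comp _ _]gi.
have Hfr (x : homology X n) : homology_map f (homology_map r x) = homology_map s (homology_map g x).
  by rewrite !HC [chain_comp _ _]fr.
apply: inj_surj_bijective => [a b ab|b].
  have e : homology_map i a = homology_map i b by apply: (bij_inj (gq n)); rewrite !Hgi ab.
  by rewrite -[a]Hri e Hri.
have [x xE] := bijective_surj (gq n) (homology_map j b).
by exists (homology_map r x); rewrite Hfr xE Hsj.
Qed.

Definition rcdiff (X : cx) n : rep_hom (X n) (X (n - 1)) := cdiff X n.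
Definition rcmap (X Y : cx) (f : chain_map X Y) n : rep_hom (X n) (Y n) := f n.

Lemma quasi_isoP (X Y : ChG) (f : mor X Y) : quasi_iso f <-> forall n,
  (forall z y, rcdiff X (n - 1) z = 0 -> rcmap f (n - 1) z = rcdiff Y n y ->
     exists x, z = rcdiff X n x) /\
  (forall z, rcdiff Y (n - 1) z = 0 -> exists x y,
     rcdiff X (n - 1) x = 0 /\ z = rcmap f (n - 1) x + rcdiff Y n y).
Proof.
split=> [fq n|fP n].
  split=> [z y /eqP dz fz|z /eqP dz].
    pose c : cycles X n := exist _ z dz.
    have d0 : rcdiff X (n - 1) 0 == 0 by rewrite linear0.
    pose c0 : cycles X n := exist _ 0 d0.
    have : \pi_(homology X n) c = \pi_(homology X n) c0.
      apply: (bij_inj (fq n)); rewrite !homology_mapE; apply/eqquotP/asboolP.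
      by exists y; rewrite /= -[LHS]fz linear0 subr0.
    by move=> /eqquotP/asboolP [x xE]; exists x; rewrite [RHS]xE subr0.
  pose c : cycles Y n := exist _ z dz.
  have [a] := bijective_surj (fq n) (\pi_(homology Y n) c).
  have [[x /= dx] ->] := homology_pi a; rewrite homology_mapE.
  move=> /eqquotP/asboolP [y /= yE]; exists x, (- y); split; first exact/eqP.
  have yE' : rcdiff Y n y = rcmap f (n - 1) x - z := yE.
  by rewrite linearN yE' opprB [RHS]addrC subrK.
apply: inj_surj_bijective => [a b|b].
  have [[x dx] ->] := homology_pi a; have [[x' dx'] ->] := homology_pi b.
  rewrite !homology_mapE => /eqquotP/asboolP [y /= yE].
  have [||t tE] := (fP n).1 (x - x') y.
  - by rewrite linearB (eqP dx) (eqP dx') subrr.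
  - by rewrite linearB; exact: esym yE.
  by apply/eqquotP/asboolP; exists t; exact: esym tE.
have [[z dz] ->] := homology_pi b.
have [x [y [/eqP dx zE]]] := (fP n).2 z (eqP dz).
exists (\pi_(homology X n) (exist _ x dx)); rewrite homology_mapE.
apply/eqquotP/asboolP; exists (- y); rewrite linearN /= zE opprD addrA subrr add0r.
by [].
Qed.

Section KernelRep.
Variables (U W : smooth_rep k G) (f : rep_hom U W).

Lemma ker0 : f 0 = 0. Proof. exact: linear0. Qed.
Lemma kerP (c : k) (u v : U) : f u = 0 -> f v = 0 -> f (c *: u + v) = 0.
Proof. by move=> fu fv; rewrite linearP fu fv scaler0 addr0. Qed.
Definition ker_sub : submodule U := Submodule ker0 kerP.

Lemma ker_act_subproof g (x : sm_type ker_sub) : ker_sub (rep_act g (sm_val x)).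
Proof. by have /= := sm_valS x; rewrite rep_hom_act => ->; exact: rep_act0. Qed.

Definition ker_act g (x : sm_type ker_sub) : sm_type ker_sub :=
  sm_mk (ker_act_subproof g x).

Lemma ker_act_linear g : linear (ker_act g).
Proof. by move=> c x y; apply: sm_val_inj; exact: rep_linear. Qed.
Lemma ker_act1 x : ker_act 1%g x = x.
Proof. by apply: sm_val_inj; exact: rep_act1. Qed.
Lemma ker_actM g h x : ker_act (g * h)%g x = ker_act g (ker_act h x).
Proof. by apply: sm_val_inj; exact: rep_actM. Qed.
Lemma ker_smooth x : open [set g | ker_act g x = x].
Proof.
rewrite (_ : [set g | _] = [set g | rep_act g (sm_val x) = sm_val x]).
  exact: rep_smooth.
apply/seteqP; split=> g /= gx; last exact: sm_val_inj.
by rewrite -[in RHS]gx.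
Qed.

Definition ker_rep : smooth_rep k G :=
  SmoothRep ker_act_linear ker_act1 ker_actM ker_smooth.

Definition ker_incl : rep_hom ker_rep U :=
  @RepHom k G ker_rep U (sm_incl ker_sub) (fun g v => erefl).

End KernelRep.

Section KernelComplex.
Variables (X Y : cx) (f : chain_map X Y).

Lemma ker_diff_subproof n (x : ker_rep (rcmap f n)) :
  ker_sub (rcmap f (n - 1)) (rcdiff X n (sm_val x)).
Proof.
have /(congr1 (fun h : rep_hom _ _ => h (sm_val x))) /= <- := cmap_diff f n.
by have /= -> := sm_valS x; exact: linear0.
Qed.

Definition ker_diff_fun n (x : ker_rep (rcmap f n)) : ker_rep (rcmap f (n - 1)) :=
  sm_mk (ker_diff_subproof x).

Lemma ker_diff_linear n : linear (@ker_diff_fun n).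
Proof. by move=> c x y; apply: sm_val_inj; exact: linearP. Qed.

Lemma ker_diff_act n g (x : ker_rep (rcmap f n)) :
  mklin (@ker_diff_linear n) (rep_act g x) = rep_act g (mklin (@ker_diff_linear n) x).
Proof. by apply: sm_val_inj; exact: (rep_hom_act (rcdiff X n)). Qed.

Definition ker_diff n : rep_hom (ker_rep (rcmap f n)) (ker_rep (rcmap f (n - 1))) :=
  @RepHom k G _ _ (mklin (@ker_diff_linear n)) (@ker_diff_act n).

Definition ker_cx : cx.
Proof.
apply: (@Complex (Rep k G) (fun n => ker_rep (rcmap f n)) ker_diff) => n.
apply: rep_hom_ext => x; apply: sm_val_inj.
by have /(congr1 (fun h : rep_hom _ _ => h (sm_val x))) := cdiffK X n.
Defined.

Definition ker_cx_incl : chain_map ker_cx X.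
Proof.
apply: (@ChainMap (Rep k G) ker_cx X (fun n => ker_incl (rcmap f n))) => n.
exact: rep_hom_ext.
Defined.

Definition ker_cx_zero : chain_map ker_cx X.
Proof.
apply: (@ChainMap (Rep k G) ker_cx X (fun n => rep_zero _ _)) => n.
by apply: rep_hom_ext => x; exact: linear0.
Defined.

(** The termwise kernel, a complex of smooth representations, is the test object: its inclusion and
    the zero map become equal after [f]. *)
Lemma monomorphismP : monomorphism (C := ChG) f <-> forall n, injective (rcmap f n).
Proof.
split=> [fm n x x' xx'|fI Z u v uv].
  have e : ker_cx_incl = ker_cx_zero.
    apply: (fm ker_cx); apply: chain_map_ext => m; apply: rep_hom_ext => y.
    rewrite -[LHS]/(rcmap f m (sm_val y)) -[RHS]/(rcmap f m 0).
    by rewrite linear0; exact: (sm_valS y).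
  have kx : ker_sub (rcmap f n) (x - x') by rewrite /= linearB xx' subrr.
  apply/eqP; rewrite -subr_eq0; apply/eqP.
  exact: (congr1 (fun h : chain_map ker_cx X => rcmap h n (sm_mk kx)) e).
apply: chain_map_ext => n; apply: rep_hom_ext => z; apply: fI.
exact: (congr1 (fun h : chain_map Z Y => rcmap h n z) uv).
Qed.

End KernelComplex.
End Homology.

(** * Transfer of the structure along the tensor functor *)

Section Transfer.
Variables (k : fieldType) (G : topGroupType) (V : smooth_rep k G).
Local Notation H := (rep_end_op V).
Local Notation ChH := (Ch (LMod H)).
Local Notation F := (Ch_functor (tensor_zfunctor V)).

Lemma tinj_monoP (M N : ChH) (g : mor M N) : monomorphism (fmor F g) <-> tinj g.
Proof. exact: monomorphismP. Qed.

Lemma tqisoP (M N : ChH) (g : mor M N) : quasi_iso (fmor F g) <-> tqiso g.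
Proof. exact: quasi_isoP. Qed.

Definition fcof : morphism_class ChH := fun M N g => monomorphism (fmor F g).
Definition fweq : morphism_class ChH := fun M N g => quasi_iso (fmor F g).

Lemma fretract (M N M' N' : ChH) (f : mor M N) (g : mor M' N') :
  retract f g -> retract (fmor F f) (fmor F g).
Proof.
move=> [i [r [j [s [ri sj gi fr]]]]].
exists (fmor F i), (fmor F r), (fmor F j), (fmor F s).
by rewrite -!fmor_comp ri sj gi fr !fmor_id.
Qed.

Lemma fcof_subcategory : subcategory fcof.
Proof.
split=> [M Z u v|M N P g f gm fm Z u v]; first by rewrite fmor_id !comp1m.
by rewrite fmor_comp -!Defs.compA => /gm /fm.
Qed.

Lemma fcof_retract : retract_closed fcof.
Proof.
move=> A B M N f g /fretract [i [r [j [s [ri _ gi _]]]]] gm Z u v uv.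
rewrite -[u]comp1m -[v]comp1m -ri -!Defs.compA; congr mcomp; apply: gm.
by rewrite !Defs.compA gi -!Defs.compA uv.
Qed.

Lemma fweq_subcategory : subcategory fweq.
Proof.
split=> [M|M N P g f gq fq]; rewrite /fweq ?fmor_id ?fmor_comp.
  exact: (quasi_iso_subcategory k G).1.
exact: (quasi_iso_subcategory k G).2 gq fq.
Qed.

Lemma fweq_two_of_three : two_of_three fweq.
Proof. by move=> M N P f g; rewrite /fweq !fmor_comp; exact: quasi_iso_two_of_three. Qed.

Lemma fweq_retract : retract_closed fweq.
Proof. by move=> A B M N f g /fretract; exact: quasi_iso_retract. Qed.

Lemma tcof_cap (M N : ChH) (g : mor M N) : cap_class fcof fweq g <-> tcof g.
Proof. by split=> -[/tinj_monoP gI /tqisoP gQ]. Qed.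

Definition cof_tfib_fact : functorial_factorization ChH := disk_factorization V.
Definition tcof_fib_fact : functorial_factorization ChH := free_factorization (@small_map k G V).

Lemma cof_tfib_factP (M N : ChH) (f : mor M N) :
  [/\ fcof (fact_left cof_tfib_fact f), rlp fcof (fact_right cof_tfib_fact f)
    & fweq (fact_right cof_tfib_fact f)].
Proof.
split.
- by apply/tinj_monoP; exact: disk_left_tinj.
- by move=> A B i /tinj_monoP iI u v sq; exact: prod_disk_lift iI sq.
- by apply/tqisoP; exact: prod_disk_tqiso.
Qed.

Lemma small_injective_rlp (M N : ChH) (q : mor M N) :
  J_injective (@small_map k G V) q -> rlp (@cap_class ChH fcof fweq) q.
Proof.
move=> qJ A B i /tcof_cap iT u v sq.
exact: (@tcof_lifts k G V M N q qJ A B i u v iT sq).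
Qed.

Lemma rlp_small_injective (M N : ChH) (q : mor M N) :
  (forall (A B : ChH) (i : mor A B), tcof i -> lifts i q) ->
  J_injective (@small_map k G V) q.
Proof. by move=> qP j; apply: qP; exact: nm_tcof. Qed.

Lemma tcof_fib_factP (M N : ChH) (f : mor M N) :
  (fcof (fact_left tcof_fib_fact f) /\ fweq (fact_left tcof_fib_fact f)) /\
  rlp (@cap_class ChH fcof fweq) (fact_right tcof_fib_fact f).
Proof.
split; last first.
  apply: small_injective_rlp => j u v sq.
  have [h [_ hi ho]] := free_fillP (f := f) sq.
  by exists h.
(* Both test maps lift against all trivial cofibrations, in particular against the small ones, which
   is all that [free_in_llp] asks. *)
apply/tcof_cap; apply: llp_tcof => u v sq; apply: free_in_llp sq; apply: rlp_small_injective.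
  by move=> A B i iT u' v' sq'; exact: prod_disk_lift iT.1 sq'.
by move=> A B i; exact: test_fib_lifts.
Qed.

Definition transferred : model_structure ChH :=
  assemble fcof_subcategory fcof_retract fweq_subcategory fweq_two_of_three
    fweq_retract cof_tfib_factP tcof_fib_factP.

End Transfer.

Theorem proposition2p21 (k : fieldType) (p : nat) (G : topGroupType)
    (I : open_subgroup G) (chark : p \in [pchar k]) (proI : pro_p p I) :
  exists S : model_structure (Ch (LMod (hecke k I))),
    [/\ forall (M N : Ch (LMod (hecke k I))) (g : mor M N),
          cof S g <-> monomorphism (fmor (tensor_Ch k I) g),
        forall (M N : Ch (LMod (hecke k I))) (g : mor M N),
          weq S g <-> quasi_iso (fmor (tensor_Ch k I) g)
      & forall (M N : Ch (LMod (hecke k I))) (g : mor M N),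
          fib S g <-> rlp (trivial_cofibration S) g].
Proof. by exists (transferred (ind k I)); split. Qed.
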